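(* Consider a (real or complex) dual multibilliard of pencil type (containing at least one conic). The minimal degree of its rational integral is (i) two, if it contains no skew vertices; (ii) $12$, if the pencil has type a) (conics through four distinct points $A,B,C,D$) and the multibilliard contains a pair of neighbor skew vertices, namely a pair of vertices $K_{EL}$ and $K_{ES}$ for some three distinct $E,L,S\in\{A,B,C,D\}$; (iii) four in any other case.
   Context: Basic definitions. Let $\mathbb F=\mathbb R$ or $\mathbb C$. A dual billiard is a smooth (holomorphic) curve $\gamma\subset\mathbb F\mathbb P^2$ with, for each $P\in\gamma$, a non-trivial projective involution $\sigma_P$ of the projective tangent line $L_P$ fixing $P$. A dual billiard structure at a point $Q$ is a family of non-trivial projective involutions $\sigma_{Q,\ell}:\ell\to\ell$ fixing $Q$, defined for lines $\ell\ni Q$ in a nonempty open set of lines. A dual multibilliard is a (possibly infinite) collection of nonlinear connected curves $\gamma_j$ and points $Q_s$ (vertices), each equipped with a dual billiard structure (repetitions with different structures allowed). A rational integral is a non-constant rational function on the plane whose restriction to every tangent line $L_P$ of every $\gamma_j$ is $\sigma_P$-invariant and whose restriction to each line $\ell$ through any vertex $Q$ where $\sigma_{Q,\ell}$ is defined is $\sigma_{Q,\ell}$-invariant; its degree is the degree of the homogeneous numerator and denominator in lowest terms. The structure on a conic $\gamma$ defined by a pencil containing $\gamma$: $\sigma_P$ permutes the (complex) intersection points of $L_P$ with each conic of the pencil (or fixes the intersection point, if unique); it is defined outside finitely many $P$. Involutions at vertices. A projective angular symmetry centered at $A$ is a non-trivial projective involution of $\mathbb{CP}^2$ fixing $A$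 and each line through $A$; it has a line of fixed points not through $A$ (its fixed point line). For a (possibly singular) conic $\mathcal S\not\ni A$ the $\mathcal S$-angular symmetry centered at $A$ is the projective angular symmetry permuting the intersection points with $\mathcal S$ of each line through $A$. For a regular conic $\mathcal S\ni A$ with tangent line $L_A$ at $A$, the degenerate $\mathcal S$-angular symmetry $\sigma_A^{\mathcal S}$ is the birational involution fixing each line $\ell\ne L_A$ through $A$ and acting on $\ell$ as the projective involution fixing $A$ and the other point of $\ell\cap\mathcal S$. A structure at $A$ is global (quasi-global) if it is given by a projective angular symmetry (degenerate $\mathcal S$-angular symmetry). Admissible vertices for a complex pencil of conics (each is called standard or skew): Case a): conics through 4 distinct points $A,B,C,D$ (no three collinear). a1) Standard: $M_1=AB\cap CD$, $M_2=AD\cap BC$, $M_3=AC\cap BD$, $M_j$ with the projective angular symmetry with fixed point line $M_iM_k$, $\{i,j,k\}=\{1,2,3\}$. a2) Skew: for each unordered pair $E\neq L$ in $\{A,B,C,D\}$, $K_{EL}=EL\cap M_iM_j$ where $M_i,M_j\notin EL$, with the projective angular symmetry with fixed point line $ST$, $\{S,T\}=\{A,B,C,D\}\setminus\{E,L\}$. Case b): conics through 3 points $A,B,C$ tangent at $C$ to the same line $L$. b1) Standard: $M=AB\cap L$, projective angular symmetry with fixed point line $CK_{AB}$. b2) Skew: $K_{AB}\in AB$ such that $M,K_{AB},A,B$ is harmonic (the projective involution of $AB$ fixing $M$, $K_{AB}$ permutes $A$, $B$), with fixed point line $L$. b3) Skew: $C$ with the projective angular symmetry with fixed point line $AB$.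 b4) Skew: $C$ with $\sigma_C^{\mathcal S}$, for any regular conic $\mathcal S$ of the pencil. Case c): conics through two points $A,C$, tangent there to given lines $L_A,L_C$ respectively. c1) Standard: $M=L_A\cap L_C$ with fixed point line $AC$; and any $M'\in AC\setminus\{A,C\}$ with the $(L_A\cup L_C)$-angular symmetry. c2) Skew: $A$ (respectively $C$) with the projective angular symmetry with fixed point line $L_C$ (respectively $L_A$). c3) Skew: $A$ (respectively $C$) with the degenerate $\mathcal S_A$- (respectively $\mathcal S_C$-) angular symmetry, for any regular conic $\mathcal S_A$ ($\mathcal S_C$) of the pencil. Case d): conics through two distinct points $A,B$, tangent to each other at $A$ with contact of order three, with common tangent line $L$ at $A$. d1) Skew: $A$ with $\sigma_A^{\mathcal S}$ for any regular conic $\mathcal S$ of the pencil. d2) Skew: any $C\in L\setminus\{A\}$ with the projective angular symmetry with fixed point line $AB$. Case e): conics through one point $A$, tangent to each other there with contact of order four, with common tangent line $L$. e1) Skew: $A$ with $\sigma_A^{\mathcal S}$ for any regular conic $\mathcal S$ of the pencil. e2) Standard: any $C\in L\setminus\{A\}$ with the projective angular symmetry whose fixed point line is the set of points $D$ for which $CD$ is tangent at $D$ to the conic of the pencil through $D$ (including $D=A$). For a real pencil, the real admissible vertices are those of the complexified pencil (whose base points may be non-real) for which the vertex and its involution are real. Pencil type multibilliard: a (real or complex) dual multibilliard such that 1) all its curves are conics lying in one pencil, with dual billiard structures defined by this pencil (one conic is possible); 2) all its vertices are admissible for the pencil; 3) if it contains a skew vertex with a quasi-global structure, then it contains no other skew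 vertex, with the following exceptions: in Case c) the skew vertices may be the pair $A$, $C$ with quasi-global structures defined by one and the same (arbitrary) regular conic $\mathcal S=\mathcal S_A=\mathcal S_C$ of the pencil; in Case d) the skew vertices may be a pair $A$, $C$ defined by a regular conic $\mathcal S$ of the pencil: $A$ with $\sigma_A^{\mathcal S}$, and $C$ the intersection of $L$ with the tangent line to $\mathcal S$ at $B$, with the projective angular symmetry with fixed point line $AB$; 4) in Case d) it contains at most one vertex $C\in L\setminus\{A\}$; 5) each skew admissible vertex that a priori admits several structures is included with no more than one structure; these vertices are: in Case b) the vertex $C$ (with the global structure b3) or one of the quasi-global structures b4) given by different regular conics $\mathcal S$ of the pencil); in Case c) each of the vertices $A$ and $C$ (with the global structure c2) or one of the quasi-global structures c3)); in Cases d) and e) the vertex $A$ (with one of the quasi-global structures d1), respectively e1), given by different regular conics $\mathcal S$ of the pencil). *)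

(* Defs.v *)
From mathcomp Require Export all_boot all_order all_algebra.
From mathcomp Require Export reals complex mpoly.

Set Implicit Arguments.
Unset Strict Implicit.
Unset Printing Implicit Defensive.

Import GRing.Theory Num.Theory.
Local Open Scope ring_scope.
Local Open Scope complex_scope.

(** * Projective plane

    A projective subspace of P^2(F) is a linear subspace of F^3: points have
    dimension 1, lines have dimension 2.  Hence the line through p and q is
    [(p + q)%VS], the intersection of l and m is [(l :&: m)%VS], incidence is
    [(p <= l)%VS], and a projective transformation is induced by
    [f : 'End('rV[F]_3)] via [(f @: p)%VS]. *)

Section ProjectivePlane.
Variable F : fieldType.
Local Notation subspace := {vspace 'rV[F]_3}.
Implicit Types (p q l A : subspace) (f : 'End('rV[F]_3)) (S : 'M[F]_3).

Definition is_point p : bool := \dim p == 1%N.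
Definition is_line l : bool := \dim l == 2%N.
Definition point_on p l : bool := is_point p && (p <= l)%VS.

(** [f] induces a non-trivial projective involution of the projective subspace
    [l] (a line, or the whole plane [fullv]); on a line [l] the values of [f]
    outside [l] are irrelevant. *)
Definition proj_involution l f : Prop :=
  [/\ (f @: l)%VS = l,
      forall p, point_on p l -> (f @: (f @: p))%VS = p
    & exists2 p, point_on p l & (f @: p)%VS <> p].

(** Conics are given by nonzero symmetric matrices (up to scaling). *)

Definition polar_form S (u v : 'rV[F]_3) : F := (u *m S *m v^T) 0 0.
Definition is_conic S : Prop := S^T = S /\ S != 0.
Definition regular S : bool := S \in unitmx.
Definition on_conic S p : Prop :=
  forall u, u \in p -> polar_form S u u = 0.

(** For a conic which is singular at [p] every line through [p] qualifies. *)
Definition tangent_at S p l : Prop :=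
  [/\ is_line l, point_on p l
    & forall u v, u \in p -> v \in l -> polar_form S u v = 0].

(** [f] exchanges the two intersection points of [l] with [S], or fixes the
    intersection point if there is only one. *)
Definition permutes_intersection f l S : Prop :=
  forall x, point_on x l -> on_conic S x ->
    (forall y, point_on y l -> on_conic S y -> y <> x -> (f @: x)%VS = y) /\
    ((forall y, point_on y l -> on_conic S y -> y = x) -> (f @: x)%VS = x).

(** [S] and [S'] have contact of order exactly [k] (intersection multiplicity)
    at [p]: the order of vanishing of [S'] along an immersed local
    parametrization [phi] of [S] with [phi 0 = p]. *)
Definition contact_order S S' p (k : nat) : Prop :=
  exists phi : 'rV[{poly F}]_3,
    let along T := (phi *m map_mx polyC T *m phi^T) 0 0 in
    [/\ p = <[map_mx (fun c => c.[0]) phi]>%VS,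
        map_mx (fun c => c^`().[0]) phi \notin p,
        along S = 0
      & 'X^k %| along S' /\ ~~ ('X^(k.+1) %| along S')].

(** ** Dual multibilliards

    Families of involutions are given by their graphs. *)

(** [invol P x y] means that sigma_P is defined and maps the point [x] of the
    tangent line at [P] to [y]. *)
Record dual_billiard := DualBilliard {
  curve : subspace -> Prop;
  tangent_line : subspace -> subspace -> Prop;
  invol : subspace -> subspace -> subspace -> Prop
}.

(** [reflect_on l x y] means that the involution of the line [l] through the
    vertex is defined and maps the point [x] of [l] to [y]. *)
Record vertex := Vertex {
  center : subspace;
  reflect_on : subspace -> subspace -> subspace -> Prop
}.

(** Collections are sets: the same curve or the same point may occur several
    times, with different structures. *)
Record multibilliard := Multibilliard {
  curves : dual_billiard -> Prop;
  vertices : vertex -> Prop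
}.

Definition reflection_defined (v : vertex) l : Prop :=
  exists x y, reflect_on v l x y.

Definition invariant_pair (N D : {mpoly F[3]}) (x y : subspace) : Prop :=
  forall u w, u \in x -> w \in y ->
    N.@[fun i => u 0 i] * D.@[fun i => w 0 i]
    = N.@[fun i => w 0 i] * D.@[fun i => u 0 i].

(** The rational function N/D, in lowest terms and of degree [d], is a
    rational integral.  As N and D are coprime they do not both vanish
    identically on a line, so the cross-multiplied identity is exactly the
    invariance of the restriction of N/D, as a map to the projective line. *)
Definition rational_integral (B : multibilliard) (d : nat)
    (N D : {mpoly F[3]}) : Prop :=
  [/\ [/\ N \is d.-homog, D \is d.-homog & D != 0],
      forall p q r : {mpoly F[3]}, N = p * q -> D = p * r ->
        p \is a GRing.unit,
      forall c : F, N <> c *: D,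
      forall g, curves B g ->
        forall P x y, invol g P x y -> invariant_pair N D x y
    & forall v, vertices B v ->
        forall l x y, reflect_on v l x y -> invariant_pair N D x y].

Definition minimal_integral_degree (B : multibilliard) (d : nat) : Prop :=
  (exists N D, rational_integral B d N D) /\
  (forall d' N D, rational_integral B d' N D -> (d <= d')%N).

Definition is_pencil (P : {vspace 'M[F]_3}) : Prop :=
  \dim P = 2%N /\ forall S, S \in P -> S^T = S.

Definition pencil_conic (P : {vspace 'M[F]_3}) S : Prop :=
  S \in P /\ S != 0.

Definition base_point (P : {vspace 'M[F]_3}) p : Prop :=
  is_point p /\ forall S, pencil_conic P S -> on_conic S p.

(** An involution of the tangent line [l] at [p] defined by the pencil [P]. *)
Definition pencil_involution (P : {vspace 'M[F]_3}) p l f : Prop :=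
  [/\ proj_involution l f, (f @: p)%VS = p
    & forall S, pencil_conic P S -> permutes_intersection f l S].

Section PencilTypes.
Variable P : {vspace 'M[F]_3}.
Implicit Types (B C D L LA LC : subspace).

Definition type_a A B C D : Prop :=
  [/\ [/\ is_point A, is_point B, is_point C & is_point D],
      [/\ is_line (A + B)%VS, is_line (A + C)%VS, is_line (A + D)%VS,
          is_line (B + C)%VS & is_line (B + D)%VS /\ is_line (C + D)%VS],
      [/\ ~~ (C <= A + B)%VS, ~~ (D <= A + B)%VS, ~~ (D <= A + C)%VS
        & ~~ (D <= B + C)%VS]
    & forall S, pencil_conic P S <->
        is_conic S /\ [/\ on_conic S A, on_conic S B, on_conic S C
                        & on_conic S D]].

Definition type_b A B C L : Prop :=
  [/\ [/\ is_point A, is_point B, is_point C & is_line L],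
      is_line (A + B)%VS /\ ~~ (C <= A + B)%VS,
      [/\ (C <= L)%VS, ~~ (A <= L)%VS & ~~ (B <= L)%VS]
    & forall S, pencil_conic P S <->
        is_conic S /\ [/\ on_conic S A, on_conic S B & tangent_at S C L]].

Definition type_c A C LA LC : Prop :=
  [/\ [/\ is_point A, is_point C, is_line LA & is_line LC],
      (A <= LA)%VS /\ ~~ (C <= LA)%VS,
      (C <= LC)%VS /\ ~~ (A <= LC)%VS
    & forall S, pencil_conic P S <->
        is_conic S /\ tangent_at S A LA /\ tangent_at S C LC].

(** The regular conics of the pencil are tangent to [L] at [A], and to each
    other there with contact of order [k]. *)
Definition mutual_contact A L (k : nat) : Prop :=
  [/\ exists2 S, pencil_conic P S & regular S,
      forall S, pencil_conic P S -> on_conic S A,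
      forall S, pencil_conic P S -> regular S -> tangent_at S A L
    & forall S S', pencil_conic P S -> regular S ->
        pencil_conic P S' -> regular S' -> S' \notin <[S]>%VS ->
        contact_order S S' A k].

Definition type_d A B L : Prop :=
  [/\ [/\ is_point A, is_point B & is_line L],
      A <> B,
      forall S, pencil_conic P S -> on_conic S B
    & mutual_contact A L 3].

Definition type_e A L : Prop :=
  [/\ is_point A, is_line L & mutual_contact A L 4].

End PencilTypes.

Definition angular_symmetry A f : Prop :=
  [/\ proj_involution fullv f, (f @: A)%VS = A
    & forall l, is_line l -> (A <= l)%VS -> (f @: l)%VS = l].

Definition fixed_point_line A f l : Prop :=
  [/\ is_line l, ~~ (A <= l)%VS
    & forall p, point_on p l -> (f @: p)%VS = p].

Definition given_by (v : vertex) f : Prop :=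
  forall l x y, reflect_on v l x y <->
    [/\ is_line l, (center v <= l)%VS, point_on x l & y = (f @: x)%VS].

Definition global_vertex A l (v : vertex) : Prop :=
  center v = A /\
  exists f, [/\ angular_symmetry A f, fixed_point_line A f l & given_by v f].

(** The S-angular symmetry centered at a point A outside S. *)
Definition conic_global_vertex A S (v : vertex) : Prop :=
  [/\ center v = A, ~ on_conic S A
    & exists f, [/\ angular_symmetry A f,
        forall l, is_line l -> (A <= l)%VS -> permutes_intersection f l S
      & given_by v f]].

(** The degenerate S-angular symmetry centered at a point A of S. *)
Definition quasi_global_vertex A S (v : vertex) : Prop :=
  [/\ center v = A, is_point A /\ on_conic S A, is_conic S /\ regular S
    & forall l x y, reflect_on v l x y <->
        [/\ is_line l, (A <= l)%VS, ~ tangent_at S A l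
          & exists f, [/\ proj_involution l f, (f @: A)%VS = A,
              exists Q, [/\ point_on Q l, Q <> A, on_conic S Q
                          & (f @: Q)%VS = Q]
            & point_on x l /\ y = (f @: x)%VS]]].

(** Admissibility is meant over an algebraically closed field. *)

Section Admissible.
Variable P : {vspace 'M[F]_3}.
Implicit Types (B C D E X Y T L LA LC M K : subspace) (v : vertex).

(** K_{EL} for base points E, L; the other two base points are X, Y. *)
Definition K_point (E L X Y : subspace) : subspace :=
  ((E + L) :&: (((E + X) :&: (L + Y)) + ((E + Y) :&: (L + X))))%VS.

Definition skew_K_vertex (E L X Y : subspace) v : Prop :=
  type_a P E L X Y /\ global_vertex (K_point E L X Y) (X + Y)%VS v.

(** M, K, A, B is harmonic, where M is the intersection of AB and L. *)
Definition harmonic_K A B L K : Prop :=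
  let M := ((A + B) :&: L)%VS in
  [/\ point_on K (A + B)%VS, K <> M
    & exists f, [/\ proj_involution (A + B)%VS f, (f @: M)%VS = M,
                    (f @: K)%VS = K & (f @: A)%VS = B /\ (f @: B)%VS = A]].

Definition conic_is_line_pair S l m : Prop :=
  is_conic S /\
  forall p, is_point p -> (on_conic S p <-> (p <= l)%VS \/ (p <= m)%VS).

(** [l] is the set of the points D such that CD is tangent at D to
    the conic of the pencil through D, including D = A.  For conics with fourth
    order contact at A that conic has to be regular: through a point D <> A of
    the common tangent line the only conic is that line counted twice. *)
Definition tangency_line A C l : Prop :=
  is_line l /\
  forall D, is_point D -> ((D <= l)%VS <->
    D = A \/ exists S, [/\ pencil_conic P S, regular S
                         & tangent_at S D (C + D)%VS]).

Inductive standard_vertex v : Prop :=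
| StandardA1 A B C D of type_a P A B C D
    & global_vertex ((A + B) :&: (C + D))
        (((A + D) :&: (B + C)) + ((A + C) :&: (B + D))) v
| StandardB1 A B C L K of type_b P A B C L & harmonic_K A B L K
    & global_vertex ((A + B) :&: L) (C + K) v
| StandardC1 A C LA LC of type_c P A C LA LC
    & global_vertex (LA :&: LC) (A + C) v
| StandardC1' A C LA LC M' S of type_c P A C LA LC
    & point_on M' (A + C) & M' <> A & M' <> C
    & conic_is_line_pair S LA LC & conic_global_vertex M' S v
| StandardE2 A L C l of type_e P A L & point_on C L & C <> A
    & tangency_line A C l & global_vertex C l v.

Inductive skew_global_vertex v : Prop :=
| SkewA2 E L X Y of skew_K_vertex E L X Y v
| SkewB2 A B C L K of type_b P A B C L & harmonic_K A B L K
    & global_vertex K L v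
| SkewB3 A B C L of type_b P A B C L & global_vertex C (A + B) v
| SkewC2 A C LA LC of type_c P A C LA LC & global_vertex A LC v
    (* by symmetry of type_c in (A, LA) and (C, LC) this also covers C *)
| SkewD2 A B L C of type_d P A B L & point_on C L & C <> A
    & global_vertex C (A + B) v.

Inductive skew_quasi_global_vertex v : Prop :=
| SkewB4 A B C L S of type_b P A B C L & pencil_conic P S
    & quasi_global_vertex C S v
| SkewC3 A C LA LC S of type_c P A C LA LC & pencil_conic P S
    & quasi_global_vertex A S v
| SkewD1 A B L S of type_d P A B L & pencil_conic P S
    & quasi_global_vertex A S v
| SkewE1 A L S of type_e P A L & pencil_conic P S
    & quasi_global_vertex A S v.

Definition skew_vertex v : Prop :=
  skew_global_vertex v \/ skew_quasi_global_vertex v.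

Definition admissible_vertex v : Prop := standard_vertex v \/ skew_vertex v.

(** The pairs of skew vertices allowed although one is quasi-global. *)
Inductive exceptional_pair v w : Prop :=
| ExceptionC A C LA LC S of type_c P A C LA LC & pencil_conic P S
    & quasi_global_vertex A S v & quasi_global_vertex C S w
| ExceptionD A B L S T C of type_d P A B L & pencil_conic P S
    & quasi_global_vertex A S v
    & tangent_at S B T & C = (L :&: T)%VS & global_vertex C (A + B) w.

(** The compatibility conditions on the set [W] of all vertices. *)

Definition quasi_global_condition (W : vertex -> Prop) : Prop :=
  forall v w, W v -> W w -> skew_quasi_global_vertex v -> skew_vertex w ->
    w = v \/ exceptional_pair v w.

Definition case_d_condition (W : vertex -> Prop) : Prop :=
  forall A B L, type_d P A B L ->
  forall v w, W v -> W w ->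
    (center v <= L)%VS -> center v <> A ->
    (center w <= L)%VS -> center w <> A -> v = w.

(** For points admitting only one skew structure this holds automatically. *)
Definition single_structure_condition (W : vertex -> Prop) : Prop :=
  forall v w, W v -> W w -> skew_vertex v -> skew_vertex w ->
    center v = center w -> v = w.

Definition has_skew_vertex (W : vertex -> Prop) : Prop :=
  exists2 v, W v & skew_vertex v.

Definition has_neighbor_skew_vertices (W : vertex -> Prop) : Prop :=
  exists E L X Y v w, [/\ W v, W w, skew_K_vertex E L X Y v
                        & skew_K_vertex E X L Y w].

End Admissible.
End ProjectivePlane.

(** * General axioms of dual multibilliards

    Smoothness of the curves is not part of this predicate: below, all curves
    are regular conics with their tangent lines. *)

Section GeneralNotion.
Variable F : numFieldType.

Definition dual_billiard_axioms (g : dual_billiard F) : Prop :=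
  (exists s : seq {vspace 'rV[F]_3}, forall p, curve g p -> p \notin s ->
     exists x y, invol g p x y) /\
  (forall p, (exists x y, invol g p x y) -> curve g p /\
     exists l f, [/\ tangent_line g p l, point_on p l, is_line l,
        proj_involution l f
      & (f @: p)%VS = p /\
        forall x y, invol g p x y <-> point_on x l /\ y = (f @: x)%VS]).

(** The last item says that the set of the lines [center v + <[u]>] on which
    the involution is defined is open, in terms of the direction [u]. *)
Definition vertex_axioms (v : vertex F) : Prop :=
  [/\ is_point (center v),
      exists l, reflection_defined v l,
      forall l, reflection_defined v l ->
        [/\ is_line l, (center v <= l)%VS
          & exists f, [/\ proj_involution l f, (f @: center v)%VS = center v
              & forall x y,
                  reflect_on v l x y <-> point_on x l /\ y = (f @: x)%VS]]
    & forall u, reflection_defined v (center v + <[u]>)%VS ->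
        exists2 e : F, 0 < e & forall u' : 'rV[F]_3,
          (forall i, `|u' 0 i - u 0 i| < e) ->
          reflection_defined v (center v + <[u']>)%VS].

Definition is_dual_multibilliard (B : multibilliard F) : Prop :=
  (forall g, curves B g -> dual_billiard_axioms g) /\
  (forall v, vertices B v -> vertex_axioms v).

End GeneralNotion.

(** * Real and complex multibilliards of pencil type

    [iota] is the inclusion of the ground field F (the reals or the complex
    numbers) in the complex numbers K. *)

Section PencilType.
Variables (F K : numFieldType) (iota : {rmorphism F -> K}).

(** Complexification of a linear subspace (the K-span of its elements). *)
Definition complexify m n (U : {vspace 'M[F]_(m, n)}) : {vspace 'M[K]_(m, n)} :=
  <<map (map_mx iota) (vbasis U)>>%VS.

(** The vertex [v] over F is real for the structure [w] over K: its center is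
    that of [w], and the involutions of [w] restrict to those of [v]. *)
Definition vertex_complexification (v : vertex F) (w : vertex K) : Prop :=
  [/\ center w = complexify (center v),
      forall l x y, reflect_on v l x y <->
        [/\ is_line l, is_point x, is_point y
          & reflect_on w (complexify l) (complexify x) (complexify y)]
    & forall l x z, is_line l -> is_point x ->
        reflect_on w (complexify l) (complexify x) z ->
        exists2 y, is_point y & z = complexify y].

(** [g] is a regular conic of the pencil [P] with a point over F, with the dual
    billiard structure defined by [P].  At a base point the permutation
    condition does not determine an involution. *)
Definition pencil_billiard (P : {vspace 'M[F]_3}) (g : dual_billiard F) : Prop :=
  exists S, [/\ pencil_conic P S, regular S, exists p, curve g p,
    forall p, curve g p <-> is_point p /\ on_conic S p
  & (forall p l, tangent_line g p l <-> curve g p /\ tangent_at S p l) /\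
    (forall p x y, invol g p x y <->
       [/\ curve g p, ~ base_point P p
         & exists l f, [/\ tangent_line g p l, point_on x l, is_point y,
             pencil_involution (complexify P) (complexify p) (complexify l) f
           & complexify y = (f @: complexify x)%VS]])].

(** The vertices of [B], with their admissible complexified structures. *)
Definition complex_vertices (P : {vspace 'M[F]_3}) (B : multibilliard F)
    (w : vertex K) : Prop :=
  exists v, [/\ vertices B v, vertex_complexification v w
              & admissible_vertex (complexify P) w].

Definition pencil_type (P : {vspace 'M[F]_3}) (B : multibilliard F) : Prop :=
  let PC := complexify P in
  let W := complex_vertices P B in
  [/\ is_dual_multibilliard B /\ is_pencil P,
      forall g, curves B g -> pencil_billiard P g,
      forall v, vertices B v ->
        exists2 w, vertex_complexification v w & admissible_vertex PC w,
      quasi_global_condition PC W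
    & case_d_condition PC W /\ single_structure_condition PC W].

End PencilType.

Variant ground := RealGround | ComplexGround.

Definition scalars (R : realType) (k : ground) : numFieldType :=
  match k with RealGround => R | ComplexGround => R[i] end.

Definition embedding (R : realType) (k : ground) :
    {rmorphism scalars R k -> R[i]} :=
  match k return {rmorphism scalars R k -> R[i]} with
  | RealGround => real_complex R
  | ComplexGround => idfun
  end.

(* Main.v *)
(** A rational integral N/D is determined by its restriction to one regular
    conic of the multibilliard, parametrized as a parabola.  Invariance on the
    tangent lines kills the Wronskian of the two restrictions, so these are
    proportional; repeating this, a combination of k+1 invariant functions with
    a common denominator vanishes on the conic to order k.  Applied to the
    products of N and D with the forms of degree d/2 in two conics q1, q2 of the
    pencil this gives a(q1, q2) D = b(q1, q2) N: every integral is a rational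
    function of the parameter q1/q2 of the pencil, of degree at most d/2.

    Each admissible vertex acts on the pencil: trivially if it is standard, and
    by an involution if it is skew.  Apart from neighbors, all skew vertices
    induce the same involution, given by its two fixed conics, and an invariant
    function of the parameter has degree at least 2; for F the reals a
    quadratic function defined over F is found by taking the real or imaginary
    part of the relation between exchanged conics.  Two neighbors generate the
    permutations of the three line pairs through the base points, with general
    orbits of six elements; the invariant of degree 6 is e_2^3/e_3^2 for the
    symmetric functions e_i of the three line pairs, whose sum is zero. *)

From HB Require Import structures.
Require Import Defs.
From mathcomp Require Import boolp ring zify.

Set Implicit Arguments.
Unset Strict Implicit.
Unset Printing Implicit Defensive.

Import GRing.Theory Num.Theory.

(** The involution of a tangent line fixes the point of tangency with derivative -1, so an invariant
    function has derivative zero there; this is why the Wronskian vanishes. The number of functions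
    is dictated by degrees: for m = floor(d/2) there are 2m+2 products of N and D with the monomials
    of degree m in q1, q2, so some combination vanishes on the conic to order 2m+1. Its degree 2m+d
    is below the degree 4m+2 of that power of the conic, hence it is zero.

    Two obstacles shape the rest. The vertices are classified over the complex numbers, while
    integrals and curves live over the ground field and a vertex acts only on an open set of lines;
    genericity is therefore expressed by polynomials along lines over the ground field. And each
    vertex carries its own labelling of the base points, so two vertices can be compared only
    through data intrinsic to the pencil, such as its singular conics and the base points at which
    they are singular. *)

Definition horner_simp := (hornerD, hornerN, hornerZ, hornerC, hornerX, hornerXn,
  hornerMn, hornerM, horner_exp).

(** * Involutions on the tangent lines of a parabola *)

Section TangentInvariants.
Local Open Scope ring_scope.
Variable F : numFieldType.
Implicit Types (p q y z : {poly F}) (n d h : {poly {poly F}}).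

(** The exceptions are listed as values of an injective [g], because a billiard structure is
    undefined at finitely many points of the conic, which [g] parametrizes. Among [size p + size s]
    integers at most [size s] are exceptional. *)
Lemma poly_eq0_cofinite (T : eqType) (g : F -> T) (s : seq T) p :
  injective g -> (forall t, g t \notin s -> root p t) -> p = 0.
Proof.
move=> g_inj rp; apply: contrapT => /eqP p0.
pose ts := [seq i%:R : F | i <- iota 0 (size p + size s)].
have uts : uniq ts.
  by rewrite map_inj_uniq ?iota_uniq // => i j /eqP; rewrite eqr_nat => /eqP.
have := max_poly_roots p0 (rs := [seq t <- ts | g t \notin s]).
have -> : all (root p) [seq t <- ts | g t \notin s].
  by apply/allP => t; rewrite mem_filter => /andP[/rp].
rewrite filter_uniq // => /(_ isT isT); rewrite size_filter ltnNge => /negP; apply.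
have /eqP := count_predC (fun t => g t \in s) ts.
rewrite size_map size_iota => /eqP e.
have le_s : (count (fun t => g t \in s) ts <= size s)%N.
  rewrite -size_filter -(size_map g); apply: uniq_leq_size.
    by rewrite map_inj_uniq ?filter_uniq.
  by move=> x /mapP[t]; rewrite mem_filter => /andP[ts' _] ->.
by rewrite -(leq_add2r (size s)) -e addnC leq_add2l.
Qed.

Lemma poly_eq0_all p : (forall t, root p t) -> p = 0.
Proof. by move=> rp; apply: (@poly_eq0_cofinite F id [::]). Qed.

Lemma poly_neq0_value p : p != 0 -> exists t, p.[t] != 0.
Proof.
move=> /eqP p0; apply: contrapT => np; apply: p0; apply: poly_eq0_all => t.
by apply: contrapT => rt; apply: np; exists t; apply/negP.
Qed.

(** Choose [t] with [q.[t] != 0] and subtract the multiple of [q] that agrees with [p] at [t]. The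
    difference [r] still satisfies the identity; if it vanished at [t] to a finite positive order
    k+1, then r' q would vanish to order exactly k and r q' to order at least k+1. *)
Lemma wronskian_eq0 p q : q != 0 -> p^`() * q = p * q^`() ->
  exists c, p = c *: q.
Proof.
move=> q0 W; have [t qt] := poly_neq0_value q0.
exists (p.[t] / q.[t]); apply/eqP; rewrite -subr_eq0; set r := p - _.
have Wr : r^`() * q = r * q^`().
  by rewrite /r derivB derivZ !mulrBl W -!scalerAl [q^`() * q]mulrC.
apply: contrapT => /negP r0.
have rt : root r t by rewrite rootE !hornerE divfK // subrr.
have [[|k] [r1]] := multiplicity_XsubC r t; rewrite r0 /= => r1t er.
  by move: rt; rewrite er mulr1 (negPf r1t).
move: Wr; rewrite er derivM deriv_exp derivXsubC mul1r => Wr.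
have {}Wr : ('X - t%:P) ^+ k *
   ((r1^`() * ('X - t%:P) + r1 *+ k.+1) * q - r1 * ('X - t%:P) * q^`()) = 0.
  move/eqP: Wr; rewrite -subr_eq0 => /eqP Wr; apply: (etrans _ Wr).
  rewrite /= exprS -[_ ^+ k *+ _]mulr_natr -[r1 *+ _]mulr_natr.
  set a := k.+1%:R; move: a (r1^`()) (q^`()) => a b c.
  by move: ('X - _) => X; move: (X ^+ k) => E; ring.
move/eqP: Wr; rewrite mulf_eq0 expf_eq0 polyXsubC_eq0 andbF /= => /eqP Wr.
have := congr1 (horner^~ t) Wr; rewrite /= !hornerE subrr !(mulr0, mul0r) add0r subr0.
move/eqP; rewrite mulf_eq0 (negPf qt) orbF hornerMn mulrn_eq0 /=.
by move: r1t; rewrite rootE => /negPf->.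
Qed.

(** [n : {poly {poly F}}] is a polynomial in [Y] (inner) and [Z] (outer
    variable); [subst2 y z n] is [n(y, z)]. *)
Definition subst2 y z n : {poly F} := (map_poly (comp_poly y) n).[z].

Lemma subst2C y z p : subst2 y z p%:P = p \Po y.
Proof. by rewrite /subst2 map_polyC hornerC. Qed.
Lemma subst2X y z : subst2 y z 'X = z.
Proof. by rewrite /subst2 map_polyX hornerX. Qed.
Lemma subst2D y z : {morph subst2 y z : n d / n + d}.
Proof. by move=> n d; rewrite /subst2 rmorphD hornerD. Qed.
Lemma subst2M y z : {morph subst2 y z : n d / n * d}.
Proof. by move=> n d; rewrite /subst2 rmorphM hornerM. Qed.
Lemma subst2B y z : {morph subst2 y z : n d / n - d}.
Proof. by move=> n d; rewrite /subst2 rmorphB hornerE hornerN. Qed.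

Definition value2 (a b : F) n : F := n.[b%:P].[a].

Lemma value2M a b : {morph value2 a b : n d / n * d}.
Proof. by move=> n d; rewrite /value2 !hornerM. Qed.
Lemma value2B a b : {morph value2 a b : n d / n - d}.
Proof. by move=> n d; rewrite /value2 !(hornerD, hornerN). Qed.
Lemma value2C a b c : value2 a b c%:P%:P = c.
Proof. by rewrite /value2 !hornerC. Qed.

Lemma horner_subst2 y z n s : (subst2 y z n).[s] = value2 y.[s] z.[s] n.
Proof.
elim/poly_ind: n => [|n p IH]; first by rewrite /subst2 /value2 rmorph0 !hornerE.
rewrite subst2D subst2M subst2X subst2C !hornerE IH /value2 !hornerE.
by rewrite horner_comp.
Qed.

Lemma subst2_comp y z w n : subst2 y z n \Po w = subst2 (y \Po w) (z \Po w) n.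
Proof.
elim/poly_ind: n => [|n p IH].
  by rewrite /subst2 !rmorph0 !horner0 comp_poly0.
by rewrite !subst2D !subst2M !subst2X !subst2C comp_polyD comp_polyM IH comp_polyA.
Qed.

(** Used for the tangent line against the parabola: their outer coordinates differ by a square, so
    the two restrictions agree to first order. *)
Lemma subst2_congr y z z' n :
  exists k, subst2 y z n - subst2 y z' n = k * (z - z').
Proof.
rewrite /subst2; move: (map_poly _ n) => g.
have /factor_theorem[k eg] : root (g - (g.[z'])%:P) z'.
  by rewrite rootE !(hornerE, hornerN) subrr.
exists k.[z]; have := congr1 (horner^~ z) eg.
by rewrite /= !(hornerE, hornerN).
Qed.

Definition on_parabola n := subst2 'X 'X^2 n.
Definition parabola : {poly {poly F}} := 'X - ('X^2)%:P.

Lemma parabola_dvd n : on_parabola n = 0 -> exists h, n = parabola * h.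
Proof.
move=> n0; have /factor_theorem[h ->] : root n 'X^2.
  rewrite rootE -n0 /on_parabola /subst2 (@map_poly_id _ (comp_poly 'X)) //.
  by move=> c _; rewrite /= comp_polyXr.
by exists h; rewrite mulrC.
Qed.

Lemma on_parabolaM n d : on_parabola (n * d) = on_parabola n * on_parabola d.
Proof. exact: subst2M. Qed.

Lemma on_parabola_eq : on_parabola parabola = 0.
Proof. by rewrite /on_parabola subst2B subst2X subst2C comp_polyXr subrr. Qed.

Lemma parabola_neq0 : parabola != 0.
Proof. by rewrite /parabola polyXsubC_eq0. Qed.

(** Restriction to the parabola is multiplicative with values in a domain, and its kernel is
    generated by [parabola]; so [d], nonzero there, is cancelled one power at a time. *)
Lemma parabola_exp_cancel k n d h : on_parabola d != 0 ->
  n * d = parabola ^+ k * h -> exists h', n = parabola ^+ k * h'.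
Proof.
move=> d0; elim: k n h => [|k IH] n h e; first by exists n; rewrite mul1r.
have /parabola_dvd[g eg] : on_parabola n = 0.
  have /eqP := congr1 on_parabola e.
  rewrite exprS -mulrA !on_parabolaM on_parabola_eq mul0r mulf_eq0 (negPf d0) orbF.
  by move/eqP.
move: e; rewrite eg exprS -!mulrA => /(mulfI parabola_neq0)/IH[h' ->].
by exists h'; rewrite mulrA.
Qed.

(** In the affine coordinate [s] of the tangent line to the parabola at
    [(t, t^2)], an involution fixing the point [s = 0] is
    [s |-> - s / (1 + delta s)]. *)
Variable T : F -> F -> Prop.

Definition tangent_value t s n := value2 (t + s) (t ^+ 2 + t * s *+ 2) n.

Definition tangent_invariant n d := forall t delta, T t delta ->
  forall s, 1 + delta * s != 0 ->
  let s' := - s / (1 + delta * s) in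
  tangent_value t s n * tangent_value t s' d
  = tangent_value t s' n * tangent_value t s d.

Lemma tangent_valueM t s n d :
  tangent_value t s (n * d) = tangent_value t s n * tangent_value t s d.
Proof. exact: value2M. Qed.

(** The pullback of [p] under s |-> -s / (1 + delta s), cleared of its denominator by the [m]-th
    power of 1 + delta s. *)
Definition flip (delta : F) (m : nat) p : {poly F} :=
  \sum_(i < m) p`_i *: ((- 'X) ^+ i * (1 + delta *: 'X) ^+ (m - i)).

Lemma horner_flip delta m p s : (size p <= m)%N -> 1 + delta * s != 0 ->
  (flip delta m p).[s]
  = (1 + delta * s) ^+ m * p.[- s / (1 + delta * s)].
Proof.
move=> sp nz; rewrite /flip horner_sum (horner_coef_wide _ sp) mulr_sumr.
apply: eq_bigr => i _; rewrite !horner_simp.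
move: (1 + _ * _) nz => v nz.
have -> : v ^+ m = v ^+ (m - i) * v ^+ i by rewrite -exprD subnK // ltnW.
rewrite exprMn exprVn; move: (v ^+ i) (expf_neq0 i nz) => w w0.
by field.
Qed.

(** The 1-jet at the fixed point. The exponent [m.+2] guarantees that both low terms occur in the
    sum. *)
Lemma flip_low delta m p :
  (flip delta m.+2 p).[0] = p`_0 /\
  (flip delta m.+2 p)^`().[0] = delta *+ m.+2 * p`_0 - p`_1.
Proof.
have [k ->] : exists k, flip delta m.+2 p = p`_0 *: (1 + delta *: 'X) ^+ m.+2
    - p`_1 *: ('X * (1 + delta *: 'X) ^+ m.+1) + 'X^2 * k.
  exists (\sum_(i < m) p`_i.+2 *: ((- 'X) ^+ i * (1 + delta *: 'X) ^+ (m - i))).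
  rewrite /flip !big_ord_recl /= mulr_sumr addrA; congr (_ + _ + _).
  - by rewrite subn0 mul1r.
  - by rewrite subSS subn0 expr1 mulNr scalerN.
  - apply: eq_bigr => i _; rewrite /bump /= !add1n !subSS !exprS -scalerAr.
    by congr (_ *: _); ring.
split; first by rewrite !horner_simp mulr0 addr0 expr1n; ring.
rewrite !(derivD, derivN, derivZ, derivM, derivX, deriv_exp, derivC) /=.
rewrite !horner_simp ?(mulr0, addr0) ?expr1n ?mulr1; ring.
Qed.

(** Along the tangent line the difference of the two sides of the invariance relation, cleared of
    denominators, is a polynomial that vanishes identically. Its derivative at the fixed point s = 0
    is twice the Wronskian: the involution has derivative -1 there, and the terms with [delta]
    cancel. *)
Lemma tangent_wronskian n d t delta : tangent_invariant n d -> T t delta ->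
  ((on_parabola n)^`() * on_parabola d - on_parabola n * (on_parabola d)^`()).[t]
  = 0.
Proof.
move=> inv Tt.
pose r k := subst2 ('X + t%:P) ((t ^+ 2)%:P + (t *+ 2) *: 'X) k.
have rv k s : (r k).[s] = tangent_value t s k.
  rewrite horner_subst2 !hornerE /tangent_value addrC; congr value2.
  by rewrite mulrnAl.
(* The tangent line agrees with the parabola to first order, so the restriction [r k] has at 0 the
   value and the derivative of [on_parabola k] at [t]. *)
have low k : (r k)`_0 = (on_parabola k).[t] /\ (r k)`_1 = (on_parabola k)^`().[t].
  have [g eg] := subst2_congr ('X + t%:P) (('X + t%:P) ^+ 2)
                   ((t ^+ 2)%:P + (t *+ 2) *: 'X) k.
  have {eg}-> : r k = on_parabola k \Po ('X + t%:P) - 'X^2 * g.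
    rewrite /on_parabola subst2_comp comp_Xn_poly comp_polyX /r.
    have <- : g * (('X + t%:P) ^+ 2 - ((t ^+ 2)%:P + (t *+ 2) *: 'X)) = 'X^2 * g.
      rewrite sqrrD -polyC_exp -mul_polyC polyCMn; ring.
    by rewrite -eg subKr.
  split; first by rewrite -horner_coef0 !(hornerE, horner_comp, hornerN) expr0n /= mul0r subr0.
  rewrite (_ : _`_1 = (on_parabola k \Po ('X + t%:P) - 'X^2 * g)^`().[0]); last first.
    by rewrite horner_coef0 coef_deriv.
  rewrite !(derivB, derivM, deriv_comp, derivXn, derivD, derivX, derivC).
  by rewrite !(hornerE, horner_comp, hornerN, hornerMn); ring.
set m := maxn (size (r n)) (size (r d)).
have : r n * flip delta m.+2 (r d) - flip delta m.+2 (r n) * r d = 0.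
  pose g s := 1 + delta * s.
  (* For [delta = 0] every [s] is admissible; otherwise the single excluded value is [- delta^-1],
     whose image is at infinity. *)
  have [d0|d0] := eqVneq delta 0.
    apply: poly_eq0_all => s; have nz : 1 + delta * s != 0 by rewrite d0 mul0r addr0 oner_neq0.
    rewrite rootE !(hornerE, hornerN) !horner_flip ?leqW ?leq_maxl ?leq_maxr //.
    have := inv _ _ Tt _ nz; cbv zeta; rewrite -!rv => e.
    by rewrite [X in X - _]mulrCA e mulrA subrr.
  apply: (@poly_eq0_cofinite F id [:: - delta^-1]) => // s.
  rewrite inE => nz0; have nz : 1 + delta * s != 0.
    apply: contra nz0; rewrite addrC addr_eq0 => /eqP e.
    by rewrite -[s](mulKf d0) e mulrN1.
  rewrite rootE !(hornerE, hornerN) !horner_flip ?leqW ?leq_maxl ?leq_maxr //.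
  have := inv _ _ Tt _ nz; cbv zeta; rewrite -!rv => e.
  by rewrite [X in X - _]mulrCA e mulrA subrr.
move/(congr1 (fun p => p^`().[0])).
rewrite derivB !derivM deriv0 !(hornerE, hornerN).
rewrite !(flip_low _ _ _).1 !(flip_low _ _ _).2 !horner_coef0 !coef_deriv !mulr1n.
rewrite !(low _).1 !(low _).2.
set a := (on_parabola n).[t]; set b := (on_parabola d).[t].
set a' := (on_parabola n)^`().[t]; set b' := (on_parabola d)^`().[t] => e.
have : (a' * b - a * b') *+ 2 = 0 by rewrite -e; ring.
by move/eqP; rewrite mulrn_eq0 /= => /eqP.
Qed.

Hypothesis T_cofinite : exists (V : eqType) (g : F -> V) (bad : seq V),
  injective g /\ forall t, g t \notin bad -> exists delta, T t delta.

Lemma tangent_invariant_const n d : tangent_invariant n d -> on_parabola d != 0 ->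
  exists c h, n = c%:P%:P * d + parabola * h.
Proof.
move=> inv d0; have [V [g [bad [g_inj gT]]]] := T_cofinite.
have W : (on_parabola n)^`() * on_parabola d - on_parabola n * (on_parabola d)^`() = 0.
  apply: (@poly_eq0_cofinite V g bad) => // t /gT[delta Tt].
  by rewrite rootE (tangent_wronskian inv Tt).
have [c ec] := wronskian_eq0 d0 (subr0_eq W).
have [h eh] : exists h, n - c%:P%:P * d = parabola * h.
  apply: parabola_dvd; rewrite /on_parabola subst2B subst2M subst2C comp_polyC.
  by rewrite mul_polyC -/(on_parabola _) ec subrr.
by exists c, h; rewrite -eh addrC subrK.
Qed.

Variable q2 : {poly {poly F}}.
Hypothesis q2_neq0 : on_parabola q2 != 0.
Hypothesis q2_invariant : tangent_invariant parabola q2.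

(** [h q2 / d] is the product of the invariant functions [parabola h / d] and [q2 / parabola]. On a
    tangent line the parabola vanishes only at the point of tangency, where the relation is
    trivial. *)
Lemma tangent_invariant_div h d : tangent_invariant (parabola * h) d ->
  tangent_invariant (h * q2) d.
Proof.
move=> inv t delta Tt s nz /=; have := inv _ _ Tt _ nz.
have /= := q2_invariant Tt nz; rewrite !tangent_valueM.
have pv s1 : tangent_value t s1 parabola = - s1 ^+ 2.
  by rewrite /tangent_value /parabola value2B /value2 !horner_simp; ring.
have [->|s0] := eqVneq s 0; first by rewrite oppr0 mul0r.
set s' := - s / _; have s'0 : s' != 0 by rewrite mulf_neq0 ?oppr_eq0 ?invr_eq0.
rewrite !pv; set h1 := tangent_value t s h; set h2 := tangent_value t s' h.
set a1 := tangent_value t s q2; set a2 := tangent_value t s' q2.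
set b1 := tangent_value t s d; set b2 := tangent_value t s' d => e1 e2.
apply/(mulfI (expf_neq0 2 s0))/(mulfI (expf_neq0 2 s'0)).
transitivity (- s' ^+ 2 * a1 * (- s ^+ 2 * h1 * b2)); first by ring.
by rewrite e2 -e1; ring.
Qed.

Lemma tangent_invariantB n1 n2 d (c : F) :
  tangent_invariant n1 d -> tangent_invariant n2 d ->
  tangent_invariant (n1 - c%:P%:P * n2) d.
Proof.
move=> i1 i2 t delta Tt s nz; have /= e1 := i1 _ _ Tt _ nz.
have /= e2 := i2 _ _ Tt _ nz.
by rewrite /tangent_value /= !value2B !value2M !value2C !mulrBl -!mulrA e1 e2.
Qed.

(** Each order of contact with the parabola costs one linear condition. *)
Lemma tangent_invariant_family k (n : 'I_k.+1 -> {poly {poly F}}) d :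
  on_parabola d != 0 -> (forall i, tangent_invariant (n i) d) ->
  exists (x : 'I_k.+1 -> F) h, (exists i, x i != 0) /\
    \sum_i (x i)%:P%:P * n i = parabola ^+ k * h.
Proof.
move=> d0; elim: k n => [|k IH] n inv.
  exists (fun=> 1), (n ord0); split; first by exists ord0; rewrite oner_eq0.
  by rewrite big_ord1 !mul1r.
have /choice[c ec] i := tangent_invariant_const (inv i) d0.
(* If every constant is zero the default index serves as well, the quotients by [c i0] being
   zero. *)
pose i0 := odflt ord0 [pick i | c i != 0].
have c0 j : c j - c j / c i0 * c i0 = 0.
  rewrite /i0; case: pickP => [i ci|c0] /=; first by rewrite divfK ?subrr.
  by have /eqP-> := negbFE (c0 j); rewrite !mul0r subrr.
pose r j := c (lift i0 j) / c i0.
have /choice[g eg] j : exists g, n (lift i0 j) - (r j)%:P%:P * n i0 = parabola * g.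
  have [h1 e1] := ec (lift i0 j); have [h2 e2] := ec i0.
  exists (h1 - (r j)%:P%:P * h2); rewrite e1 e2.
  have : (c (lift i0 j))%:P%:P - (r j)%:P%:P * (c i0)%:P%:P = 0 :> {poly {poly F}}.
    by rewrite -!polyCM -!polyCB c0.
  by move=> /subr0_eq->; ring.
(* The quotients by the parabola are invariant only after multiplication by [q2]; this factor is
   cancelled again once the combination is found. *)
have ginv j : tangent_invariant (g j * q2) d.
  by apply: tangent_invariant_div; rewrite -eg; apply: tangent_invariantB.
have [x [h [[i xi] ex]]] := IH _ ginv.
have [h' eh'] : exists h', \sum_j (x j)%:P%:P * g j = parabola ^+ k * h'.
  apply: (parabola_exp_cancel q2_neq0 (h := h)); rewrite -ex mulr_suml.
  by apply: eq_bigr => j _; rewrite mulrA.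
pose X i := if unlift i0 i is Some j then x j else - \sum_j x j * r j.
have XL j : X (lift i0 j) = x j by rewrite /X liftK.
exists X, h'; split; first by exists (lift i0 i); rewrite XL.
rewrite (bigD1_ord i0) //= {1}/X unlift_none exprS -mulrA -eh' mulr_sumr.
rewrite (eq_bigr (fun j => parabola * ((x j)%:P%:P * g j)
     + (x j)%:P%:P * (r j)%:P%:P * n i0)).
  rewrite big_split /= -mulr_suml.
  rewrite (_ : \sum_(i < k.+1) (x i)%:P%:P * (r i)%:P%:P = (\sum_j x j * r j)%:P%:P).
    by rewrite !polyCN mulNr addrCA addNr addr0.
  rewrite rmorph_sum rmorph_sum; apply: eq_bigr => j _.
  by rewrite /= -!polyCM.
move=> j _; rewrite XL mulrCA -eg; ring.
Qed.

End TangentInvariants.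

Ltac vring := apply/rowP => ?; rewrite !mxE; ring.

(** * Conics and projective frames *)

Section PlaneBasics.
Local Open Scope ring_scope.
Variable F : numFieldType.
Local Notation vec := 'rV[F]_3.
Implicit Types (u v w a b c : vec) (S T : 'M[F]_3) (p l m : {vspace vec}).

Lemma polarDl S u v w : polar_form S (u + v) w = polar_form S u w + polar_form S v w.
Proof. by rewrite /polar_form !mulmxDl !mxE. Qed.
Lemma polarZl S k u w : polar_form S (k *: u) w = k * polar_form S u w.
Proof. by rewrite /polar_form -!scalemxAl !mxE. Qed.
Lemma polarDr S u v w : polar_form S w (u + v) = polar_form S w u + polar_form S w v.
Proof. by rewrite /polar_form linearD mulmxDr !mxE. Qed.
Lemma polarZr S k u w : polar_form S w (k *: u) = k * polar_form S w u.
Proof. by rewrite /polar_form linearZ -scalemxAr !mxE. Qed.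
Lemma polarNl S u w : polar_form S (- u) w = - polar_form S u w.
Proof. by rewrite -scaleN1r polarZl mulN1r. Qed.
Lemma polarNr S u w : polar_form S w (- u) = - polar_form S w u.
Proof. by rewrite -scaleN1r polarZr mulN1r. Qed.
Lemma polar0l S w : polar_form S 0 w = 0.
Proof. by rewrite -(scale0r 0) polarZl mul0r. Qed.
Lemma polar0r S w : polar_form S w 0 = 0.
Proof. by rewrite -(scale0r 0) polarZr mul0r. Qed.
Lemma polar_addm S T u w : polar_form (S + T) u w = polar_form S u w + polar_form T u w.
Proof. by rewrite /polar_form mulmxDr mulmxDl !mxE. Qed.
Lemma polar_scalem S k u w : polar_form (k *: S) u w = k * polar_form S u w.
Proof. by rewrite /polar_form -scalemxAr -scalemxAl !mxE. Qed.
Lemma polar_oppm S u w : polar_form (- S) u w = - polar_form S u w.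
Proof. by rewrite -scaleN1r polar_scalem mulN1r. Qed.
Lemma polar_zerom u w : polar_form 0 u w = 0.
Proof. by rewrite -(scale0r 0) polar_scalem mul0r. Qed.

Definition polarE := (polarDl, polarDr, polarZl, polarZr, polarNl, polarNr,
  polar_addm, polar_scalem, polar_oppm).

Lemma polarC S u v : S^T = S -> polar_form S u v = polar_form S v u.
Proof.
move=> sS; rewrite /polar_form.
have -> : u *m S *m v^T = (v *m S *m u^T)^T by rewrite !trmx_mul trmxK sS mulmxA.
by rewrite mxE.
Qed.

Lemma polar_delta S i j : polar_form S (delta_mx 0 i) (delta_mx 0 j) = S i j.
Proof. by rewrite /polar_form -rowE trmx_delta -colE !mxE. Qed.

Lemma polar_eq0 S : (forall u v, polar_form S u v = 0) -> S = 0.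
Proof. by move=> S0; apply/matrixP => i j; rewrite -polar_delta S0 mxE. Qed.

Lemma polar_diag_eq0 S : S^T = S -> (forall u, polar_form S u u = 0) -> S = 0.
Proof.
move=> sS S0; apply: polar_eq0 => u v; have := S0 (u + v).
rewrite !polarE !S0 (polarC v u sS) add0r addr0 -mulr2n.
by move/eqP; rewrite mulrn_eq0 => /eqP.
Qed.

Lemma polar_diag_neq0 S : S^T = S -> S != 0 -> exists u, polar_form S u u != 0.
Proof.
move=> sS /eqP S0; apply: contrapT => np; apply/S0/polar_diag_eq0 => // u.
by apply: contrapT => /eqP nu; apply: np; exists u.
Qed.

Lemma regular_polar S u : regular S -> (forall v, polar_form S u v = 0) -> u = 0.
Proof.
move=> rS S0; suff e : u *m S = 0 by rewrite -(mulmxK rS u) e mul0mx.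
apply/rowP => i; rewrite [RHS]mxE -(S0 (delta_mx 0 i)) /polar_form trmx_delta -colE.
by rewrite !mxE.
Qed.

Definition frame a b c :=
  (forall u, exists x y z, u = x *: a + y *: b + z *: c) /\
  (forall x y z, x *: a + y *: b + z *: c = 0 -> [/\ x = 0, y = 0 & z = 0]).

Lemma dim_plane : \dim {: vec} = 3%N.
Proof. by rewrite dimvf. Qed.

Lemma frame_intro a b c : a != 0 -> b \notin <[a]>%VS ->
  c \notin (<[a]> + <[b]>)%VS -> frame a b c.
Proof.
move=> a0 ba cab.
have ind x y z : x *: a + y *: b + z *: c = 0 -> [/\ x = 0, y = 0 & z = 0].
  move=> e; have z0 : z = 0.
    apply/eqP; apply: contraNT cab => z0.
    rewrite -[c](scalerK z0) (_ : z *: c = - (x *: a + y *: b)); last by apply/eqP; rewrite -addr_eq0 addrC e.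
    by rewrite memvZ // memvN memv_add // memvZ // memv_line.
  move: e; rewrite z0 scale0r addr0 => e; have y0 : y = 0.
    apply/eqP; apply: contraNT ba => y0.
    rewrite -[b](scalerK y0) (_ : y *: b = - (x *: a)); last by apply/eqP; rewrite -addr_eq0 addrC e.
    by rewrite memvZ // memvN memvZ // memv_line.
  move: e; rewrite y0 scale0r addr0 => /eqP; rewrite scaler_eq0 (negPf a0) orbF.
  by move/eqP.
split=> // u.
have fr : free [:: a; b; c].
  apply/freeP => k; rewrite !big_ord_recl big_ord0 /= addr0 addrA => /ind[k0 k1 k2] i.
  case: i => [[|[|[|//]]] i]; [rewrite -[RHS]k0|rewrite -[RHS]k1|rewrite -[RHS]k2];
  by congr k; apply: val_inj.
have : u \in <<[:: a; b; c]>>%VS.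
  suff -> : <<[:: a; b; c]>>%VS = fullv by rewrite memvf.
  by apply/eqP; rewrite eqEdim subvf /= dim_plane (eqP fr).
rewrite !span_cons span_nil addv0 => /memv_addP[_ /vlineP[x ->] [_ /memv_addP[_ /vlineP[y ->] [_ /vlineP[z ->] ->]] ->]].
by exists x, y, z; rewrite addrA.
Qed.

Lemma notin_exists p : (\dim p < 3)%N -> exists v, v \notin p.
Proof.
move=> dp; apply: contrapT => np.
have : (\dim {:vec} <= \dim p)%N; last by rewrite dim_plane leqNgt dp.
apply: dimvS; apply/subvP => v _; apply: contrapT => vp; apply: np; exists v.
exact/negP.
Qed.

Lemma is_point_vline u : u != 0 -> is_point <[u]>%VS.
Proof. by rewrite /is_point dim_vline => ->. Qed.

Lemma is_pointP p : is_point p -> exists2 u, u != 0 & p = <[u]>%VS.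
Proof.
move=> dp; exists (vpick p); first by rewrite vpick0 -dimv_eq0 (eqP dp).
apply/eqP; rewrite eq_sym eqEdim -memvE memv_pick (eqP dp) dim_vline.
by rewrite vpick0 -dimv_eq0 (eqP dp).
Qed.

Lemma is_point_vec p u : is_point p -> u \in p -> u != 0 -> p = <[u]>%VS.
Proof.
move=> dp up u0; apply/eqP; rewrite eq_sym eqEdim -memvE up (eqP dp) dim_vline u0.
by [].
Qed.

Lemma vline_eq u v : (<[u]>%VS = <[v]>%VS) -> exists k, u = k *: v.
Proof. by move=> e; apply/vlineP; rewrite -e memv_line. Qed.

Lemma dim_add2 u v : u != 0 -> v \notin <[u]>%VS -> \dim (<[u]> + <[v]>)%VS = 2%N.
Proof.
move=> u0 vu; have v0 : v != 0 by apply: contraNneq vu => ->; rewrite mem0v.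
rewrite dimv_disjoint_sum ?dim_vline ?u0 ?v0 //; apply/eqP.
rewrite -subv0; apply/subvP => w; rewrite memv_cap => /andP[/vlineP[k ->] /vlineP[h e]].
rewrite memv0; have [h0|h0] := eqVneq h 0; first by rewrite e h0 scale0r.
by rewrite e; apply: contraNT vu => _; rewrite -[v](scalerK h0) -e memvZ // memvZ // memv_line.
Qed.

Lemma is_line_vec l u v : is_line l -> u != 0 -> u \in l -> v \in l ->
  v \notin <[u]>%VS -> l = (<[u]> + <[v]>)%VS.
Proof.
move=> dl u0 ul vl vu; apply/eqP; rewrite eq_sym eqEdim subv_add -!memvE ul vl /=.
by rewrite (eqP dl) dim_add2.
Qed.

Lemma is_lineP l u : is_line l -> u != 0 -> u \in l ->
  exists2 v, v \notin <[u]>%VS & l = (<[u]> + <[v]>)%VS.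
Proof.
move=> dl u0 ul; have [v [vl vu]] : exists v, v \in l /\ v \notin <[u]>%VS.
  apply: contrapT => np; have : (\dim l <= \dim <[u]>)%N.
    apply: dimvS; apply/subvP => v vl; apply: contrapT => vu; apply: np; exists v.
    by split=> //; apply/negP.
  by rewrite (eqP dl) dim_vline u0.
by exists v => //; apply: is_line_vec.
Qed.

Lemma memv_line2 u v w : reflect (exists x y, w = x *: u + y *: v)
  (w \in (<[u]> + <[v]>)%VS).
Proof.
apply: (iffP memv_addP) => [[_ /vlineP[x ->] [_ /vlineP[y ->] ->]]|[x [y ->]]].
  by exists x, y.
exists (x *: u); rewrite ?memvZ ?memv_line //.
by exists (y *: v); rewrite ?memvZ ?memv_line.
Qed.

Lemma frame_neq0 a b c : frame a b c -> [/\ a != 0, b != 0 & c != 0].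
Proof.
move=> [_ fr]; split; apply/negP => /eqP e.
- by suff /fr[/eqP] : 1 *: a + 0 *: b + 0 *: c = 0; rewrite ?oner_eq0 // e; vring.
- by suff /fr[_ /eqP] : 0 *: a + 1 *: b + 0 *: c = 0; rewrite ?oner_eq0 // e; vring.
- by suff /fr[_ _ /eqP] : 0 *: a + 0 *: b + 1 *: c = 0; rewrite ?oner_eq0 // e; vring.
Qed.

Lemma frame_inj a b c x y z x' y' z' : frame a b c ->
  x *: a + y *: b + z *: c = x' *: a + y' *: b + z' *: c ->
  [/\ x = x', y = y' & z = z'].
Proof.
move=> [_ fr] e.
suff /fr[] : (x - x') *: a + (y - y') *: b + (z - z') *: c = 0.
  by move=> /subr0_eq -> /subr0_eq -> /subr0_eq ->.
transitivity (x *: a + y *: b + z *: c - (x' *: a + y' *: b + z' *: c)).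
  by vring.
by rewrite e subrr.
Qed.

Lemma polar_frame S a b c : S^T = S -> frame a b c ->
  polar_form S a a = 0 -> polar_form S b b = 0 -> polar_form S c c = 0 ->
  polar_form S a b = 0 -> polar_form S b c = 0 -> polar_form S a c = 0 -> S = 0.
Proof.
move=> sS [sp _] aa bb cc ab bc ac; apply: polar_eq0 => u v.
have [x [y [z ->]]] := sp u; have [x' [y' [z' ->]]] := sp v.
rewrite !polarE (polarC b a) // (polarC c b) // (polarC c a) //.
by rewrite aa bb cc ab bc ac; ring.
Qed.

Lemma polar_frame_ker S a b c n : frame a b c -> polar_form S n a = 0 ->
  polar_form S n b = 0 -> polar_form S n c = 0 -> forall v, polar_form S n v = 0.
Proof.
move=> [sp _] ea eb ec v; have [x [y [z ->]]] := sp v.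
by rewrite !polarE ea eb ec !mulr0 !addr0.
Qed.

(** A regular conic with a point over the field contains a hyperbolic pair: an isotropic [g] with
    S(e0, g) != 0 is found by correcting [w] along [e0], and [e1] spans the orthogonal complement of
    the pair. In this frame the points of the conic other than the third base vector are (1 : t :
    t^2). *)
Lemma conic_frame S p : S^T = S -> regular S -> is_point p -> on_conic S p ->
  exists e0 e1 e2 mu, [/\ frame e0 e1 e2, p = <[e0]>%VS, mu != 0 &
    forall x y z, polar_form S (x *: e0 + y *: e1 + z *: e2)
      (x *: e0 + y *: e1 + z *: e2) = mu * (y ^+ 2 - x * z)].
Proof.
move=> sS rS /is_pointP[e0 e00 ->] /(_ e0 (memv_line _)) S00.
have [w Sw] : exists w, polar_form S e0 w != 0.
  apply: contrapT => np; case/eqP: e00; apply: (regular_polar rS) => v.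
  by apply/eqP/negPn/negP => nv; apply: np; exists v.
have [g S0g Sgg] : exists2 g, polar_form S e0 g = polar_form S e0 w &
    polar_form S g g = 0.
  exists (w - (polar_form S w w / (polar_form S e0 w *+ 2)) *: e0).
    by rewrite !polarE S00; ring.
  by rewrite !polarE S00 (polarC w e0 sS); field.
have ge0 : g \notin <[e0]>%VS.
  by apply/vlineP => -[j eg]; move: S0g Sw; rewrite eg polarZr S00 mulr0 => <-; rewrite eqxx.
have [v vn] : exists v, v \notin (<[e0]> + <[g]>)%VS.
  by apply: notin_exists; rewrite dim_add2.
pose s := polar_form S e0 w.
pose e1 := v - (polar_form S v g / s) *: e0 - (polar_form S v e0 / s) *: g.
have s0 : s != 0 by [].
have S01 : polar_form S e0 e1 = 0.
  by rewrite /e1 !polarE S00 S0g (polarC e0 v sS) -/s; field.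
have Sg1 : polar_form S g e1 = 0.
  by rewrite /e1 !polarE Sgg (polarC g e0 sS) S0g (polarC g v sS) -/s; field.
have e1n : e1 \notin (<[e0]> + <[g]>)%VS.
  apply: contra vn => e1n; rewrite (_ : v = e1 + ((polar_form S v g / s) *: e0 + (polar_form S v e0 / s) *: g)).
    by rewrite memvD //; apply/memv_line2; do 2 eexists.
  by rewrite /e1; vring.
clearbody e1; have fr : frame e0 g e1 by apply: frame_intro.
pose mu := polar_form S e1 e1.
have mu0 : mu != 0.
  apply/negP => /eqP mu0; have [_ _ /eqP e10] := frame_neq0 fr; apply: e10.
  apply: (regular_polar rS); apply: (polar_frame_ker fr) => //.
    by rewrite polarC.
  by rewrite polarC.
(* With this factor the coefficient [2 r s] of the mixed term in x z becomes [- mu]. *)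
pose r := - mu / (s *+ 2).
have s20 : s *+ 2 != 0 by rewrite mulrn_eq0.
have r0 : r != 0 by rewrite mulf_neq0 ?oppr_eq0 ?invr_eq0.
exists e0, e1, (r *: g), mu; split=> //.
  case: fr => sp fr; split=> [u|x y z].
    have [x [y [z ->]]] := sp u; exists x, z, (y / r).
    by rewrite scalerA divfK // addrAC.
  by rewrite scalerA addrAC => /fr[-> /eqP + ->]; rewrite mulf_eq0 (negPf r0) orbF => /eqP.
move=> x y z; rewrite !polarE S00 Sgg S01 Sg1 (polarC e1 e0 sS) (polarC e1 g sS).
rewrite S01 Sg1 (polarC g e0 sS) S0g -/s -/mu /r; field.
by rewrite Sw.
Qed.

End PlaneBasics.

(** * Ternary forms along lines *)

Section PolynomialFunctions.
Local Open Scope ring_scope.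
Variable F : numFieldType.
Local Notation vec := 'rV[F]_3.
Implicit Types (u v w : vec) (S : 'M[F]_3) (N D G : {mpoly F[3]}).

Lemma rmorph_mmap n (A : comNzRingType) (U V : comNzRingType)
    (f : {rmorphism A -> U}) (psi : {rmorphism U -> V}) (h : 'I_n -> U) (p : {mpoly A[n]}) :
  psi (mmap f h p) = mmap (psi \o f) (psi \o h) p.
Proof.
rewrite /mmap rmorph_sum; apply: eq_bigr => m _; rewrite rmorphM; congr (_ * _).
by rewrite /mmap1 rmorph_prod; apply: eq_bigr => i _; rewrite rmorphXn.
Qed.

Lemma eq_mmap n (A : comNzRingType) (U : comNzRingType) (f g : A -> U)
    (h k : 'I_n -> U) (p : {mpoly A[n]}) :
  f =1 g -> h =1 k -> mmap f h p = mmap g k p.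
Proof.
move=> fg hk; rewrite /mmap; apply: eq_bigr => m _; rewrite fg; congr (_ * _).
by rewrite /mmap1; apply: eq_bigr => i _; rewrite hk.
Qed.

Definition at_vec N u : F := N.@[fun i => u 0 i].

Lemma at_vecZ d N k u : N \is d.-homog -> at_vec N (k *: u) = k ^+ d * at_vec N u.
Proof.
move=> /dhomogP hN; rewrite /at_vec !mevalE mulr_sumr; apply: eq_big_seq => m /hN hm.
rewrite mulrCA; congr (_ * _).
rewrite (eq_bigr (fun i => k ^+ m i * u 0 i ^+ m i)).
  rewrite big_split /=; congr (_ * _); rewrite prodrXr -mdegE.
  by congr (_ ^+ _).
by move=> i _; rewrite mxE exprMn.
Qed.

Definition line_poly u v N : {poly F} :=
  mmap polyC (fun i => (u 0 i)%:P + v 0 i *: 'X) N.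

Lemma horner_line_poly u v N s : (line_poly u v N).[s] = at_vec N (u + s *: v).
Proof.
rewrite -[LHS]/(horner_eval s _) /line_poly rmorph_mmap /at_vec /meval.
apply: eq_mmap => i /=; first by rewrite /horner_eval hornerC.
by rewrite /horner_eval !horner_simp !mxE mulrC.
Qed.

Lemma size_mmap_homog d N (h : 'I_3 -> {poly F}) :
  N \is d.-homog -> (forall i, size (h i) <= 2)%N ->
  (size (mmap polyC h N) <= d.+1)%N.
Proof.
move=> /dhomogP hN sh; rewrite /mmap; apply: (leq_trans (size_sum _ _ _)).
apply/bigmax_leqP_seq => m /hN dm _; have {}dm : mdeg m = d by [].
rewrite mul_polyC.
apply: (leq_trans (size_scale_leq _ _)); rewrite /mmap1.
rewrite -dm mdegE; elim/big_rec2: _ => [|i k p _ IH]; first by rewrite size_poly1.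
apply: (leq_trans (size_polyMleq _ _)).
have si : (size (h i ^+ m i) <= (m i).+1)%N.
  apply: (leq_trans (size_poly_exp_leq _ _)); rewrite ltnS.
  by rewrite -[leqRHS]mul1n leq_mul2r -subn1 leq_subLR sh orbT.
move: si IH; set s1 := size (_ : {poly F}); set s2 := size (_ : {poly F}).
by move: s1 s2 (m i) => s1 s2 mi; lia.
Qed.

Definition conic_poly S : {mpoly F[3]} :=
  \sum_i \sum_j S i j *: ('X_i * 'X_j).

Lemma at_conic_poly S u : at_vec (conic_poly S) u = polar_form S u u.
Proof.
transitivity (\sum_i \sum_j u 0 i * S i j * u 0 j).
  rewrite /at_vec /conic_poly raddf_sum; apply: eq_bigr => i _.
  rewrite raddf_sum; apply: eq_bigr => j _.
  by rewrite /= mevalZ mevalM !mevalXU; ring.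
rewrite exchange_big /polar_form [RHS]mxE; apply: eq_bigr => j _.
by rewrite !mxE mulr_suml.
Qed.

Lemma conic_poly_homog S : conic_poly S \is 2.-homog.
Proof.
apply: rpred_sum => i _; apply: rpred_sum => j _; apply: rpredZ.
by apply: (@dhomogM _ _ _ 1 _ 1); rewrite dhomogX /= mdeg1.
Qed.

Lemma at_vecM N D u : at_vec (N * D) u = at_vec N u * at_vec D u.
Proof. exact: mevalM. Qed.
Lemma at_vecB N D u : at_vec (N - D) u = at_vec N u - at_vec D u.
Proof. exact: mevalB. Qed.
Lemma at_vecD N D u : at_vec (N + D) u = at_vec N u + at_vec D u.
Proof. exact: mevalD. Qed.
Lemma at_vecX N k u : at_vec (N ^+ k) u = at_vec N u ^+ k.
Proof. exact: rmorphXn. Qed.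

Section AffineChart.
Variables (e0 e1 e2 : vec).

Let chart (i : 'I_3) : {poly {poly F}} :=
  ((e0 0 i)%:P + e1 0 i *: 'X)%:P + (e2 0 i)%:P%:P * 'X.

(** The dehomogenized form N(e0 + Y e1 + Z e2). *)
Definition in_chart N : {poly {poly F}} := mmap (polyC \o polyC) chart N.

Lemma in_chartM N D : in_chart (N * D) = in_chart N * in_chart D.
Proof. exact: rmorphM. Qed.
Lemma in_chartX N k : in_chart (N ^+ k) = in_chart N ^+ k.
Proof. exact: rmorphXn. Qed.
Lemma in_chartB N D : in_chart (N - D) = in_chart N - in_chart D.
Proof. exact: rmorphB. Qed.
Lemma in_chartZ c N : in_chart (c *: N) = c%:P%:P * in_chart N.
Proof. by rewrite -mul_mpolyC in_chartM /in_chart mmapC. Qed.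
Lemma in_chart_sum I (r : seq I) (f : I -> {mpoly F[3]}) :
  in_chart (\sum_(i <- r) f i) = \sum_(i <- r) in_chart (f i).
Proof. exact: rmorph_sum. Qed.

Lemma value_in_chart a b N :
  value2 a b (in_chart N) = at_vec N (e0 + a *: e1 + b *: e2).
Proof.
rewrite -[LHS]/((horner_eval a \o horner_eval b%:P) _) /in_chart rmorph_mmap.
rewrite /at_vec /meval; apply: eq_mmap => i /=.
  by rewrite /horner_eval !hornerC.
by rewrite /horner_eval /chart !horner_simp !mxE; ring.
Qed.

(** The degree of a form is tested on the lines Z = b, where the parabola restricts to a quadratic
    polynomial. *)
Lemma size_subst_in_chart a b d N : N \is d.-homog ->
  (size (subst2 (a%:P + 'X) b%:P (in_chart N)) <= d.+1)%N.
Proof.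
move=> hN.
rewrite -[subst2 _ _ _]/((horner_eval b%:P \o map_poly (comp_poly (a%:P + 'X))) _).
rewrite /in_chart rmorph_mmap (eq_mmap (g := polyC)
  (k := fun i => (e0 0 i + e1 0 i * a + e2 0 i * b)%:P + e1 0 i *: 'X)).
- apply: size_mmap_homog => // i.
  apply: (leq_trans (size_polyD _ _)); rewrite geq_max.
  rewrite (leq_trans (size_polyC_leq1 _)) //=.
  by rewrite (leq_trans (size_scale_leq _ _)) // size_polyX.
- by move=> c /=; rewrite /horner_eval map_polyC /= comp_polyC hornerC.
move=> i /=; rewrite /horner_eval /chart rmorphD rmorphM /= !map_polyC map_polyX /=.
rewrite !comp_polyC comp_polyD comp_polyC comp_polyZ comp_polyX !horner_simp.
by rewrite -!mul_polyC !polyCD !polyCM; ring.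
Qed.

End AffineChart.

End PolynomialFunctions.

(** * Integrals are functions of the conic of the pencil *)

Section LowerBound.
Local Open Scope ring_scope.
Variable F : numFieldType.
Local Notation vec := 'rV[F]_3.
Implicit Types (u v w : vec) (S : 'M[F]_3) (N D G : {mpoly F[3]}).
Implicit Types (n d h : {poly {poly F}}).

Lemma value2_eq0 n : (forall a b, value2 a b n = 0) -> n = 0.
Proof.
move=> n0; apply/polyP => i; rewrite coef0; apply: poly_eq0_all => a.
suff e : map_poly (horner_eval a) n = 0.
  by have := congr1 (fun p : {poly F} => p`_i) e; rewrite coef_map coef0 /= => /eqP.
apply: poly_eq0_all => b; apply/eqP; rewrite -(n0 a b) /value2.
by rewrite -[RHS](horner_map (horner_eval a)) /= {3}/horner_eval hornerC.
Qed.

Lemma multiplicity_parabola n : n != 0 ->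
  exists i n', on_parabola n' != 0 /\ n = parabola F ^+ i * n'.
Proof.
move=> n0; have [i [n' nn' ->]] := multiplicity_XsubC n 'X^2.
exists i, n'; split; last by rewrite mulrC.
move: nn'; rewrite n0; apply: contra => /eqP /parabola_dvd[h ->].
by rewrite /root /parabola hornerM !hornerE /= subrr mul0r.
Qed.

Lemma mulr2n_inj0 (x : F) : x *+ 2 = 0 -> x = 0.
Proof. by move/eqP; rewrite mulrn_eq0 => /eqP. Qed.

Lemma polarization S u v : S^T = S ->
  polar_form S (u + v) (u + v) = polar_form S u u + polar_form S v v + polar_form S u v *+ 2.
Proof. by move=> sS; rewrite !polarE (polarC v u sS); ring. Qed.

(** As [f o f] fixes every point of the line, comparing its action on [b] and on [a + b] shows that
    the two diagonal entries of [f] have equal squares. If they were equal the off-diagonal entry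
    would vanish and [f] would be trivial. The parameter [delta] is that of s |-> -s / (1 + delta s)
    on the points a + s b. *)
Lemma line_involution a b (f : 'End(vec)) : a != 0 -> b \notin <[a]>%VS ->
  proj_involution (<[a]> + <[b]>)%VS f -> (f @: <[a]>)%VS = <[a]>%VS ->
  exists alpha delta, [/\ alpha != 0, f a = alpha *: a &
    f b = - alpha *: b + (alpha * delta) *: a].
Proof.
move=> a0 ba [fl f2 [p /andP[pp pl] fp]] fa.
have fr x y : x *: a + y *: b = 0 -> x = 0 /\ y = 0.
  move=> e; have y0 : y = 0.
    apply/eqP; apply: contraNT ba => y0; rewrite -[b](scalerK y0).
    rewrite (_ : y *: b = - (x *: a)); last by apply/eqP; rewrite -addr_eq0 addrC e.
    by rewrite memvZ // memvN memvZ // memv_line.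
  move: e; rewrite y0 scale0r addr0 => /eqP; rewrite scaler_eq0 (negPf a0) orbF.
  by move/eqP.
have [alpha ea] : exists k, f a = k *: a.
  by apply/vlineP; rewrite -fa memv_img // memv_line.
have al0 : alpha != 0.
  apply: contraNneq a0 => z; move: fa; rewrite limg_line ea z scale0r => e.
  by rewrite -memv0 -[0%VS]/<[0]>%VS e memv_line || rewrite -memv0 -vline0 e memv_line.
have bl : b \in (<[a]> + <[b]>)%VS by rewrite (subvP (addvSr _ _)) ?memv_line.
have al : a \in (<[a]> + <[b]>)%VS by rewrite (subvP (addvSl _ _)) ?memv_line.
have [g [beta eb]] : exists x y, f b = x *: a + y *: b.
  by apply/memv_line2; rewrite -fl memv_img.
have ff u : u != 0 -> u \in (<[a]> + <[b]>)%VS -> exists k, f (f u) = k *: u.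
  move=> u0 ul; apply: vline_eq; rewrite -!limg_line; apply: f2.
  by rewrite /point_on is_point_vline // -memvE.
have b0 : b != 0 by apply: contraNneq ba => ->; rewrite mem0v.
have [k ek] := ff _ b0 bl.
have : (g * (alpha + beta)) *: a + (beta ^+ 2 - k) *: b = 0.
  transitivity (f (f b) - k *: b); last by rewrite ek subrr.
  by rewrite eb linearD !linearZ /= ea eb; vring.
case/fr=> e1 e2.
have ab0 : a + b != 0.
  apply/negP => /eqP e; have [|/eqP] := fr 1 1; last by rewrite oner_eq0.
  by rewrite !scale1r.
have [k' ek'] := ff _ ab0 (memvD al bl).
have : (alpha ^+ 2 + g * (alpha + beta) - k') *: a + (beta ^+ 2 - k') *: b = 0.
  transitivity (f (f (a + b)) - k' *: (a + b)); last by rewrite ek' subrr.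
  by rewrite !linearD /= ea eb !linearZ /= linearD !linearZ /= ea eb; vring.
case/fr; rewrite e1 addr0 => e3 e4.
have : (alpha - beta) * (alpha + beta) = 0.
  by rewrite -subr_sqr (subr0_eq e3) (subr0_eq e4) subrr.
move/eqP; rewrite mulf_eq0 => /orP[/eqP/subr0_eq be|/eqP be]; last first.
  exists alpha, (g / alpha); split=> //; rewrite eb addrC mulrCA divff // mulr1.
  by congr (_ *: _ + _); apply/eqP; rewrite -addr_eq0 addrC be.
move: e1; rewrite -be -mulr2n => /eqP; rewrite mulf_eq0 mulrn_eq0 (negPf al0) /= orbF.
move/eqP=> g0; case: fp.
have [u u0 eu] := is_pointP pp; rewrite eu limg_line.
have /memv_line2[x [y exy]] : u \in (<[a]> + <[b]>)%VS by rewrite memvE -eu.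
rewrite (_ : f u = alpha *: u) ?vlineZ //.
  by apply/eqP; rewrite eqEdim -memvE memvZ ?memv_line //= !dim_vline scaler_eq0 (negPf al0) (negPf u0).
by rewrite exy linearD !linearZ /= ea eb -be g0; vring.
Qed.

(** Here [s1] is the size of a quadratic polynomial to the power 2m+1, with m = [d./2], and [s2] the
    size of its cofactor; a product of degree at most 2m+d is too small for them. *)
Fact degree_gap (d s1 s2 : nat) : (0 < s1 -> 0 < s2 ->
  s1.-1 = 2 * (d./2 + d./2.+1) -> (2 * d./2 + d).+1 < (s1 + s2).-1)%N.
Proof. by have := odd_double_half d; case: (odd d); lia. Qed.

Section Chart.
Variables (S0 S2 : 'M[F]_3) (e0 e1 e2 : vec) (mu : F).
Hypothesis fr : frame e0 e1 e2.
Hypothesis mu0 : mu != 0.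
Hypothesis sS0 : S0^T = S0.
Hypothesis sS2 : S2^T = S2.
Hypothesis S0E : forall x y z, polar_form S0 (x *: e0 + y *: e1 + z *: e2)
      (x *: e0 + y *: e1 + z *: e2) = mu * (y ^+ 2 - x * z).

Local Notation chart := (in_chart e0 e1 e2).

Let S0E' y z : polar_form S0 (e0 + y *: e1 + z *: e2) (e0 + y *: e1 + z *: e2)
  = mu * (y ^+ 2 - z).
Proof. by rewrite -[e0]scale1r S0E mul1r. Qed.

Lemma chart_S0 : chart (conic_poly S0) = (- mu)%:P%:P * parabola F.
Proof.
apply/eqP; rewrite -subr_eq0; apply/eqP/value2_eq0 => a b.
rewrite value2B value2M value2C value_in_chart at_conic_poly S0E'.
by rewrite /value2 /parabola !horner_simp; ring.
Qed.

Lemma S0_frame : [/\ polar_form S0 e0 e0 = 0, polar_form S0 e1 e1 = mu,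
  polar_form S0 e2 e2 = 0, polar_form S0 e0 e1 = 0 &
  polar_form S0 e1 e2 = 0 /\ polar_form S0 e0 e2 *+ 2 = - mu].
Proof.
have E00 : polar_form S0 e0 e0 = 0.
  by have := S0E 1 0 0; rewrite !scale0r !addr0 scale1r => ->; ring.
have E11 : polar_form S0 e1 e1 = mu.
  by have := S0E 0 1 0; rewrite !scale0r addr0 add0r scale1r => ->; ring.
have E22 : polar_form S0 e2 e2 = 0.
  by have := S0E 0 0 1; rewrite !scale0r !add0r scale1r => ->; ring.
have E01 : polar_form S0 e0 e1 *+ 2 = 0.
  have := S0E 1 1 0; rewrite !scale0r addr0 !scale1r polarization // E00 E11.
  by rewrite add0r => /(canRL (addKr _)) ->; ring.
have E12 : polar_form S0 e1 e2 *+ 2 = 0.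
  have := S0E 0 1 1; rewrite !scale0r add0r !scale1r polarization // E22 E11.
  by rewrite addr0 => /(canRL (addKr _)) ->; ring.
have E02 : polar_form S0 e0 e2 *+ 2 = - mu.
  have := S0E 1 0 1; rewrite !scale0r addr0 !scale1r polarization // E22 E00.
  by rewrite !add0r => ->; ring.
by split=> //; [exact: mulr2n_inj0 | split=> //; exact: mulr2n_inj0].
Qed.

(** If S2 vanishes at all points (1 : t : t^2), the five coefficients of a quartic in t are zero.
    They determine the entries of S2 in the frame up to one, and this one is matched by a multiple
    of S0. *)
Lemma chart_S2_neq0 : S2 \notin <[S0]>%VS -> on_parabola (chart (conic_poly S2)) != 0.
Proof.
move=> S2n; apply: contra S2n => /eqP n0.
pose p := Poly [:: polar_form S2 e0 e0; polar_form S2 e0 e1 *+ 2; polar_form S2 e1 e1 + polar_form S2 e0 e2 *+ 2; polar_form S2 e1 e2 *+ 2; polar_form S2 e2 e2].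
have p0 : p = 0.
  apply: poly_eq0_all => t; have := congr1 (horner^~ t) n0.
  rewrite /= horner_subst2 !horner_simp value_in_chart at_conic_poly => e.
  rewrite rootE horner_Poly /=; apply/eqP; apply: etrans e.
  rewrite !polarE (polarC e1 e0 sS2) (polarC e2 e0 sS2) (polarC e2 e1 sS2).
  by ring.
have coef i := congr1 (fun q : {poly F} => q`_i) p0.
have [E00 E11 E22 E01 [E12 E02]] := S0_frame.
apply/vlineP; exists (polar_form S2 e1 e1 / mu); apply/eqP; rewrite -subr_eq0; apply/eqP.
have sym : (S2 - (polar_form S2 e1 e1 / mu) *: S0)^T = S2 - (polar_form S2 e1 e1 / mu) *: S0.
  by rewrite linearB linearZ /= sS0 sS2.
have := coef 0; have := coef 1; have := coef 2; have := coef 3; have := coef 4.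
rewrite !coef_Poly !coef0 /= => c4 /mulr2n_inj0 c3 c2 /mulr2n_inj0 c1 c0.
apply: (polar_frame sym fr); rewrite !polarE.
- by rewrite c0 E00 mulr0 subr0.
- by rewrite E11 divfK // subrr.
- by rewrite c4 E22 mulr0 subr0.
- by rewrite c1 E01 mulr0 subr0.
- by rewrite c3 E12 mulr0 subr0.
- apply: mulr2n_inj0; rewrite mulrnBl -mulrnAr E02 mulrN opprK divfK // addrC.
  exact: c2.
Qed.

Variables (N D : {mpoly F[3]}) (deg : nat).
Hypothesis hN : N \is deg.-homog.
Hypothesis hD : D \is deg.-homog.
Hypothesis S2n : S2 \notin <[S0]>%VS.
Variable bad : seq {vspace vec}.
Hypothesis involutions : forall p, is_point p -> on_conic S0 p -> p \notin bad ->
  exists l f, [/\ tangent_at S0 p l, proj_involution l f, (f @: p)%VS = p &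
    forall x, point_on x l -> invariant_pair N D x (f @: x)%VS /\
      invariant_pair (conic_poly S0) (conic_poly S2) x (f @: x)%VS].

Let tpoint t s : vec := e0 + (t + s) *: e1 + (t ^+ 2 + t * s *+ 2) *: e2.
Let phi t : vec := e0 + t *: e1 + t ^+ 2 *: e2.

(** Both invariances are built into [T], so that the results on tangent lines apply to N / D and to
    S0 / S2 at once. *)
Let T t delta := forall s, 1 + delta * s != 0 ->
  let u := tpoint t s in let w := tpoint t (- s / (1 + delta * s)) in
  at_vec N u * at_vec D w = at_vec N w * at_vec D u /\
  polar_form S0 u u * polar_form S2 w w = polar_form S0 w w * polar_form S2 u u.

Lemma phi_neq0 t : phi t != 0.
Proof.
apply/negP => /eqP e; case: fr => _ /(_ 1 t (t ^+ 2)); rewrite scale1r => /(_ e)[/eqP].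
by rewrite oner_eq0.
Qed.

Lemma phi_inj : injective (fun t => <[phi t]>%VS).
Proof.
move=> t t' /vline_eq[k e].
have := frame_inj (x := 1) (y := t) (z := t ^+ 2) (x' := k) (y' := k * t') (z' := k * t' ^+ 2) fr.
rewrite scale1r -/(phi t) e => -[]; first by rewrite /phi; vring.
by move=> <- ->; rewrite mul1r.
Qed.

Lemma T_phi t : <[phi t]>%VS \notin bad -> exists delta, T t delta.
Proof.
move=> tb; have [E00 E11 E22 E01 [E12 E02]] := S0_frame.
have on : on_conic S0 <[phi t]>.
  by move=> _ /vlineP[k ->]; rewrite polarZl polarZr S0E' subrr !mulr0.
have [l [f [[ll /andP[_ pl] tan] invf fp fxy]]] := involutions (is_point_vline (phi_neq0 t)) on tb.
(* The derivative of [phi] at [t], which spans the tangent line together with [phi t]. *)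
pose psi := e1 + (t *+ 2) *: e2.
have pn : psi \notin <[phi t]>%VS.
  apply/vlineP => -[k e].
  have := frame_inj (x := 0) (y := 1) (z := t *+ 2) (x' := k) (y' := k * t) (z' := k * t ^+ 2) fr.
  rewrite scale0r scale1r add0r -/psi e => -[]; first by rewrite /phi; vring.
  by move=> <- /eqP; rewrite mul0r oner_eq0.
(* If [psi] were off the tangent line, [phi t] would be orthogonal to a whole frame, although S0(phi
   t, e2) != 0. *)
have psil : psi \in l.
  apply: contrapT => /negP nl.
  have [v vp lE] := is_lineP ll (phi_neq0 t) (pl : phi t \in l).
  have fr' : frame (phi t) v psi by apply: frame_intro => //; rewrite ?phi_neq0 // -lE.
  have zero : forall w, polar_form S0 (phi t) w = 0.
    apply: (polar_frame_ker fr').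
    - by apply: tan; rewrite ?memv_line // lE; apply: (subvP (addvSl _ _)); rewrite memv_line.
    - by apply: tan; rewrite ?memv_line // lE; apply: (subvP (addvSr _ _)); rewrite memv_line.
    - apply: mulr2n_inj0; rewrite /phi /psi !polarE.
      rewrite (polarC e2 e1 sS0) E01 E11 E12 E22.
      transitivity (t *+ 2 * (polar_form S0 e0 e2 *+ 2) + t * mu *+ 2); first by ring.
      by rewrite E02; ring.
  have := zero e2; rewrite /phi !polarE E12 E22 !mulr0 !addr0 => z.
  by move: E02; rewrite z mul0rn => /eqP; rewrite eq_sym oppr_eq0 (negPf mu0).
have lE := is_line_vec ll (phi_neq0 t) (pl : phi t \in l) psil pn.
rewrite lE in invf fxy.
have [alpha [delta [al0 fa fb]]] := line_involution (phi_neq0 t) pn invf fp.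
exists delta => s nz; cbv zeta.
have te s1 : tpoint t s1 = phi t + s1 *: psi by rewrite /tpoint /phi /psi; vring.
set s' := - s / _.
have fu : f (tpoint t s) = (alpha * (1 + delta * s)) *: tpoint t s'.
  rewrite !te linearD linearZ /= fa fb /s' scalerDr !scalerA.
  by apply/rowP => i; rewrite !mxE; field.
have u0 : tpoint t s != 0.
  rewrite te; apply/negP => /eqP e; case/negP: pn; have [s0|s0] := eqVneq s 0.
    by move: e; rewrite s0 scale0r addr0 => /eqP; rewrite (negPf (phi_neq0 t)).
  rewrite -[psi](scalerK s0) (_ : s *: psi = - phi t).
    by rewrite memvZ // memvN memv_line.
  by apply/eqP; rewrite -addr_eq0 addrC e.
have := fxy <[tpoint t s]>%VS; rewrite /point_on is_point_vline //=.
have -> : (<[tpoint t s]> <= <[phi t]> + <[psi]>)%VS.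
  by rewrite -memvE; apply/memv_line2; exists 1, s; rewrite scale1r te.
move=> /(_ isT)[i1 i2]; have wm : tpoint t s' \in (f @: <[tpoint t s]>)%VS.
  rewrite limg_line fu; apply/vlineP; exists (alpha * (1 + delta * s))^-1.
  by rewrite scalerK // mulf_neq0.
split; first exact: (i1 _ _ (memv_line _) wm).
rewrite -!at_conic_poly; exact: (i2 _ _ (memv_line _) wm).
Qed.

Lemma T_cofinite : exists (V : eqType) (g : F -> V) (bad : seq V),
  injective g /\ forall t, g t \notin bad -> exists delta, T t delta.
Proof. by exists _, (fun t => <[phi t]>%VS), bad; split; [exact: phi_inj|exact: T_phi]. Qed.

Local Notation pi := (parabola F).
Let q2 := chart (conic_poly S2).

Lemma T_invariant : tangent_invariant T (chart N) (chart D).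
Proof.
move=> t delta Tt s nz; rewrite /tangent_value /= !value_in_chart.
by have [] := Tt _ nz.
Qed.

Lemma T_invariant_conics : tangent_invariant T pi q2.
Proof.
move=> t delta Tt s nz /=; have [_ e] := Tt _ nz; apply: (mulfI (x := - mu)).
  by rewrite oppr_eq0.
have v s1 : - mu * tangent_value t s1 pi = polar_form S0 (tpoint t s1) (tpoint t s1).
  by rewrite -at_conic_poly -value_in_chart chart_S0 value2M value2C.
rewrite !mulrA !v /tangent_value !value_in_chart !at_conic_poly; exact: e.
Qed.

Lemma tangent_invariantM n1 d1 n2 d2 : tangent_invariant T n1 d1 ->
  tangent_invariant T n2 d2 -> tangent_invariant T (n1 * n2) (d1 * d2).
Proof.
move=> i1 i2 t delta Tt s nz /=; have /= := i2 _ _ Tt _ nz; have /= := i1 _ _ Tt _ nz.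
by rewrite !tangent_valueM => E1 E2; rewrite mulrACA E1 E2; ring.
Qed.

Lemma tangent_invariantX n d k : tangent_invariant T n d ->
  tangent_invariant T (n ^+ k) (d ^+ k).
Proof.
move=> i1; elim: k => [|k IH]; first by move=> t delta Tt s nz /=; rewrite mulrC.
by rewrite !exprS; apply: tangent_invariantM.
Qed.

Lemma tangent_invariant_refl n : tangent_invariant T n n.
Proof. by move=> t delta Tt s nz /=; rewrite mulrC. Qed.

Lemma tangent_invariant_sym n d : tangent_invariant T n d -> tangent_invariant T d n.
Proof.
move=> i t delta Tt s nz /=; have /= := i _ _ Tt _ nz => e.
by rewrite mulrC -e mulrC.
Qed.

(** The parabola meets its tangent line only at [s = 0], where invariance is trivial. *)
Lemma tangent_invariant_cancel n d j : tangent_invariant T (pi ^+ j * n) (pi ^+ j * d) ->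
  tangent_invariant T n d.
Proof.
move=> i t delta Tt s nz /=; have /= := i _ _ Tt _ nz; rewrite !tangent_valueM.
have [->|s0] := eqVneq s 0; first by rewrite oppr0 mul0r => _; rewrite mulrC.
set s' := - s / _; have s'0 : s' != 0 by rewrite mulf_neq0 ?oppr_eq0 ?invr_eq0.
have pv s1 : tangent_value t s1 (pi ^+ j) = (- s1 ^+ 2) ^+ j.
  elim: (j) => [|k IH]; first by rewrite /tangent_value /value2 !hornerC.
  rewrite exprS [RHS]exprS tangent_valueM IH; congr (_ * _).
  by rewrite /tangent_value /parabola value2B /value2 !horner_simp; ring.
rewrite !pv => e.
have nz1 : (- s ^+ 2) ^+ j != 0 by rewrite expf_neq0 // oppr_eq0 expf_neq0.
have nz2 : (- s' ^+ 2) ^+ j != 0 by rewrite expf_neq0 // oppr_eq0 expf_neq0.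
apply: (mulfI (mulf_neq0 nz1 nz2)); rewrite mulrACA e mulrACA.
by rewrite [X in X * _]mulrC.
Qed.

(** A Pade approximation of [n / d] along the parabola: 2m+2 coefficients against 2m+1 orders of
    vanishing. All functions get the common denominator [q2 ^+ m * d1], which has to be nonzero on
    the parabola; so common powers of the parabola are first removed from [n] and [d]. *)
Lemma binary_approximant n d m : tangent_invariant T n d ->
  exists (a b : 'I_m.+1 -> F) h, (exists i, (a i != 0) || (b i != 0)) /\
   (\sum_i (b i)%:P%:P * (pi ^+ i * q2 ^+ (m - i))) * n
   - (\sum_i (a i)%:P%:P * (pi ^+ i * q2 ^+ (m - i))) * d = pi ^+ (m + m.+1) * h.
Proof.
move=> inv; have q20 : on_parabola q2 != 0 by apply: chart_S2_neq0.
have [n0|n0] := eqVneq n 0.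
  exists (fun=> 0), (fun=> 1), 0; split; first by exists ord0; rewrite oner_eq0 orbT.
  rewrite n0 !mulr0 sub0r (eq_bigr (fun=> 0)); last by move=> i _; rewrite mul0r.
  by rewrite big1 // mul0r oppr0.
have [d0|d0] := eqVneq d 0.
  exists (fun=> 1), (fun=> 0), 0; split; first by exists ord0; rewrite oner_eq0.
  rewrite d0 !mulr0 subr0 (eq_bigr (fun=> 0)); last by move=> i _; rewrite mul0r.
  by rewrite big1 // mul0r.
have [i [n1 [n10 en]]] := multiplicity_parabola n0.
have [j [d1 [d10 ed]]] := multiplicity_parabola d0.
(* The situation is symmetric in [n] and [d]; let [d] have the smaller multiplicity along the
   parabola. *)
wlog le_ji : n d i j n1 d1 inv n0 d0 n10 en d10 ed / (j <= i)%N.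
  move=> W; have [ji|/ltnW ij] := leqP j i; first exact: (W n d i j n1 d1).
  have := W d n j i d1 n1 (tangent_invariant_sym inv) d0 n0 d10 ed n10 en ij.
  move=> [a [b [h [[k ab] e]]]]; exists b, a, (- h); split.
    by exists k; rewrite orbC.
  by rewrite mulrN -e opprB.
have inv1 : tangent_invariant T (pi ^+ (i - j) * n1) d1.
  by apply: (@tangent_invariant_cancel _ _ j); rewrite mulrA -exprD subnKC // -en -ed.
have base (k : 'I_m.+1) : tangent_invariant T (pi ^+ k * q2 ^+ (m - k)) (q2 ^+ m).
  rewrite (_ : q2 ^+ m = q2 ^+ k * q2 ^+ (m - k)); last by rewrite -exprD subnKC ?leq_ord.
  exact: tangent_invariantM (tangent_invariantX _ T_invariant_conics) (tangent_invariant_refl _).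
pose fam (k : 'I_(m.+1 + m.+1)) := match split k with
  | inl k => pi ^+ k * q2 ^+ (m - k) * (pi ^+ (i - j) * n1)
  | inr k => pi ^+ k * q2 ^+ (m - k) * d1 end.
have D0 : on_parabola (q2 ^+ m * d1) != 0.
  rewrite on_parabolaM mulf_neq0 //; elim: (m) => [|k IH].
    by rewrite /on_parabola /subst2 rmorph1 hornerC oner_eq0.
  by rewrite exprS on_parabolaM mulf_neq0.
have [] := tangent_invariant_family T_cofinite q20 T_invariant_conics
  (k := (m + m.+1)%N) (n := fam) D0.
  move=> k; rewrite /fam; case: (@split m.+1 m.+1 k) => k'; apply: tangent_invariantM => //.
  exact: tangent_invariant_refl.
move=> x [h [[k xk] e]].
exists (fun k : 'I_m.+1 => - x (@rshift m.+1 m.+1 k)),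
  (fun k : 'I_m.+1 => x (@lshift m.+1 m.+1 k)), (pi ^+ j * h); split.
  case: (@splitP m.+1 m.+1 k) => k' ek; exists k'.
    by rewrite (_ : @lshift m.+1 m.+1 k' = k) ?xk ?orbT //; apply: val_inj.
  by rewrite (_ : @rshift m.+1 m.+1 k' = k) ?oppr_eq0 ?xk //; apply: val_inj.
rewrite mulrCA -e (@big_split_ord _ _ _ m.+1 m.+1) /= mulrDr.
rewrite [in LHS]en [in LHS]ed -{1}(subnKC le_ji) exprD; congr (_ + _).
  rewrite mulr_suml mulr_sumr; apply: eq_bigr => k' _.
  by rewrite /fam (unsplitK (inl k')); ring.
rewrite -mulNr -sumrN mulr_suml mulr_sumr; apply: eq_bigr => k' _.
by rewrite /fam (unsplitK (inr k')) !polyCN; ring.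
Qed.

Lemma pencil_form_of_integral_chart :
  exists a b : 'I_(deg./2).+1 -> F, (exists i, (a i != 0) || (b i != 0)) /\
  forall u, let q i := polar_form S0 u u ^+ i * polar_form S2 u u ^+ (deg./2 - i) in
    (\sum_i b i * q i) * at_vec N u = (\sum_i a i * q i) * at_vec D u.
Proof.
set m := deg./2; have [a [b [h [[k abk] e]]]] := binary_approximant m T_invariant.
(* In the chart S0 is [- mu] times the parabola; the powers of this factor are absorbed in the
   coefficients. *)
pose r (i : 'I_m.+1) := ((- mu) ^+ i)^-1.
have r0 i : r i != 0 by rewrite invr_eq0 expf_neq0 // oppr_eq0.
exists (fun i => a i * r i), (fun i => b i * r i); split.
  by exists k; rewrite !mulf_eq0 !negb_or !r0 !andbT.
pose B (c : 'I_m.+1 -> F) : {mpoly F[3]} :=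
  \sum_i (c i * r i) *: (conic_poly S0 ^+ i * conic_poly S2 ^+ (m - i)).
have BE c u : at_vec (B c) u = \sum_i c i * r i *
    (polar_form S0 u u ^+ i * polar_form S2 u u ^+ (m - i)).
  rewrite /at_vec /B raddf_sum; apply: eq_bigr => i _; rewrite /= mevalZ.
  by rewrite -/(at_vec _ u) at_vecM !at_vecX !at_conic_poly.
have Bhom c : B c \is (2 * m).-homog.
  apply: rpred_sum => i _; apply: rpredZ.
  rewrite (_ : (2 * m = 2 * i + 2 * (m - i))%N); last by rewrite -mulnDr subnKC ?leq_ord.
  by apply: dhomogM; apply: dhomogMn; apply: conic_poly_homog.
pose G := B b * N - B a * D.
have Ghom : G \is (2 * m + deg).-homog by apply: rpredB; apply: dhomogM.
have Bchart c : chart (B c) = \sum_i (c i)%:P%:P * (pi ^+ i * q2 ^+ (m - i)).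
  rewrite in_chart_sum; apply: eq_bigr => i _.
  rewrite in_chartZ in_chartM !in_chartX chart_S0 exprMn -!polyC_exp !mulrA.
  congr (_ * _ * _); rewrite -!polyCM; congr (_%:P%:P).
  by rewrite /r -mulrA mulVf ?mulr1 // expf_neq0 // oppr_eq0.
have Gchart : chart G = pi ^+ (m + m.+1) * h by rewrite in_chartB !in_chartM !Bchart.
(* On the line Z = z the form [G] becomes a multiple of the power 2m+1 of a quadratic polynomial,
   which its degree does not allow unless it is zero. *)
have G1 y z : at_vec G (e0 + y *: e1 + z *: e2) = 0.
  rewrite -value_in_chart; have := size_subst_in_chart e0 e1 e2 y z Ghom.
  set g := subst2 _ _ _ => sg.
  have -> : value2 y z (chart G) = g.[0].
    by rewrite /g horner_subst2 !horner_simp addr0.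
  suff -> : g = 0 by rewrite horner0.
  apply: contrapT => /eqP g0; move: sg; rewrite leqNgt => /negP; apply.
  have gE : g = (z%:P - (y%:P + 'X) ^+ 2) ^+ (m + m.+1) * subst2 (y%:P + 'X) z%:P h.
    rewrite /g Gchart subst2M; congr (_ * _); elim: (m + m.+1)%N => [|i IH].
      by rewrite /subst2 rmorph1 hornerC.
    rewrite exprS [RHS]exprS subst2M IH; congr (_ * _).
    by rewrite /parabola subst2B subst2X subst2C comp_Xn_poly.
  have h0 : subst2 (y%:P + 'X) z%:P h != 0.
    by apply: contraNneq g0 => h0; rewrite gE h0 mulr0.
  have sq : size (z%:P - (y%:P + 'X) ^+ 2) = 3%N.
    have s3 : size ((y%:P + 'X) ^+ 2) = 3%N.
      by rewrite addrC -[y]opprK polyCN size_exp_XsubC.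
    by rewrite addrC size_polyDl size_polyN s3 // (leq_ltn_trans (size_polyC_leq1 _)).
  have q0 : z%:P - (y%:P + 'X) ^+ 2 != 0 by rewrite -size_poly_gt0 sq.
  rewrite gE size_mul ?expf_neq0 //.
  have := size_exp (z%:P - (y%:P + 'X) ^+ 2) (m + m.+1); rewrite sq /=.
  have : (0 < size (subst2 (y%:P + 'X) z%:P h))%N by rewrite size_poly_gt0.
  have : (0 < size ((z%:P - (y%:P + 'X) ^+ 2) ^+ (m + m.+1)))%N.
    by rewrite size_poly_gt0 expf_neq0.
  exact: degree_gap.
have G2 x y z : x != 0 -> at_vec G (x *: e0 + y *: e1 + z *: e2) = 0.
  move=> x0; rewrite (_ : _ + _ = x *: (e0 + (y / x) *: e1 + (z / x) *: e2)).
    by rewrite (at_vecZ _ _ Ghom) G1 mulr0.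
  by apply/rowP => i; rewrite !mxE; field.
have G3 u : at_vec G u = 0.
  have [x [y [z ->]]] := fr.1 u.
  (* The vectors with x = 0 are reached along the direction [e0]. *)
  suff /(congr1 (horner^~ 0)) : line_poly (x *: e0 + y *: e1 + z *: e2) e0 G = 0.
    by rewrite /= horner_line_poly scale0r addr0 horner0.
  apply: (@poly_eq0_cofinite F F id [:: - x]) => // s; rewrite inE => sx.
  rewrite rootE horner_line_poly.
  have -> : x *: e0 + y *: e1 + z *: e2 + s *: e0 = (x + s) *: e0 + y *: e1 + z *: e2.
    by vring.
  by rewrite G2 // addrC addr_eq0.
move=> u; cbv zeta; rewrite -!BE -!at_vecM; apply/eqP; rewrite -subr_eq0 -at_vecB.
by rewrite -/G G3.
Qed.

End Chart.

Theorem pencil_form_of_integral (S0 S2 : 'M[F]_3) N D deg (bad : seq {vspace vec}) p0 :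
  S0^T = S0 -> regular S0 -> S2^T = S2 -> S2 \notin <[S0]>%VS ->
  is_point p0 -> on_conic S0 p0 ->
  N \is deg.-homog -> D \is deg.-homog ->
  (forall p, is_point p -> on_conic S0 p -> p \notin bad ->
  exists l f, [/\ tangent_at S0 p l, proj_involution l f, (f @: p)%VS = p &
    forall x, point_on x l -> invariant_pair N D x (f @: x)%VS /\
      invariant_pair (conic_poly S0) (conic_poly S2) x (f @: x)%VS]) ->
  exists a b : 'I_(deg./2).+1 -> F, (exists i, (a i != 0) || (b i != 0)) /\
  forall u, let q i := polar_form S0 u u ^+ i * polar_form S2 u u ^+ (deg./2 - i) in
    (\sum_i b i * q i) * at_vec N u = (\sum_i a i * q i) * at_vec D u.
Proof.
move=> sS0 rS0 sS2 S2n pp0 on0 hN hD inv.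
have [e0 [e1 [e2 [mu [fr _ mu0 S0E]]]]] := conic_frame sS0 rS0 pp0 on0.
exact: (pencil_form_of_integral_chart fr mu0 sS0 sS2 S0E hN hD S2n inv).
Qed.

End LowerBound.

(** * Vertices acting on the pencil *)

Section Vertices.
Local Open Scope ring_scope.
Variable F : numFieldType.
Local Notation vec := 'rV[F]_3.
Implicit Types (u v a b c m : vec) (S T Qm Qp : 'M[F]_3) (P : {vspace 'M[F]_3}).
Implicit Types (A B C D L LA LC l x y : {vspace vec}) (w : vertex F) (f : 'End(vec)).

(** The trivial action on the pencil: [v] lies on the same conic as [u], and all quadratic forms of
    the pencil change by one common factor. *)
Definition preserving P w := forall l x y u v, reflect_on w l x y ->
  u \in x -> v \in y -> u != 0 -> v != 0 ->
  exists2 k, k != 0 & forall S, S \in P -> polar_form S v v = k * polar_form S u u.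

(** The involution of the pencil that fixes the conics [Qm] and [Qp] and changes the sign of the
    ratio Qm / Qp. *)
Definition reversing Qm Qp w := forall l x y u v, reflect_on w l x y ->
  u \in x -> v \in y -> u != 0 -> v != 0 ->
  exists2 k, k != 0 & polar_form Qm v v = - k * polar_form Qm u u /\
                      polar_form Qp v v = k * polar_form Qp u u.

Lemma reversingC Qm Qp w : reversing Qm Qp w -> reversing Qp Qm w.
Proof.
move=> r l x y u v rf ux vy u0 v0; have [k k0 [e1 e2]] := r _ _ _ _ _ rf ux vy u0 v0.
by exists (- k); rewrite ?oppr_eq0 // opprK.
Qed.

Lemma reversing_line Qm Qp Qm' Qp' w : Qm' \in <[Qm]>%VS -> Qp' \in <[Qp]>%VS ->
  reversing Qm Qp w -> reversing Qm' Qp' w.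
Proof.
move=> /vlineP[k ->] /vlineP[k' ->] r l x y u v rf ux vy u0 v0.
have [j j0 [e1 e2]] := r _ _ _ _ _ rf ux vy u0 v0; exists j => //.
by rewrite !polarE e1 e2; split; ring.
Qed.

Lemma scalar_on_line l f : is_line l ->
  (forall p, point_on p l -> (f @: p)%VS = p) -> exists k, {in l, forall v, f v = k *: v}.
Proof.
move=> dl fp.
have fk v : v \in l -> exists k, f v = k *: v.
  move=> vl; have [->|v0] := eqVneq v 0; first by exists 0; rewrite linear0 scaler0.
  apply: vline_eq; rewrite -limg_line; apply: fp.
  by rewrite /point_on is_point_vline // -memvE.
have [p p0 pl] : exists2 p, p != 0 & p \in l.
  exists (vpick l); last exact: memv_pick.
  by rewrite vpick0 -dimv_eq0 (eqP dl).
have [q qp lE] := is_lineP dl p0 pl.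
have ql : q \in l by rewrite lE (subvP (addvSr _ _)) ?memv_line.
have [k ek] := fk _ pl; have [k' ek'] := fk _ ql; have [k'' ek''] := fk _ (memvD pl ql).
have [r rn] : exists r, r \notin (<[p]> + <[q]>)%VS.
  by apply: notin_exists; rewrite dim_add2.
have fr : frame p q r by apply: frame_intro.
have : k *: p + k' *: q + 0 *: r = k'' *: p + k'' *: q + 0 *: r.
  by rewrite !scale0r !addr0 -scalerDr -ek'' linearD /= ek ek'.
move=> /(frame_inj fr)[e1 e2 _]; exists k => v; rewrite lE => /memv_line2[x [y ->]].
by rewrite linearD !linearZ /= ek ek' e1 e2; vring.
Qed.

(** A projective angular symmetry is a harmonic homology. As [f o f] is trivial on points, the
    eigenvalues on the axis and at the center have equal squares, and they differ because [f] is not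
    trivial. *)
Lemma homology A l f : is_point A -> angular_symmetry A f -> fixed_point_line A f l ->
  exists2 a, a != 0 /\ A = <[a]>%VS & exists2 k, k != 0 &
  [/\ f a = - k *: a, {in l, forall v, f v = k *: v} &
      forall u, exists v t, v \in l /\ u = v + t *: a].
Proof.
move=> pA [[ffull f2 [z /andP[zp _] fz]] fA _] [dl Al fl].
have [a a0 eA] := is_pointP pA; exists a => //.
have [k ek] := scalar_on_line dl fl.
have [p p0 pl] : exists2 p, p != 0 & p \in l.
  exists (vpick l); last exact: memv_pick.
  by rewrite vpick0 -dimv_eq0 (eqP dl).
have [q qp lE] := is_lineP dl p0 pl.
have fr : frame p q a.
  by apply: frame_intro => //; rewrite -lE memvE -eA.
have split_u u : exists v t, v \in l /\ u = v + t *: a.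
  have [x [y [t ->]]] := fr.1 u; exists (x *: p + y *: q), t; split=> //.
  by rewrite lE; apply/memv_line2; exists x, y.
have ff u : u != 0 -> exists j, f (f u) = j *: u.
  move=> u0; apply: vline_eq; rewrite -!limg_line; apply: f2.
  by rewrite /point_on is_point_vline // subvf.
have [j ej] : exists j, f a = j *: a.
  by apply/vlineP; rewrite -eA -fA memv_img // eA memv_line.
have k0 : k != 0.
  apply/eqP => k0; case/eqP: (p0).
  have := f2 <[p]>%VS; rewrite /point_on is_point_vline // subvf => /(_ isT).
  rewrite !limg_line (ek _ pl) k0 scale0r linear0 => e.
  by have := memv_line p; rewrite -e => /vlineP[t ->]; rewrite scaler0.
have pa0 : p + a != 0.
  apply/negP => /eqP e; have [|/eqP] := fr.2 1 0 1; last by rewrite oner_eq0.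
  by rewrite scale0r addr0 !scale1r.
have [i ei] := ff _ pa0.
have : k ^+ 2 *: p + 0 *: q + j ^+ 2 *: a = i *: p + 0 *: q + i *: a.
  rewrite scale0r !addr0 -scalerDr -ei linearD /= (ek _ pl) ej linearD !linearZ /=.
  by rewrite (ek _ pl) ej !scalerA !expr2.
move=> /(frame_inj fr)[e1 _ e2].
have : (j - k) * (j + k) = 0 by rewrite -subr_sqr e1 e2 subrr.
move/eqP; rewrite mulf_eq0 => /orP[/eqP/subr0_eq jk|/eqP jk]; last first.
  by exists k => //; split=> //; rewrite ej; congr (_ *: _); apply/eqP; rewrite -addr_eq0 jk.
case: fz; have [u u0 ->] := is_pointP zp.
have [v [t [vl ->]]] := split_u u.
rewrite limg_line linearD linearZ /= (ek _ vl) ej jk scalerA (mulrC t) -scalerA -scalerDr.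
by apply/eqP; rewrite eqEdim -memvE memvZ ?memv_line //= !dim_vline scaler_eq0 (negPf k0).
Qed.

Lemma given_by_vec w f l x y u v : given_by w f -> reflect_on w l x y ->
  u \in x -> v \in y -> u != 0 -> v != 0 -> exists2 j, j != 0 & v = j *: f u.
Proof.
move=> gf /gf[dl cl /andP[xp xl] ->] ux vy u0 v0.
move: vy; rewrite (is_point_vec xp ux u0) limg_line => /vlineP[j e]; exists j => //.
by apply: contraNneq v0 => j0; rewrite e j0 scale0r.
Qed.

(** When the center is the pole of the axis for every conic of the pencil, the forms have no mixed
    term in [v + t a] and do not see the sign of [t]. *)
Lemma homology_preserving P A l w : (forall S, S \in P -> S^T = S) ->
  is_point A -> global_vertex A l w ->
  (forall S k v, S \in P -> k \in A -> v \in l -> polar_form S k v = 0) ->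
  preserving P w.
Proof.
move=> sP pA [_ [f [af fl gf]]] orth l' x y u v rf ux vy u0 v0.
have [a [a0 eA] [k k0 [fa fv dec]]] := homology pA af fl.
have [j j0 ->] := given_by_vec gf rf ux vy u0 v0.
have [p [t [pl ->]]] := dec u.
exists (j ^+ 2 * k ^+ 2); first by rewrite mulf_neq0 ?expf_neq0.
move=> S SP; rewrite linearD linearZ /= fa (fv _ pl) !polarE.
have aA : a \in A by rewrite eA memv_line.
by rewrite (polarC p a (sP _ SP)) (orth _ _ _ SP aA pl); ring.
Qed.

(** [Qm] vanishes on the axis and at the center, so only its mixed term survives, and this changes
    sign; [Qp] has no mixed term. *)
Lemma homology_reversing A l w Qm Qp : Qm^T = Qm -> Qp^T = Qp ->
  is_point A -> global_vertex A l w ->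
  (forall v, v \in l -> polar_form Qm v v = 0) ->
  (forall k, k \in A -> polar_form Qm k k = 0) ->
  (forall k v, k \in A -> v \in l -> polar_form Qp k v = 0) ->
  reversing Qm Qp w.
Proof.
move=> sm sp pA [_ [f [af fl gf]]] ml mA orth l' x y u v rf ux vy u0 v0.
have [a [a0 eA] [k k0 [fa fv dec]]] := homology pA af fl.
have [j j0 ->] := given_by_vec gf rf ux vy u0 v0.
have [p [t [pl ->]]] := dec u.
have aA : a \in A by rewrite eA memv_line.
exists (j ^+ 2 * k ^+ 2); first by rewrite mulf_neq0 ?expf_neq0.
rewrite linearD linearZ /= fa (fv _ pl) !polarE.
rewrite (polarC p a sp) (orth _ _ aA pl) (ml _ pl) (mA _ aA) (polarC p a sm).
by split; ring.
Qed.

Lemma quasi_global_vec A S w l x y u v : quasi_global_vertex A S w ->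
  reflect_on w l x y -> u \in x -> v \in y -> u != 0 -> v != 0 ->
  exists a q s t k, [/\ A = <[a]>%VS, polar_form S a a = 0, polar_form S q q = 0,
    k != 0 & u = s *: a + t *: q /\ v = k *: (s *: a - t *: q)].
Proof.
move=> [_ [pA onA] [[sS _] rS] rE] rf ux vy u0 v0.
have [a a0 eA] := is_pointP pA.
case/rE: rf => dl Al _ [f [inv fA [Q [/andP[pQ Ql] QA onQ fQ]]]] [/andP[px xl] ey].
have [q q0 eQ] := is_pointP pQ.
have qa : q \notin <[a]>%VS.
  apply: contra_notN QA => qa; rewrite eA eQ; apply: esym.
  exact: is_point_vec (is_point_vline a0) qa q0.
have lE : l = (<[a]> + <[q]>)%VS.
  by apply: (is_line_vec dl a0 _ _ qa); rewrite memvE -?eA -?eQ.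
rewrite lE in inv; rewrite eA in fA.
have [al [de [al0 fa fq]]] := line_involution a0 qa inv fA.
(* The second point [q] of the conic is fixed as well, which removes the off-diagonal term. *)
have fq' : f q = - al *: q.
  rewrite fq; move: fQ; rewrite eQ limg_line fq => /vline_eq[k ek].
  have [e0|d0] := eqVneq (al * de) 0; first by rewrite e0 scale0r addr0.
  case/negP: qa; apply/vlineP.
  have e : (k + al) *: q = (al * de) *: a by rewrite scalerDl -ek; vring.
  have ka : k + al != 0.
    apply/eqP => ka; move: e; rewrite ka scale0r => /esym/eqP.
    by rewrite scaler_eq0 (negPf d0) (negPf a0).
  by exists ((k + al)^-1 * (al * de)); rewrite -scalerA -e scalerK.
have /memv_line2[s [t eu]] : u \in (<[a]> + <[q]>)%VS by rewrite -lE (subvP xl).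
move: vy; rewrite ey (is_point_vec px ux u0) limg_line => /vlineP[j ev].
exists a, q, s, t, (j * al); split=> //.
- by apply: onA; rewrite eA memv_line.
- by apply: onQ; rewrite eQ memv_line.
- rewrite mulf_neq0 //; apply: contraNneq v0 => j0; by rewrite ev j0 scale0r.
split=> //; rewrite ev eu linearD !linearZ /= fa fq'; vring.
Qed.

(** On the line spanned by the center [a] and a second point [q] of [S], the form [S] has only the
    term in s t, and [Qp], being singular at [a], only the term in t^2. *)
Lemma quasi_global_reversing A S w Qp : quasi_global_vertex A S w -> Qp^T = Qp ->
  (forall k v, k \in A -> polar_form Qp k v = 0) -> reversing S Qp w.
Proof.
move=> qg sp sing l x y u v rf ux vy u0 v0.
have [a [q [s [t [k [eA aa qq k0 [-> ->]]]]]]] := quasi_global_vec qg rf ux vy u0 v0.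
have [_ _ [[sS _] _] _] := qg.
have aA : a \in A by rewrite eA memv_line.
exists (k ^+ 2); first exact: expf_neq0.
rewrite !polarE aa qq !(sing _ _ aA) (polarC q a sS) (polarC q a sp) (sing _ _ aA).
by split; ring.
Qed.

End Vertices.

(** * Normal forms of pencils *)

Section NormalForms.
Local Open Scope ring_scope.
Variable F : numFieldType.
Local Notation vec := 'rV[F]_3.
Implicit Types (u v a b c m : vec) (S T Qm Qp : 'M[F]_3) (P : {vspace 'M[F]_3}).
Implicit Types (A B C D L LA LC l : {vspace vec}) (w : vertex F) (f : 'End(vec)).

Lemma vline_scale k u : k != 0 -> <[k *: u]>%VS = <[u]>%VS.
Proof.
move=> k0; apply/eqP; rewrite eqEsubv -!memvE memvZ ?memv_line //=.
by apply/vlineP; exists k^-1; rewrite scalerK.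
Qed.

Lemma frame_scale a b c x y z : frame a b c -> x != 0 -> y != 0 -> z != 0 ->
  frame (x *: a) (y *: b) (z *: c).
Proof.
move=> [sp fr] x0 y0 z0; split=> [u|x' y' z'].
  have [x' [y' [z' ->]]] := sp u; exists (x' / x), (y' / y), (z' / z).
  by rewrite !scalerA !divfK.
rewrite !scalerA => /fr[/eqP + /eqP + /eqP].
by rewrite !mulf_eq0 (negPf x0) (negPf y0) (negPf z0) !orbF => /eqP-> /eqP-> /eqP->.
Qed.

Lemma is_line_notin a b : is_line (<[a]> + <[b]>)%VS -> b \notin <[a]>%VS.
Proof.
move=> dl; apply/negP; rewrite memvE => /addv_idPl e; move: dl.
by rewrite /is_line e dim_vline; case: (a != 0).
Qed.

Lemma mem_line2l a b : a \in (<[a]> + <[b]>)%VS.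
Proof. by rewrite (subvP (addvSl _ _)) ?memv_line. Qed.
Lemma mem_line2r a b : b \in (<[a]> + <[b]>)%VS.
Proof. by rewrite (subvP (addvSr _ _)) ?memv_line. Qed.

Lemma base_polar P S A a : (forall T, pencil_conic P T -> on_conic T A) ->
  a \in A -> S \in P -> polar_form S a a = 0.
Proof.
move=> on aA SP; have [->|S0] := eqVneq S 0; first by rewrite polar_zerom.
by apply: on.
Qed.

(** The vectors are scaled so that the fourth point is [a + b + c]; vanishing there is the relation
    between the three mixed entries. *)
Lemma type_a_frame P A B C D : (forall S, S \in P -> S^T = S) -> type_a P A B C D ->
  exists a b c, [/\ frame a b c,
    [/\ A = <[a]>, B = <[b]>, C = <[c]> & D = <[a + b + c]> ]%VS &
    forall S, S \in P -> [/\ polar_form S a a = 0, polar_form S b b = 0,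
      polar_form S c c = 0 & polar_form S a b + polar_form S b c + polar_form S a c = 0]].
Proof.
move=> sP [[pA pB pC pD] [lAB lAC lAD lBC [lBD lCD]] [nC nD1 nD2 nD3] PE].
have [a a0 eA] := is_pointP pA; have [b b0 eB] := is_pointP pB.
have [c c0 eC] := is_pointP pC; have [d d0 eD] := is_pointP pD.
move: lAB nC nD1 nD2 nD3; rewrite eA eB eC eD -!memvE => lAB nC nD1 nD2 nD3.
have fr : frame a b c by apply: frame_intro => //; apply: is_line_notin.
have [x [y [z ed]]] := fr.1 d.
have z0 : z != 0.
  apply: contraNneq nD1 => z0; rewrite ed z0 scale0r addr0.
  by apply/memv_line2; exists x, y.
have y0 : y != 0.
  apply: contraNneq nD2 => y0; rewrite ed y0 scale0r addr0.
  by apply/memv_line2; exists x, z.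
have x0 : x != 0.
  apply: contraNneq nD3 => x0; rewrite ed x0 scale0r add0r.
  by apply/memv_line2; exists y, z.
exists (x *: a), (y *: b), (z *: c); split; first exact: frame_scale.
  by rewrite !vline_scale // -ed.
move=> S SP; have on T : pencil_conic P T -> [/\ on_conic T A, on_conic T B, on_conic T C & on_conic T D].
  by case/PE.
have Sa : polar_form S a a = 0.
  by apply: (base_polar (P := P) (A := A)) => // [T /on[]//|]; rewrite eA memv_line.
have Sb : polar_form S b b = 0.
  by apply: (base_polar (P := P) (A := B)) => // [T /on[]//|]; rewrite eB memv_line.
have Sc : polar_form S c c = 0.
  by apply: (base_polar (P := P) (A := C)) => // [T /on[]//|]; rewrite eC memv_line.
have Sd : polar_form S d d = 0.
  by apply: (base_polar (P := P) (A := D)) => // [T /on[]//|]; rewrite eD memv_line.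
rewrite !polarE Sa Sb Sc !mulr0; split=> //; apply: mulr2n_inj0; rewrite -[RHS]Sd ed.
rewrite !polarE (polarC b a (sP _ SP)) (polarC c a (sP _ SP)) (polarC c b (sP _ SP)).
by rewrite Sa Sb Sc; ring.
Qed.

(** The scaling puts [a + b] on the tangent line [L], so that tangency at [C] contains the equation
    S(c, a + b) = 0. *)
Lemma type_b_frame P A B C L : (forall S, S \in P -> S^T = S) -> type_b P A B C L ->
  exists a b c, [/\ frame a b c,
    [/\ A = <[a]>, B = <[b]>, C = <[c]> & L = <[a + b]> + <[c]> ]%VS &
    forall S, S \in P -> [/\ polar_form S a a = 0, polar_form S b b = 0,
      polar_form S c c = 0 & polar_form S b c = - polar_form S a c]].
Proof.
move=> sP [[pA pB pC lL] [lAB nC] [CL AL BL] PE].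
have [a a0 eA] := is_pointP pA; have [b b0 eB] := is_pointP pB.
have [c c0 eC] := is_pointP pC.
move: lAB nC CL AL BL; rewrite eA eB eC -!memvE => lAB nC cL aL bL.
have fr : frame a b c by apply: frame_intro => //; apply: is_line_notin.
have [v vc eL] := is_lineP lL c0 cL.
have [x [y [z ev]]] := fr.1 v.
have xyL : x *: a + y *: b \in L.
  rewrite eL; apply/memv_line2; exists (- z), 1; rewrite ev; vring.
have x0 : x != 0.
  apply/eqP => x0; have [y0|y0] := eqVneq y 0.
    case/negP: vc; rewrite ev x0 y0 !scale0r !add0r; apply/vlineP; by exists z.
  case/negP: bL; rewrite -[b](scalerK y0) memvZ //.
  by move: xyL; rewrite x0 scale0r add0r.
have y0 : y != 0.
  apply/eqP => y0; case/negP: aL; rewrite -[a](scalerK x0) memvZ //.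
  by move: xyL; rewrite y0 scale0r addr0.
exists (x *: a), (y *: b), c.
have fr' : frame (x *: a) (y *: b) c.
  by rewrite -[c]scale1r; apply: frame_scale => //; rewrite oner_eq0.
split=> //.
  split; rewrite ?vline_scale //.
  rewrite addvC; apply: is_line_vec => //.
  apply/vlineP => -[k e].
  by suff /fr.2[/eqP] : x *: a + y *: b + (- k) *: c = 0;
    rewrite ?(negPf x0) // e; vring.
move=> S SP; have on T : pencil_conic P T -> [/\ on_conic T A, on_conic T B & tangent_at T C L].
  by case/PE.
have Sa : polar_form S a a = 0.
  by apply: (base_polar (P := P) (A := A)) => // [T /on[]//|]; rewrite eA memv_line.
have Sb : polar_form S b b = 0.
  by apply: (base_polar (P := P) (A := B)) => // [T /on[]//|]; rewrite eB memv_line.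
have tan v' : v' \in L -> polar_form S c v' = 0.
  move=> vL; have [->|S0] := eqVneq S 0; first by rewrite polar_zerom.
  have [_ _ [_ _ t]] := on S (conj SP S0); apply: t => //.
  by rewrite eC memv_line.
rewrite !polarE Sa Sb !mulr0; split=> //; first exact: tan.
have := tan _ xyL; rewrite !polarE !(polarC c _ (sP _ SP)) => e.
by apply/eqP; rewrite -addr_eq0 addrC e.
Qed.

(** [m] spans the intersection of the two tangent lines; for the conics of the pencil it is the pole
    of the line AC. *)
Lemma type_c_frame P A C LA LC : (forall S, S \in P -> S^T = S) -> type_c P A C LA LC ->
  exists a c m, [/\ frame a c m,
    [/\ A = <[a]>, C = <[c]>, LA = <[a]> + <[m]> & LC = <[c]> + <[m]> ]%VS &
    forall S, S \in P -> [/\ polar_form S a a = 0, polar_form S c c = 0,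
      polar_form S a m = 0 & polar_form S c m = 0]].
Proof.
move=> sP [[pA pC lA lC] [AL nC] [CL nA] PE].
have [a a0 eA] := is_pointP pA; have [c c0 eC] := is_pointP pC.
move: AL nC CL nA; rewrite eA eC -!memvE => aLA cLA cLC aLC.
have [v va eLA] := is_lineP lA a0 aLA; have [u uc eLC] := is_lineP lC c0 cLC.
have ca : c \notin <[a]>%VS.
  by apply: contra cLA => /vlineP[k ->]; rewrite memvZ.
have vac : v \notin (<[a]> + <[c]>)%VS.
  apply/negP => /memv_line2[x [y ev]]; have [y0|y0] := eqVneq y 0.
    case/negP: va; rewrite ev y0 scale0r addr0; apply/vlineP; by exists x.
  case/negP: cLA; rewrite -[c](scalerK y0) memvZ // eLA.
  by apply/memv_line2; exists (- x), 1; rewrite ev; vring.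
have fr : frame a c v by apply: frame_intro.
have [x [y [z eu]]] := fr.1 u; pose m := x *: a + z *: v.
have mLA : m \in LA by rewrite eLA; apply/memv_line2; exists x, z.
have mLC : m \in LC.
  by rewrite eLC; apply/memv_line2; exists (- y), 1; rewrite eu /m; vring.
have z0 : z != 0.
  apply/eqP => z0; have [x0|x0] := eqVneq x 0.
    case/negP: uc; rewrite eu x0 z0 !scale0r addr0 add0r; apply/vlineP; by exists y.
  case/negP: aLC; rewrite -[a](scalerK x0) memvZ //.
  by move: mLC; rewrite /m z0 scale0r addr0.
have ma : m \notin (<[a]> + <[c]>)%VS.
  apply: contra vac => mac; rewrite -[v](scalerK z0) memvZ //.
  have -> : z *: v = m - x *: a by rewrite /m; vring.
  by rewrite memvB // memvZ // mem_line2l.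
exists a, c, m; split; first exact: frame_intro.
  split=> //; apply: is_line_vec => //.
    by apply: contra ma; apply: (subvP (addvSl _ _)).
  by apply: contra ma; apply: (subvP (addvSr _ _)).
move=> S SP; have [->|S0] := eqVneq S 0; first by rewrite !polar_zerom.
have /PE[_ [[_ _ tA] [_ _ tC]]] : pencil_conic P S by [].
by split; [apply: tA|apply: tC|apply: tA|apply: tC]; rewrite ?eA ?eC ?memv_line.
Qed.

(** The vectors are Taylor coefficients of the local parametrization [phi] of [S], and the equations
    are, up to factors, the coefficients of degree 0 to 3 of the form along [phi]. All of them
    vanish for [S], and those of degree below k+3 for [S']; so the last equation for [S'] requires
    contact four. *)
Lemma contact_taylor S S' A k : S^T = S -> S'^T = S' -> contact_order S S' A k.+3 ->
  exists p0 p1 p2 p3, [/\ A = <[p0]>%VS, p1 \notin A,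
   forall T, T = S \/ T = S' -> [/\ polar_form T p0 p0 = 0, polar_form T p0 p1 = 0 &
     polar_form T p0 p2 *+ 2 + polar_form T p1 p1 = 0] &
   forall T, T = S \/ (T = S' /\ (0 < k)%N) ->
     polar_form T p0 p3 + polar_form T p1 p2 = 0].
Proof.
move=> sS sS' [phi [eA p1A along0 [along' _]]].
pose p i := map_mx (fun c : {poly F} => c`_i) phi.
have coefE T n : ((phi *m map_mx polyC T *m phi^T) 0 0)`_n
    = \sum_(i < n.+1) polar_form T (p i) (p (n - i)%N).
  rewrite mxE coef_sum.
  rewrite (eq_bigr (fun j => \sum_(i < n.+1) (p i *m T) 0 j * p (n - i)%N 0 j)).
    rewrite exchange_big; apply: eq_bigr => i _; rewrite /polar_form [RHS]mxE.
    by apply: eq_bigr => j _; rewrite !mxE.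
  move=> j _; rewrite coefM; apply: eq_bigr => i _; congr (_ * _); last by rewrite !mxE.
  rewrite !mxE coef_sum; apply: eq_bigr => h _.
  by rewrite !mxE coefMC.
have zero T n : T = S \/ (T = S' /\ (n < k.+3)%N) ->
    \sum_(i < n.+1) polar_form T (p i) (p (n - i)%N) = 0.
  case=> [->|[-> nk]]; rewrite -coefE; first by rewrite along0 coef0.
  by case/dvdpP: along' => q ->; rewrite coefMXn nk.
have sT T : T = S \/ T = S' -> T^T = T by case=> ->.
have e0 : map_mx (fun c : {poly F} => c.[0]) phi = p 0%N.
  by apply/rowP => i; rewrite !mxE horner_coef0.
have e1 : map_mx (fun c : {poly F} => c^`().[0]) phi = p 1%N.
  by apply/rowP => i; rewrite !mxE horner_coef0 coef_deriv.
exists (p 0%N), (p 1%N), (p 2%N), (p 3%N); split.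
- by rewrite eA e0.
- by rewrite -e1.
- move=> T TS; have sym := sT _ TS.
  have z n : (n < k.+3)%N -> \sum_(i < n.+1) polar_form T (p i) (p (n - i)%N) = 0.
    by move=> nk; apply: zero; case: TS => ->; [left|right].
  have := z 0%N isT; have := z 1%N isT; have := z 2%N isT.
  rewrite !big_ord_recl !big_ord0 /= => z2 z1 z0; split.
  + by rewrite -[RHS]z0 addr0.
  + apply: mulr2n_inj0; rewrite -[RHS]z1 (polarC (p 1%N) _ sym) addr0.
    by rewrite mulr2n.
  + rewrite -[RHS]z2 (polarC (p 2%N) _ sym) addr0 [in RHS]addrCA mulr2n.
    by rewrite addrC.
move=> T TS; have sym : T^T = T by apply: sT; case: TS => [|[]] ->; [left|right].
have := zero T 3%N; rewrite !big_ord_recl !big_ord0 /= => z3.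
apply: mulr2n_inj0; rewrite -[RHS]z3.
  by rewrite (polarC (p 3%N) _ sym) (polarC (p 2%N) _ sym); ring.
by case: TS => [|[]] ->; [left|right].
Qed.

End NormalForms.

(** * Regular and singular conics of a pencil; contact of order three and four *)

Section Pencils.
Local Open Scope ring_scope.
Variable F : numFieldType.
Local Notation vec := 'rV[F]_3.
Implicit Types (u v a b c m : vec) (S T Qm Qp : 'M[F]_3) (P : {vspace 'M[F]_3}).
Implicit Types (A B C D L LA LC l : {vspace vec}) (w : vertex F) (f : 'End(vec)).

Lemma pencil_span P S T : \dim P = 2%N -> S \in P -> T \in P -> S != 0 ->
  T \notin <[S]>%VS -> forall Q, Q \in P -> exists x y, Q = x *: S + y *: T.
Proof.
move=> dP SP TP S0 TS Q QP.
have T0 : T != 0 by apply: contraNneq TS => ->; rewrite mem0v.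
have PE : P = (<[S]> + <[T]>)%VS.
  apply/eqP; rewrite eq_sym eqEdim subv_add -!memvE SP TP /= dP.
  rewrite dimv_disjoint_sum ?dim_vline ?S0 ?T0 //; apply/eqP.
  rewrite -subv0; apply/subvP => w; rewrite memv_cap => /andP[/vlineP[k ->] /vlineP[h e]].
  rewrite memv0; have [h0|h0] := eqVneq h 0; first by rewrite e h0 scale0r.
  by case/negP: TS; rewrite -[T](scalerK h0) -e memvZ // memvZ // memv_line.
move: QP; rewrite PE => /memv_addP[_ /vlineP[x ->] [_ /vlineP[y ->] ->]].
by exists x, y.
Qed.

Lemma pencil_other P S : \dim P = 2%N -> S \in P -> exists2 T, T \in P & T \notin <[S]>%VS.
Proof.
move=> dP SP; apply: contrapT => np.
have : (\dim P <= \dim <[S]>)%N.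
  apply: dimvS; apply/subvP => T TP; apply: contrapT => TS; apply: np.
  by exists T => //; apply/negP.
by rewrite dP dim_vline; case: (S != 0).
Qed.

Lemma pencil_nonzero P : \dim P = 2%N -> exists2 S, S \in P & S != 0.
Proof.
move=> dP; exists (vpick P); first exact: memv_pick.
by rewrite vpick0 -dimv_eq0 dP.
Qed.

(** One linear condition on a plane of forms has a nonzero solution. The distinguished conics below
    are found in this way, hence over the given field. *)
Lemma pencil_polar_zero P u v : \dim P = 2%N ->
  exists S, [/\ S \in P, S != 0 & polar_form S u v = 0].
Proof.
move=> dP; have [S SP S0] := pencil_nonzero dP; have [T TP TS] := pencil_other dP SP.
have [e|n0] := eqVneq (polar_form S u v) 0; first by exists S.
exists (T - (polar_form T u v / polar_form S u v) *: S); split.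
- by rewrite memvB // memvZ.
- by apply: contra TS; rewrite subr_eq0 => /eqP ->; rewrite memvZ ?memv_line.
- by rewrite !polarE divfK // subrr.
Qed.

(** The condition det(T - t S) != 0 excludes only the eigenvalues of T S^-1. Contact is a condition
    on two regular conics of the pencil, so a second one has to be found. *)
Lemma pencil_regular_other P S : \dim P = 2%N -> S \in P -> regular S ->
  exists T, [/\ T \in P, regular T & T \notin <[S]>%VS].
Proof.
move=> dP SP rS; have [T TP TS] := pencil_other dP SP.
pose M := T *m invmx S.
have [t] := poly_neq0_value (monic_neq0 (char_poly_monic M)).
rewrite -/(root _ _) -eigenvalue_root_char /eigenvalue /eigenspace negbK.
rewrite kermx_eq0 row_free_unit => u.
exists (T - t *: S); split; first by rewrite memvB // memvZ.
  rewrite /regular (_ : T - _ = (M - t%:M) *m S); first by rewrite unitmx_mul u.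
  by rewrite mulmxBl mulmxKV // mul_scalar_mx.
apply: contra TS => e; rewrite -(subrK (t *: S) T) memvD //.
by rewrite memvZ ?memv_line.
Qed.

(** The second-order terms say that S(m, m) and S(a, b) are in a constant ratio over the pencil; a
    conic with S(a, b) = 0 thus contains the line [L]. For contact four ([0 < k]) the third-order
    term shows that this conic is [L] counted twice. *)
Lemma mutual_contact_facts P A L k a m b : is_pencil P -> is_point A -> is_line L ->
  mutual_contact P A L k.+3 -> A = <[a]>%VS -> m \in L -> m \notin A -> b \notin L ->
  [/\ frame a m b /\ L = (<[a]> + <[m]>)%VS,
    forall S, S \in P -> polar_form S a a = 0 /\ polar_form S a m = 0,
    exists S, [/\ S \in P, polar_form S a b != 0 & polar_form S m m != 0],
    forall S T, S \in P -> T \in P ->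
      polar_form S a b * polar_form T m m = polar_form T a b * polar_form S m m &
    (0 < k)%N -> forall S, S \in P -> polar_form S a b = 0 -> polar_form S m b = 0].
Proof.
move=> [dP sP] pA lL [[S0 [S0P S00] rS0] on tan cont] eA mL mA bL.
have a0 : a != 0 by move: pA; rewrite eA /is_point dim_vline; case: (a != 0).
have AL : (A <= L)%VS by have [_ /andP[]] := tan _ (conj S0P S00) rS0.
have aL : a \in L by rewrite memvE -eA.
have ma : m \notin <[a]>%VS by rewrite -eA.
have lE : L = (<[a]> + <[m]>)%VS by apply: is_line_vec.
have fr : frame a m b by apply: frame_intro => //; rewrite -lE.
have [S1 [S1P rS1 S1n]] := pencil_regular_other dP S0P rS0.
have S10 : S1 != 0 by apply: contraNneq S1n => ->; rewrite mem0v.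
have span := pencil_span dP S0P S1P S00 S1n.
have aA : a \in A by rewrite eA memv_line.
have aa S : S \in P -> polar_form S a a = 0 by apply: base_polar on aA.
have am S : S \in P -> regular S -> polar_form S a m = 0.
  move=> SP rS; have [->|Sn0] := eqVneq S 0; first by rewrite polar_zerom.
  by have [_ _ t] := tan _ (conj SP Sn0) rS; apply: t.
have am' S : S \in P -> polar_form S a m = 0.
  by move=> /span[x [y ->]]; rewrite !polarE !am // !mulr0 addr0.
have ab S : S \in P -> regular S -> polar_form S a b != 0.
  move=> SP rS; apply: contra a0 => /eqP e; apply/eqP/(regular_polar rS).
  by apply: (polar_frame_ker fr) => //; [apply: aa|apply: am].
have mm S : S \in P -> regular S -> polar_form S m m != 0.
  move=> SP rS; apply/eqP => e; have sS := sP _ SP.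
  have : polar_form S m b *: a - polar_form S a b *: m = 0.
    apply: (regular_polar rS); apply: (polar_frame_ker fr); rewrite !polarE.
    - by rewrite (polarC m a sS) aa // am' //; ring.
    - by rewrite am' // e; ring.
    - by ring.
  move=> z; suff /fr.2[_ /eqP] : polar_form S m b *: a + (- polar_form S a b) *: m + 0 *: b = 0.
    by rewrite oppr_eq0 (negPf (ab _ SP rS)).
  by rewrite -[RHS]z; vring.
have sS0 := sP _ S0P; have sS1 := sP _ S1P.
have [p0 [p1 [p2 [p3 [eA' p1A c2 c3]]]]] := contact_taylor sS0 sS1
  (cont _ _ (conj S0P S00) rS0 (conj S1P S10) rS1 S1n).
have [x0 ep0] : exists k, p0 = k *: a by apply: vline_eq; rewrite -eA -eA'.
have x00 : x0 != 0.
  apply: contraNneq a0 => z; move: eA'; rewrite eA ep0 z scale0r.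
  by move=> /vline_eq[j ->]; rewrite scaler0.
have [r [z [y1 ep1]]] := fr.1 p1.
(* By the first-order term the velocity [p1] of the parametrization lies on [L]. *)
have y10 : y1 = 0.
  have [_ + _] := c2 S0 (or_introl erefl); rewrite ep0 ep1 !polarE aa // am' //.
  rewrite !mulr0 !add0r => /eqP; rewrite !mulf_eq0 (negPf x00) (negPf (ab _ S0P rS0)) orbF /=.
  by move/eqP.
have z0 : z != 0.
  apply: contraNneq p1A => z0; rewrite ep1 y10 z0 !scale0r !addr0 eA.
  by apply/vlineP; exists r.
have [x2 [z2 [y2 ep2]]] := fr.1 p2; have [x3 [z3 [y3 ep3]]] := fr.1 p3.
have E2 S : S = S0 \/ S = S1 ->
    x0 * y2 *+ 2 * polar_form S a b + z ^+ 2 * polar_form S m m = 0.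
  move=> SS; have SP : S \in P by case: SS => ->.
  have [_ _ <-] := c2 S SS; rewrite ep0 ep1 ep2 y10 scale0r addr0 !polarE.
  by rewrite (polarC m a (sP _ SP)) aa // am' //; ring.
(* A regular conic does not follow its tangent line to second order. *)
have y20 : y2 != 0.
  apply/eqP => y20; have := E2 S0 (or_introl erefl); rewrite y20 mulr0 mul0rn mul0r add0r.
  by move/eqP; rewrite mulf_eq0 expf_eq0 (negPf z0) (negPf (mm _ S0P rS0)).
have cross : polar_form S0 a b * polar_form S1 m m = polar_form S1 a b * polar_form S0 m m.
  have e0 := E2 S0 (or_introl erefl); have e1 := E2 S1 (or_intror erefl).
  apply: (mulfI (expf_neq0 2 z0)); apply/eqP; rewrite -subr_eq0; apply/eqP.
  transitivity (polar_form S0 a b * (x0 * y2 *+ 2 * polar_form S1 a b + z ^+ 2 * polar_form S1 m m)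
     - polar_form S1 a b * (x0 * y2 *+ 2 * polar_form S0 a b + z ^+ 2 * polar_form S0 m m)).
    by ring.
  by rewrite e0 e1 !mulr0 subrr.
have cross' S T : S \in P -> T \in P ->
      polar_form S a b * polar_form T m m = polar_form T a b * polar_form S m m.
  move=> /span[x [y ->]] /span[x' [y' ->]]; rewrite !polarE.
  apply/eqP; rewrite -subr_eq0; apply/eqP.
  transitivity ((x * y' - y * x') * (polar_form S0 a b * polar_form S1 m m
     - polar_form S1 a b * polar_form S0 m m)); first by ring.
  by rewrite cross subrr mulr0.
split=> //.
- by move=> S SP; rewrite aa // am'.
- by exists S0; rewrite S0P ab // mm.
move=> k0 S SP Sab.
have Smm : polar_form S m m = 0.
  have := cross' _ _ S0P SP; rewrite Sab mul0r => /eqP.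
  by rewrite mulf_eq0 (negPf (ab _ S0P rS0)) => /eqP.
have E3 T : T = S0 \/ T = S1 -> x0 * y3 * polar_form T a b + r * y2 * polar_form T a b
    + z * z2 * polar_form T m m + z * y2 * polar_form T m b = 0.
  move=> TS; have TP : T \in P by case: TS => ->.
  have <- : polar_form T p0 p3 + polar_form T p1 p2 = 0.
    by apply: c3; case: TS => ->; [left|right].
  rewrite ep0 ep1 ep2 ep3 y10 scale0r addr0 !polarE (polarC m a (sP _ TP)) aa // am' //.
  by ring.
have : x0 * y3 * polar_form S a b + r * y2 * polar_form S a b
    + z * z2 * polar_form S m m + z * y2 * polar_form S m b = 0.
  have [x [y ->]] := span _ SP; rewrite !polarE.
  have e0 := E3 S0 (or_introl erefl); have e1 := E3 S1 (or_intror erefl).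
  set L0 := (X in X = 0) in e0; set L1 := (X in X = 0) in e1.
  transitivity (x * L0 + y * L1); first by rewrite /L0 /L1; ring.
  by rewrite e0 e1 !mulr0 addr0.
rewrite Sab Smm !mulr0 !add0r => /eqP.
by rewrite !mulf_eq0 (negPf z0) (negPf y20) => /eqP.
Qed.

(** [B] is off the common tangent, since otherwise a regular conic would contain the line [L]; so
    [B] can serve as the third vector of the frame. *)
Lemma type_d_frame P A B L m : is_pencil P -> type_d P A B L -> m \in L -> m \notin A ->
  exists a b, [/\ frame a m b, [/\ A = <[a]>, B = <[b]> & L = <[a]> + <[m]> ]%VS,
    forall S, S \in P -> [/\ polar_form S a a = 0, polar_form S a m = 0 & polar_form S b b = 0],
    exists S, [/\ S \in P, polar_form S a b != 0 & polar_form S m m != 0] &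
    forall S T, S \in P -> T \in P ->
      polar_form S a b * polar_form T m m = polar_form T a b * polar_form S m m].
Proof.
move=> isP [[pA pB lL] AB onB mc] mL mA.
have [a a0 eA] := is_pointP pA; have [b b0 eB] := is_pointP pB.
have bb S : S \in P -> polar_form S b b = 0.
  by apply: base_polar onB _; rewrite eB memv_line.
have ba : b \notin <[a]>%VS.
  apply/negP => ba; apply: AB; rewrite eA eB.
  by apply: is_point_vec b0 => //; rewrite is_point_vline.
have bL : b \notin L.
  apply/negP => bL; have [[S0 [S0P S00] rS0] on tan _] := mc.
  have [_ /andP[_ AL] t] := tan _ (conj S0P S00) rS0.
  have aA : a \in A by rewrite eA memv_line.
  have aL : a \in L by rewrite memvE -eA.
  have lE : L = (<[a]> + <[b]>)%VS by apply: is_line_vec.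
  have [n nL] : exists n, n \notin L by apply: notin_exists; rewrite lE dim_add2.
  have fr : frame a b n by apply: frame_intro => //; rewrite -lE.
  have sS := isP.2 _ S0P.
  have z : polar_form S0 b n *: a - polar_form S0 a n *: b = 0.
    apply: (regular_polar rS0); apply: (polar_frame_ker fr); rewrite !polarE.
    - by rewrite (polarC b a sS) (t a a aA aL) (t a b aA bL); ring.
    - by rewrite (t a b aA bL) (bb _ S0P); ring.
    - by ring.
  have [_ /eqP an _] : [/\ polar_form S0 b n = 0, - polar_form S0 a n = 0 & 0 = 0 :> F].
    by apply: fr.2; rewrite -[RHS]z; vring.
  case/eqP: a0; apply: (regular_polar rS0); apply: (polar_frame_ker fr).
  - exact: t.
  - exact: t.
  - by apply/eqP; rewrite -oppr_eq0.
have [[fr lE] aa ex cr _] := mutual_contact_facts isP pA lL mc eA mL mA bL.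
by exists a, b; split=> // S SP; have [? ?] := aa _ SP; rewrite bb.
Qed.

Lemma type_e_frame P A L m : is_pencil P -> type_e P A L -> m \in L -> m \notin A ->
  exists a b, [/\ frame a m b, A = <[a]>%VS /\ L = (<[a]> + <[m]>)%VS,
    forall S, S \in P -> polar_form S a a = 0 /\ polar_form S a m = 0,
    exists S, [/\ S \in P, polar_form S a b != 0 & polar_form S m m != 0] &
    (forall S T, S \in P -> T \in P ->
      polar_form S a b * polar_form T m m = polar_form T a b * polar_form S m m) /\
    forall S, S \in P -> polar_form S a b = 0 -> polar_form S m b = 0].
Proof.
move=> isP [pA lL mc] mL mA; have [a a0 eA] := is_pointP pA.
have [b bL] : exists b, b \notin L by apply: notin_exists; rewrite (eqP lL).
have [[fr lE] aa ex cr e4] := mutual_contact_facts isP pA lL mc eA mL mA bL.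
by exists a, b; split=> //; split=> //; apply: e4.
Qed.

Lemma line_point_other A L : is_point A -> is_line L -> exists2 m, m \in L & m \notin A.
Proof.
move=> pA lL; apply: contrapT => np; have : (\dim L <= \dim A)%N.
  apply: dimvS; apply/subvP => m mL; apply: contrapT => mA; apply: np.
  by exists m => //; apply/negP.
by rewrite (eqP pA) (eqP lL).
Qed.

End Pencils.

(** * Standard vertices act trivially on the pencil *)

Section Admissible.
Local Open Scope ring_scope.
Variable F : numFieldType.
Local Notation vec := 'rV[F]_3.
Implicit Types (u v a b c m : vec) (S T Qm Qp : 'M[F]_3) (P : {vspace 'M[F]_3}).
Implicit Types (A B C D L LA LC l K : {vspace vec}) (w : vertex F) (f : 'End(vec)).

Lemma frame_rot a b c : frame a b c -> frame b c a.
Proof.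
move=> [sp fr]; split=> [u|x y z e].
  by have [x [y [z ->]]] := sp u; exists y, z, x; vring.
suff /fr[-> -> ->] : z *: a + x *: b + y *: c = 0 by [].
by rewrite -[RHS]e; vring.
Qed.

Lemma frame_swap a b c : frame a b c -> frame b a c.
Proof.
move=> [sp fr]; split=> [u|x y z e].
  by have [x [y [z ->]]] := sp u; exists y, x, z; vring.
suff /fr[-> -> ->] : y *: a + x *: b + z *: c = 0 by [].
by rewrite -[RHS]e; vring.
Qed.

Lemma diagonal_point a b c d u : frame a b c -> d = a + b + c ->
  u \in (<[a]> + <[b]>)%VS -> u \in (<[c]> + <[d]>)%VS -> exists t, u = t *: (a + b).
Proof.
move=> fr -> /memv_line2[x [y ->]] /memv_line2[z [t e]].
have /(frame_inj fr)[-> -> _] : x *: a + y *: b + 0 *: c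
    = t *: a + t *: b + (z + t) *: c.
  by rewrite scale0r addr0 e; vring.
by exists t; rewrite scalerDr.
Qed.

(** The diagonal points on the other two pairs of lines are [a + c] and [b + c]; the line joining
    them meets AB in their difference [a - b]. *)
Lemma K_point_vec a b c d k : frame a b c -> d = a + b + c ->
  k \in K_point <[a]> <[b]> <[c]> <[d]> -> exists t, k = t *: (a - b).
Proof.
move=> fr ed; rewrite /K_point memv_cap => /andP[/memv_line2[x [y ek]]].
move=> /memv_addP[u + [v + ekuv]]; rewrite !memv_cap => /andP[u1 u2] /andP[v1 v2].
have [t et] : exists t, u = t *: (a + c).
  apply: (diagonal_point (c := b) (d := d)) => //.
    exact: frame_rot (frame_swap fr).
  by rewrite ed addrAC.
have [s es] : exists t, v = t *: (b + c).
  apply: (diagonal_point (c := a) (d := d)) => //; first exact: frame_rot.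
  by rewrite ed -addrA addrC.
have /(frame_inj fr)[ex ey ez] : x *: a + y *: b + 0 *: c
    = t *: a + s *: b + (t + s) *: c.
  by rewrite scale0r addr0 -ek ekuv et es; vring.
exists x; rewrite ek scalerBr ex ey; congr (_ + _).
by rewrite -scaleNr; congr (_ *: _); apply/eqP; rewrite -addr_eq0 addrC -ez.
Qed.

Lemma cross_point a b c u : frame a b c ->
  u \in (<[a]> + <[b]>)%VS -> u \in (<[a + b]> + <[c]>)%VS -> exists t, u = t *: (a + b).
Proof.
move=> fr /memv_line2[x [y ->]] /memv_line2[z [t e]].
have /(frame_inj fr)[-> -> _] : x *: a + y *: b + 0 *: c
    = z *: a + z *: b + t *: c.
  by rewrite scale0r addr0 e; vring.
by exists z; rewrite scalerDr.
Qed.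

(** Here M is spanned by [a + b]. An involution that exchanges A and B and fixes M multiplies [a]
    and [b] by the same factor, and its second fixed point is [a - b]. *)
Lemma harmonic_K_vec a b c K : frame a b c ->
  harmonic_K <[a]> <[b]> (<[a + b]> + <[c]>) K -> K = <[a - b]>%VS.
Proof.
move=> fr [/andP[pK KAB] + [f [_ + fK [fA fB]]]]; set M := (_ :&: _)%VS => KM fM.
have [a0 b0 c0] := frame_neq0 fr.
have ME : M = <[a + b]>%VS.
  apply/eqP; rewrite eqEsubv; apply/andP; split.
    apply/subvP => u; rewrite memv_cap => /andP[u1 u2].
    by have [t ->] := cross_point fr u1 u2; rewrite memvZ ?memv_line.
  rewrite -memvE memv_cap mem_line2l andbT; apply/memv_line2.
  by exists 1, 1; rewrite !scale1r.
have fvec u v : (f @: <[u]>)%VS = <[v]>%VS -> exists k, f u = k *: v.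
  by rewrite limg_line => /vline_eq.
have [k fa] := fvec _ _ fA; have [k' fb] := fvec _ _ fB.
rewrite ME in fM KM; have [j fab] := fvec _ _ fM.
have /(frame_inj fr)[e1 e2 _] : k' *: a + k *: b + 0 *: c
    = j *: a + j *: b + 0 *: c.
  by rewrite !scale0r !addr0 -scalerDr -fab linearD /= fa fb addrC.
have k0 : k != 0.
  apply: contraNneq b0 => k0; move: fA; rewrite limg_line fa k0 scale0r => e.
  by have := memv_line b; rewrite -e => /vlineP[t ->]; rewrite scaler0.
have [u u0 eK] := is_pointP pK.
have /memv_line2[x [y eu]] : u \in (<[a]> + <[b]>)%VS by rewrite memvE -eK.
rewrite eK in fK; have [i fu] := fvec _ _ fK.
have /(frame_inj fr)[E1 E2 _] : (k * y) *: a + (k * x) *: b + 0 *: c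
    = (i * x) *: a + (i * y) *: b + 0 *: c.
  transitivity (f u); last by rewrite fu eu; vring.
  by rewrite eu linearD !linearZ /= fa fb e1 -e2; vring.
have xy : x != y.
  apply/eqP => xy; apply: KM; rewrite eK eu xy -scalerDr vline_scale //.
  by apply: contraNneq u0 => y0; rewrite eu xy y0 !scale0r addr0.
have : k * (x + y) = 0.
  have ik : i = - k.
    apply/eqP; rewrite -addr_eq0 -(mulrI_eq0 _ (mulfI (_ : x - y != 0))) ?subr_eq0 //.
    by apply/eqP; transitivity (k * x - i * y - (k * y - i * x)); [ring | rewrite E1 E2; ring].
  apply: mulr2n_inj0; transitivity (k * (x + y) - (- k) * (x + y)); first by ring.
  by rewrite -ik; transitivity (k * x - i * y + (k * y - i * x)); [ring | rewrite E1 E2; ring].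
move/eqP; rewrite mulf_eq0 (negPf k0) /= addr_eq0 => /eqP xN.
rewrite eK eu xN (_ : _ + _ = (- y) *: (a - b)); last by vring.
rewrite vline_scale // oppr_eq0; apply: contraNneq xy => y0.
by rewrite xN y0 oppr0.
Qed.

Lemma mem_line_frame a b c x y z : frame a b c ->
  x *: a + y *: b + z *: c \in (<[a]> + <[b]>)%VS -> z = 0.
Proof.
move=> fr /memv_line2[s [t e]].
by have /(frame_inj fr)[_ _ ->] : x *: a + y *: b + z *: c = s *: a + t *: b + 0 *: c
  by rewrite e scale0r addr0.
Qed.

(** In the frame a, c, m the conics of the pencil have only the terms in s1 s2 and s3^2. The
    symmetry exchanges [a] and [c] with factors [k], [k'] and multiplies [m] by [h], so the claim is
    k k' = h^2; it is read off the images of [a + m] and of the center [n]. *)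
Lemma line_pair_preserving P A C LA LC M S w : is_pencil P -> type_c P A C LA LC ->
  is_point M -> (M <= A + C)%VS -> M <> A -> M <> C ->
  conic_is_line_pair S LA LC -> conic_global_vertex M S w -> preserving P w.
Proof.
move=> [dP sP] tc pM MAC MA MC [_ SE] [_ _ [f [[inv fM _] perm gf]]].
have [a [c [m [fr [eA eC eLA eLC] onP]]]] := type_c_frame sP tc.
have [a0 c0 m0] := frame_neq0 fr.
have frc : frame c m a by apply: frame_rot.
have fra : frame a m c by apply/frame_rot/frame_swap/frame_rot/frame_rot.
have [n n0 eM] := is_pointP pM.
have /memv_line2[x [y en]] : n \in (<[a]> + <[c]>)%VS by rewrite -eA -eC memvE -eM.
have x0 : x != 0.
  apply/eqP => x0; apply: MC; rewrite eM eC en x0 scale0r add0r vline_scale //.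
  by apply: contraNneq n0 => y0; rewrite en x0 y0 !scale0r addr0.
have y0 : y != 0.
  by apply/eqP => y0; apply: MA; rewrite eM eA en y0 scale0r addr0 vline_scale.
have onS u : u != 0 -> u \in LA \/ u \in LC -> on_conic S <[u]>.
  by move=> u0 uL; apply/SE; rewrite ?is_point_vline // -!memvE.
have aLA : a \in LA by rewrite eLA mem_line2l.
have cLC : c \in LC by rewrite eLC mem_line2l.
have mLA : m \in LA by rewrite eLA mem_line2r.
have swap p q : p != 0 -> q != 0 -> p \notin <[q]>%VS -> n \in (<[p]> + <[q]>)%VS ->
    (p \in LA \/ p \in LC) -> (q \in LA \/ q \in LC) -> exists k, f p = k *: q.
  move=> p0 q0 pq nl pS qS; apply: vline_eq; rewrite -limg_line.
  have dl : is_line (<[p]> + <[q]>)%VS by rewrite /is_line addvC dim_add2.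
  have Ml : (M <= <[p]> + <[q]>)%VS by rewrite eM -memvE.
  have pp : point_on <[p]> (<[p]> + <[q]>) by rewrite /point_on is_point_vline // addvSl.
  have [pe _] := perm _ dl Ml _ pp (onS _ p0 pS).
  apply: pe; first by rewrite /point_on is_point_vline // addvSr.
    exact: onS.
  by move=> e; case/negP: pq; rewrite e memv_line.
have ca : c \notin <[a]>%VS.
  apply/vlineP => -[k e].
  have /(frame_inj fr)[_ /eqP] : 0 *: a + 1 *: c + 0 *: m = k *: a + 0 *: c + 0 *: m.
    by rewrite e; vring.
  by rewrite oner_eq0.
have ac : a \notin <[c]>%VS.
  apply/vlineP => -[k e].
  have /(frame_inj fr)[/eqP] : 1 *: a + 0 *: c + 0 *: m = 0 *: a + k *: c + 0 *: m.
    by rewrite e; vring.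
  by rewrite oner_eq0.
have nac : n \in (<[a]> + <[c]>)%VS by apply/memv_line2; exists x, y.
have [k fa] : exists k, f a = k *: c by apply: swap => //; [left|right].
have [k' fc] : exists k, f c = k *: a by apply: swap => //; [rewrite addvC|right|left].
(* [p] lies on LA and [q] on LC, and [x *: p + q = n] puts them on one line through the center; the
   symmetry therefore maps [p] to [q]. *)
pose p := a + m; pose q := y *: c - x *: m.
have pE : p = 1 *: a + 0 *: c + 1 *: m by rewrite /p; vring.
have qE : q = 0 *: a + y *: c + (- x) *: m by rewrite /q; vring.
have p0 : p != 0.
  by apply/eqP => e; have := fr.2 1 0 1; rewrite -pE => /(_ e)[/eqP]; rewrite oner_eq0.
have q0 : q != 0.
  by apply/eqP => e; have := fr.2 0 y (- x); rewrite -qE => /(_ e)[_ /eqP]; rewrite (negPf y0).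
have [i fp] : exists i, f p = i *: q.
  apply: swap => //.
  - apply/vlineP => -[j e].
    have /(frame_inj fr)[/eqP] :
        1 *: a + 0 *: c + 1 *: m = 0 *: a + (j * y) *: c + (- (j * x)) *: m.
      by rewrite -pE e /q; vring.
    by rewrite oner_eq0.
  - by apply/memv_line2; exists x, 1; rewrite en /p /q; vring.
  - by left; rewrite memvD.
  - by right; rewrite /q eLC memvB // memvZ ?mem_line2l ?mem_line2r.
have [h fm] : exists h, f m = h *: m.
  apply: vline_eq; rewrite -limg_line.
  have mn : m \notin <[n]>%VS.
    apply/vlineP => -[j e].
    have /(frame_inj fr)[_ _ /eqP] :
        0 *: a + 0 *: c + 1 *: m = (j * x) *: a + (j * y) *: c + 0 *: m.
      by rewrite !scale0r !add0r scale1r addr0 {1}e en; vring.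
    by rewrite oner_eq0.
  have dl : is_line (<[n]> + <[m]>)%VS by rewrite /is_line dim_add2.
  have Ml : (M <= <[n]> + <[m]>)%VS by rewrite eM addvSl.
  have pm : point_on <[m]> (<[n]> + <[m]>) by rewrite /point_on is_point_vline // addvSr.
  have [_ pe] := perm _ dl Ml _ pm (onS _ m0 (or_introl mLA)).
  apply: pe => z /andP[pz zl] zon; have := (SE _ pz).1 zon => zS.
  have [u u0 ez] := is_pointP pz.
  have /memv_line2[s [t eu]] : u \in (<[n]> + <[m]>)%VS by rewrite memvE -ez.
  (* The line from the center to [m] meets each of LA and LC only at [m]. *)
  have s0 : s = 0.
    case: zS; rewrite ez -memvE => uL.
      have /(mem_line_frame fra)/eqP : (s * x) *: a + t *: m + (s * y) *: c \in (<[a]> + <[m]>)%VS.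
        by rewrite -eLA (_ : _ + _ = u) // eu en; vring.
      by rewrite mulf_eq0 (negPf y0) orbF => /eqP.
    have /(mem_line_frame frc)/eqP : (s * y) *: c + t *: m + (s * x) *: a \in (<[c]> + <[m]>)%VS.
      by rewrite -eLC (_ : _ + _ = u) // eu en; vring.
    by rewrite mulf_eq0 (negPf x0) orbF => /eqP.
  move: u0; rewrite ez eu s0 scale0r add0r => tm; rewrite vline_scale //.
  by apply: contraNneq tm => ->; rewrite scale0r.
have i0 : i != 0.
  apply/eqP => i0; have [ffull f2 _] := inv.
  have := f2 <[p]>%VS; rewrite /point_on is_point_vline // subvf => /(_ isT).
  rewrite !limg_line fp i0 scale0r linear0 => e.
  by case/eqP: p0; have := memv_line p; rewrite -e => /vlineP[t ->]; rewrite scaler0.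
have /(frame_inj fr)[_ e1 e2] : 0 *: a + k *: c + h *: m
   = 0 *: a + (i * y) *: c + (- (i * x)) *: m.
  transitivity (f p); last by rewrite fp /q; vring.
  by rewrite /p linearD /= fa fm; vring.
have [j fn] : exists j, f n = j *: n by apply: vline_eq; rewrite -limg_line -eM.
have /(frame_inj fr)[e3 e4 _] : (y * k') *: a + (x * k) *: c + 0 *: m
   = (j * x) *: a + (j * y) *: c + 0 *: m.
  transitivity (f n); last by rewrite fn en; vring.
  by rewrite en linearD !linearZ /= fa fc; vring.
have kk : k * k' = h ^+ 2.
  apply: (mulfI y0); have ej : j = i * x.
    by apply: (mulIf y0); rewrite -e4 e1; ring.
  by rewrite mulrCA e3 ej e1 e2; ring.
move=> l' z z' u v rf uz vz u0 v0; have [r r0 ->] := given_by_vec gf rf uz vz u0 v0.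
exists (r ^+ 2 * h ^+ 2).
  by rewrite mulf_neq0 ?expf_neq0 // e2 oppr_eq0 mulf_neq0.
move=> T TP; have [aa cc am cm] := onP _ TP; have sT := sP _ TP.
have [s1 [s2 [s3 ->]]] := fr.1 u.
rewrite !linearD !linearZ /= fa fc fm !polarE (polarC m a sT) (polarC m c sT).
rewrite (polarC c a sT) aa cc am cm.
transitivity (r ^+ 2 * (k * k' * s1 * s2 * polar_form T a c *+ 2
   + h ^+ 2 * s3 ^+ 2 * polar_form T m m)); first by ring.
by rewrite kk; ring.
Qed.

(** [m] has to be polar to a second point [d] of [l]. By the description of [l] this holds for one
    regular conic; any other form of the pencil differs from a multiple of it by a form with [m] in
    its kernel. *)
Lemma tangency_line_preserving P A L C l w : is_pencil P -> type_e P A L ->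
  is_point C -> (C <= L)%VS -> C <> A -> tangency_line P A C l ->
  global_vertex C l w -> preserving P w.
Proof.
move=> isP te pC CL CA [dl lE] gv; have [dP sP] := isP.
have [m m0 eC] := is_pointP pC.
have mL : m \in L by rewrite memvE -eC.
have [pA lL _] := te.
have mA : m \notin A.
  by apply/negP => mA; apply: CA; rewrite eC; apply/esym/is_point_vec.
have [a [b [fr [eA eL] aa ex [cr e4]]]] := type_e_frame isP te mL mA.
have [a0 _ b0] := frame_neq0 fr.
have al : a \in l by rewrite memvE -eA; apply/lE => //; left.
have [d da lE'] := is_lineP dl a0 al.
have dl' : d \in l by rewrite lE' mem_line2r.
have d0 : d != 0 by apply: contraNneq da => ->; rewrite mem0v.
have [S [SP rS Sdm]] : exists S, [/\ S \in P, regular S & polar_form S d m = 0].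
  have dl2 : (<[d]> <= l)%VS by rewrite -memvE.
  case: ((lE _ (is_point_vline d0)).1 dl2) => [e|[S [[SP _] rS [_ _ t]]]].
    by case/negP: da; rewrite -eA -e memv_line.
  exists S; split=> //; apply: t; rewrite ?memv_line // eC.
  exact: mem_line2l.
have Sab : polar_form S a b != 0.
  apply: contra a0 => /eqP e; apply/eqP/(regular_polar rS).
  by apply: (polar_frame_ker fr) => //; have [] := aa _ SP.
have Tdm T : T \in P -> polar_form T m d = 0.
  move=> TP; pose k := polar_form T a b / polar_form S a b.
  have QP : T - k *: S \in P by rewrite memvB // memvZ.
  have Qab : polar_form (T - k *: S) a b = 0 by rewrite !polarE /k divfK // subrr.
  have Qmb := e4 _ QP Qab.
  have Qmm : polar_form (T - k *: S) m m = 0.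
    have := cr _ _ SP QP; rewrite Qab mul0r => /eqP.
    by rewrite mulf_eq0 (negPf Sab) => /eqP.
  have Qma : polar_form (T - k *: S) m a = 0.
    by rewrite polarC ?sP //; have [] := aa _ QP.
  have : polar_form (T - k *: S) m d = 0 by apply: (polar_frame_ker fr).
  by rewrite !polarE (polarC m d (sP _ SP)) Sdm mulr0 subr0.
apply: (homology_preserving sP pC gv) => T k v TP.
rewrite eC lE' => /vlineP[t ->] /memv_line2[x [y ->]].
rewrite !polarE Tdm // (polarC m a (sP _ TP)); have [_ ->] := aa _ TP.
by ring.
Qed.

(** The center is the pole of the fixed line for every conic of the pencil; only for the points of
    AC in case c), whose fixed line is not given, are the forms computed directly. *)
Lemma standard_preserving P w : is_pencil P -> is_point (center w) ->
  standard_vertex P w -> preserving P w.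
Proof.
move=> [dP sP] pw; case.
- move=> A B C D ta gv; have pA := pw; rewrite gv.1 in pA.
  have [a [b [c [fr [eA eB eC eD] onP]]]] := type_a_frame sP ta.
  apply: (homology_preserving sP pA gv) => S k v SP.
  rewrite eA eB eC eD memv_cap => /andP[k1 k2].
  have [t ->] := diagonal_point fr erefl k1 k2.
  move=> /memv_addP[v1 + [v2 + ->]]; rewrite !memv_cap => /andP[v11 v12] /andP[v21 v22].
  have [t1 ->] : exists t, v1 = t *: (b + c).
    apply: (diagonal_point (c := a) _ _ v12 v11); first exact: frame_rot.
    by rewrite -addrA addrC.
  have [t2 ->] : exists t, v2 = t *: (a + c).
    apply: (diagonal_point (c := b) _ _ v21 v22); last by rewrite addrAC.
    exact: frame_rot (frame_swap fr).
  have [aa bb cc e] := onP _ SP; have sS := sP _ SP.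
  rewrite !polarE (polarC b a sS) aa bb.
  transitivity (t * (t1 + t2) * (polar_form S a b + polar_form S b c + polar_form S a c)).
    by ring.
  by rewrite e mulr0.
- move=> A B C L K tb; have [a [b [c [fr [eA eB eC eL] onP]]]] := type_b_frame sP tb.
  rewrite eA eB eC eL => hK gv; have pA := pw; rewrite gv.1 in pA.
  have eK := harmonic_K_vec fr hK.
  apply: (homology_preserving sP pA gv) => S k v SP.
  rewrite memv_cap => /andP[k1 k2]; have [t ->] := cross_point fr k1 k2.
  rewrite eK => /memv_line2[x [y ->]].
  have [aa bb cc bc] := onP _ SP; have sS := sP _ SP.
  by rewrite !polarE (polarC b a sS) aa bb bc; ring.
- move=> A C LA LC tc; have [a [c [m [fr [eA eC eLA eLC] onP]]]] := type_c_frame sP tc.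
  rewrite eA eC eLA eLC => gv; have pA := pw; rewrite gv.1 in pA.
  apply: (homology_preserving sP pA gv) => S k v SP.
  rewrite memv_cap => /andP[/memv_line2[x [y ->]] /memv_line2[x' [y' e]]].
  have /(frame_inj fr)[-> _ _] : x *: a + 0 *: c + y *: m
    = 0 *: a + x' *: c + y' *: m.
    by rewrite !scale0r addr0 add0r.
  move=> /memv_line2[s [t ->]]; have [aa cc am cm] := onP _ SP; have sS := sP _ SP.
  by rewrite !polarE (polarC m a sS) (polarC m c sS) am cm; ring.
- move=> A C LA LC M S tc /andP[pM MAC] MA MC lp cg.
  exact: line_pair_preserving (conj dP sP) tc pM MAC MA MC lp cg.
- move=> A L C l te /andP[pC CL] CA tl gv.
  exact: tangency_line_preserving (conj dP sP) te pC CL CA tl gv.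
Qed.

End Admissible.

(** * Skew vertices without neighbors *)

Section SkewVertices.
Local Open Scope ring_scope.
Variable F : numFieldType.
Local Notation vec := 'rV[F]_3.
Implicit Types (u v a b c m : vec) (S T Q Qm Qp : 'M[F]_3) (P : {vspace 'M[F]_3}).
Implicit Types (A B C D E L X Y LA LC l K : {vspace vec}) (w : vertex F) (f : 'End(vec)).

Definition singular S := exists2 n : vec, n != 0 & forall v, polar_form S n v = 0.

(** Cases b) and c). As [Qm] and [Qp] are the only singular conics, the pencil determines them up to
    order and scaling, whatever labelling of base points they come from. *)
Definition two_singular P Qm Qp := [/\ [/\ Qm \in P, Qp \in P, Qm != 0 & Qp \notin <[Qm]>%VS],
  singular Qm, singular Qp &
  forall S, S \in P -> S != 0 -> singular S -> S \in <[Qm]>%VS \/ S \in <[Qp]>%VS].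

(** Separates case a), where no conic of the pencil is singular at a base point, from the other
    cases. *)
Definition base_singular P := exists n : vec, n != 0 /\ exists S, [/\ S \in P, S != 0,
  forall T, T \in P -> polar_form T n n = 0 & forall v, polar_form S n v = 0].

Section TypeA.
Variables (P : {vspace 'M[F]_3}) (a b c : vec).
Hypothesis isP : is_pencil P.
Hypothesis fr : frame a b c.
Hypothesis onP : forall S, S \in P -> [/\ polar_form S a a = 0, polar_form S b b = 0,
      polar_form S c c = 0 & polar_form S a b + polar_form S b c + polar_form S a c = 0].

Lemma type_a_eq0 S : S \in P -> polar_form S a b = 0 -> polar_form S b c = 0 -> S = 0.
Proof.
move=> SP ab bc; have [aa bb cc e] := onP SP.
apply: (polar_frame (isP.2 _ SP) fr) => //.
by rewrite -[RHS]e ab bc !add0r.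
Qed.

Lemma type_a_form S x y z : S \in P ->
  let u := x *: a + y *: b + z *: c in polar_form S u u
  = (x * y * polar_form S a b + y * z * polar_form S b c + x * z * polar_form S a c) *+ 2.
Proof.
move=> SP u; have [aa bb cc e] := onP SP; have sS := isP.2 _ SP.
by rewrite /u !polarE (polarC b a sS) (polarC c a sS) (polarC c b sS) aa bb cc; ring.
Qed.

(** The conics with S(a, b) = 0 and with S(b, c) = 0 give z (y - x) = 0 and x (y - z) = 0, with the
    four base points as solutions. Hence any other labelling of the base points is a permutation of
    this one. *)
Lemma type_a_base_vec n : n != 0 -> (forall T, T \in P -> polar_form T n n = 0) ->
  [\/ <[n]>%VS = <[a]>%VS, <[n]>%VS = <[b]>%VS, <[n]>%VS = <[c]>%VS |
      <[n]>%VS = <[a + b + c]>%VS].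
Proof.
move=> n0 base; have [x [y [z en]]] := fr.1 n.
have [dP _] := isP.
have z1 : z * (y - x) = 0.
  have [T [TP T0 ab]] := pencil_polar_zero a b dP; have [_ _ _ e] := onP TP.
  have bc : polar_form T b c != 0 by apply: contra T0 => /eqP bc; apply/eqP/type_a_eq0.
  have := base T TP; rewrite en type_a_form // => /mulr2n_inj0 e2.
  apply: (mulIf bc); rewrite mul0r -[RHS]e2 ab.
  have -> : polar_form T a c = - polar_form T b c.
    by apply/eqP; move: e; rewrite -addr_eq0 ab add0r addrC => ->.
  by ring.
have z2 : x * (y - z) = 0.
  have [T [TP T0 bc]] := pencil_polar_zero b c dP; have [_ _ _ e] := onP TP.
  have ab : polar_form T a b != 0 by apply: contra T0 => /eqP ab; apply/eqP/type_a_eq0.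
  have := base T TP; rewrite en type_a_form // => /mulr2n_inj0 e2.
  apply: (mulIf ab); rewrite mul0r -[RHS]e2 bc.
  have -> : polar_form T a c = - polar_form T a b.
    by apply/eqP; move: e; rewrite -addr_eq0 bc addr0 addrC => ->.
  by ring.
have sc k u : k *: u != 0 -> <[k *: u]>%VS = <[u]>%VS.
  by move=> ku; apply: vline_scale; apply: contraNneq ku => ->; rewrite scale0r.
have [zz|zz] := eqVneq z 0.
  move: z2; rewrite zz subr0 => /eqP; rewrite mulf_eq0 => /orP[/eqP xx|/eqP yy].
    have e : n = y *: b by rewrite en zz xx; vring.
    by constructor 2; rewrite e sc // -e.
  have e : n = x *: a by rewrite en zz yy; vring.
  by constructor 1; rewrite e sc // -e.
move: z1 => /eqP; rewrite mulf_eq0 (negPf zz) subr_eq0 => /eqP yx.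
move: z2; rewrite -yx => /eqP; rewrite mulf_eq0 => /orP[/eqP xx|].
  have e : n = z *: c by rewrite en -yx xx; vring.
  by constructor 3; rewrite e sc // -e.
rewrite subr_eq0 => /eqP yz; have e : n = z *: (a + b + c) by rewrite en -yx yz; vring.
by constructor 4; rewrite e sc // -e.
Qed.

Lemma type_a_not_base_singular : ~ base_singular P.
Proof.
move=> [n [n0 [S [SP S0 base sing]]]]; have [aa bb cc e] := onP SP; have sS := isP.2 _ SP.
have sing' u : <[n]>%VS = <[u]>%VS -> forall v, polar_form S u v = 0.
  by move=> /esym/vline_eq[k ->] v; rewrite polarE sing mulr0.
case/eqP: S0; have [/sing' z|/sing' z|/sing' z|/sing' z] := type_a_base_vec n0 base.
- by apply: (polar_frame sS fr) => //; rewrite -[RHS]e !z add0r addr0.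
- by apply: (polar_frame sS fr) => //; rewrite ?(polarC a b sS) // -[RHS]e (polarC a b sS) !z !add0r.
- by apply: (polar_frame sS fr) => //; rewrite ?(polarC b c sS) ?(polarC a c sS) // -[RHS]e (polarC b c sS) (polarC a c sS) !z !addr0.
have := z a; have := z b; have := z c; rewrite !polarE (polarC b a sS) (polarC c a sS).
rewrite (polarC c b sS) aa bb cc !addr0 !add0r => e1 e2 e3.
have ab : polar_form S a b = 0 by rewrite -[RHS](subrr 0) -{1}e -{1}e1; ring.
have bc : polar_form S b c = 0 by rewrite -[RHS](subrr 0) -{1}e -{1}e3; ring.
exact: type_a_eq0.
Qed.

(** [Qm] is the pair of lines AB and CD, which contains both the center and the fixed line CD; [Qp]
    is the conic for which the center is the pole of CD. *)
Lemma K_reversing Qm Qp w : is_point (center w) -> Qm \in P -> Qp \in P ->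
  polar_form Qm a b = 0 -> polar_form Qp (a - b) c = 0 ->
  global_vertex (K_point <[a]> <[b]> <[c]> <[a + b + c]>) (<[c]> + <[a + b + c]>) w ->
  reversing Qm Qp w.
Proof.
move=> pw QmP QpP mab pabc gv; have [_ sP] := isP; have pA := pw; rewrite gv.1 in pA.
have [ma mb mc me] := onP QmP; have [qa qb qc qe] := onP QpP.
have sm := sP _ QmP; have sp := sP _ QpP.
move: pabc; rewrite !polarE => pabc.
apply: (homology_reversing sm sp pA gv).
- move=> v /memv_line2[x [y ->]]; rewrite !polarE (polarC b a sm) (polarC c a sm).
  rewrite (polarC c b sm) ma mb mc mab.
  transitivity ((x * y + y ^+ 2) *+ 2 * (polar_form Qm a b + polar_form Qm b c + polar_form Qm a c)).
    by rewrite mab; ring.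
  by rewrite me mulr0.
- move=> k /(K_point_vec fr erefl)[t ->]; rewrite !polarE (polarC b a sm) ma mb mab.
  by ring.
move=> k v /(K_point_vec fr erefl)[t ->] /memv_line2[x [y ->]].
rewrite !polarE (polarC b a sp) qa qb.
transitivity (t * (x + y) * (polar_form Qp a c - polar_form Qp b c)); first by ring.
by rewrite pabc mulr0.
Qed.

End TypeA.

(** In the frame c, d, a with d = -(a + b + c) the fourth base point is c + d + a = -b. The
    conditions on [Qm] and [Qp] are symmetric under exchange of the pairs AB and CD, so the opposite
    vertex induces the same involution. *)
Lemma K_opposite_reversing P a b c Qm Qp w : is_pencil P -> frame a b c ->
  (forall S, S \in P -> [/\ polar_form S a a = 0, polar_form S b b = 0,
      polar_form S c c = 0 & polar_form S a b + polar_form S b c + polar_form S a c = 0]) ->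
  is_point (center w) -> Qm \in P -> Qp \in P ->
  polar_form Qm a b = 0 -> polar_form Qp (a - b) c = 0 ->
  global_vertex (K_point <[c]> <[a + b + c]> <[a]> <[b]>) (<[a]> + <[b]>) w ->
  reversing Qm Qp w.
Proof.
move=> isP fr onP pw QmP QpP mab pabc.
have N (u : vec) : <[- u]>%VS = <[u]>%VS.
  by rewrite -scaleN1r vline_scale // oppr_eq0 oner_eq0.
pose d := - (a + b + c).
have bE : - b = c + d + a by rewrite /d; vring.
rewrite -(N (a + b + c)) -/d -(N b) bE.
have fr' : frame c d a.
  split=> [u|x y z e].
    have [x [y [z ->]]] := fr.1 u; exists (z - y), (- y), (x - y).
    by rewrite /d; vring.
  have /fr.2[e1 e2 e3] : (z - y) *: a + (- y) *: b + (x - y) *: c = 0.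
    by rewrite -[RHS]e /d; vring.
  have y0 : y = 0 by apply/eqP; rewrite -oppr_eq0 e2.
  by move: e1 e3; rewrite y0 !subr0.
apply: (K_reversing isP fr') => //.
- move=> S SP; have [aa bb cc e] := onP _ SP; have sS := isP.2 _ SP.
  rewrite /d !polarE (polarC b a sS) (polarC c a sS) (polarC c b sS) aa bb cc.
  split=> //.
    transitivity ((polar_form S a b + polar_form S b c + polar_form S a c) *+ 2).
      by ring.
    by rewrite e mul0rn.
  transitivity (- (polar_form S a b + polar_form S b c + polar_form S a c)); first by ring.
  by rewrite e oppr0.
- have [aa bb cc e] := onP _ QmP; have sS := isP.2 _ QmP.
  rewrite /d !polarE (polarC c a sS) (polarC c b sS) cc.
  transitivity (polar_form Qm a b - (polar_form Qm a b + polar_form Qm b c + polar_form Qm a c)).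
    by ring.
  by rewrite e mab subrr.
have [aa bb cc e] := onP _ QpP; have sS := isP.2 _ QpP.
move: pabc; rewrite /d !polarE (polarC b a sS) (polarC c a sS) aa => pabc.
transitivity ((polar_form Qp a b + polar_form Qp b c + polar_form Qp a c)
  + (polar_form Qp a c - polar_form Qp b c)); first by ring.
by rewrite e pabc addr0.
Qed.

Lemma K_point_swapl E L X Y : K_point L E X Y = K_point E L X Y.
Proof.
rewrite /K_point (addvC L E) (capvC (L + X)%VS) (capvC (L + Y)%VS).
by congr (_ :&: _)%VS; exact: addvC.
Qed.

Lemma K_point_swapr E L X Y : K_point E L Y X = K_point E L X Y.
Proof. by congr (_ :&: _)%VS; exact: addvC. Qed.

Lemma type_a_swapl P E L X Y : type_a P E L X Y -> type_a P L E X Y.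
Proof.
move=> [[pE pL pX pY] [l1 l2 l3 l4 [l5 l6]] [n1 n2 n3 n4] PE].
split=> //.
- by rewrite (addvC L E).
- by rewrite (addvC L E).
by move=> S; rewrite PE; split=> -[? []]; split.
Qed.

Lemma type_a_swapr P E L X Y : type_a P E L X Y -> type_a P E L Y X.
Proof.
move=> [[pE pL pX pY] [l1 l2 l3 l4 [l5 l6]] [n1 n2 n3 n4] PE].
have ex Z : is_line (Z + X) -> is_line (Z + Y) -> ~~ (Y <= Z + X)%VS -> ~~ (X <= Z + Y)%VS.
  move=> /eqP d1 /eqP d2; apply: contra => XZ.
  have /eqP -> : (Z + X == Z + Y)%VS by rewrite eqEdim subv_add addvSl XZ d1 d2.
  exact: addvSr.
split=> //.
- by rewrite (addvC Y X).
- by split=> //; apply: ex.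
by move=> S; rewrite PE; split=> -[? []]; split.
Qed.

Lemma skew_K_swapl P E L X Y w : skew_K_vertex P E L X Y w -> skew_K_vertex P L E X Y w.
Proof. by move=> [ta gv]; split; [exact: type_a_swapl|rewrite K_point_swapl]. Qed.

Lemma skew_K_swapr P E L X Y w : skew_K_vertex P E L X Y w -> skew_K_vertex P E L Y X w.
Proof. by move=> [ta gv]; split; [exact: type_a_swapr|rewrite K_point_swapr addvC]. Qed.

Definition conic_pair P Qm Qp :=
  [/\ Qm \in P, Qp \in P, Qm != 0 & Qp \notin <[Qm]>%VS].

Lemma type_a_pair P a b c : is_pencil P -> frame a b c ->
  (forall S, S \in P -> [/\ polar_form S a a = 0, polar_form S b b = 0,
      polar_form S c c = 0 & polar_form S a b + polar_form S b c + polar_form S a c = 0]) ->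
  exists Qm Qp, [/\ conic_pair P Qm Qp, polar_form Qm a b = 0 & polar_form Qp (a - b) c = 0].
Proof.
move=> isP fr onP; have [dP sP] := isP.
have [Qm [QmP Qm0 mab]] := pencil_polar_zero a b dP.
have [Qp [QpP Qp0 pabc]] := pencil_polar_zero (a - b) c dP.
exists Qm, Qp; split=> //; split=> //; apply/vlineP => -[k e].
have [aa bb cc se] := onP _ QpP.
have ab : polar_form Qp a b = 0 by rewrite e polarE mab mulr0.
case/eqP: Qp0; apply: (type_a_eq0 isP fr onP QpP ab).
move: se pabc; rewrite ab add0r !polarE => se /subr0_eq e2.
by apply: mulr2n_inj0; rewrite mulr2n -[RHS]se e2.
Qed.

(** Two skew vertices in case a) belong to the same pair of base points, to opposite pairs or to
    neighboring ones, and the last possibility is excluded here. *)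
Lemma type_a_common P (W : vertex F -> Prop) E L X Y w0 : is_pencil P ->
  (forall w, W w -> is_point (center w)) -> ~ has_neighbor_skew_vertices P W ->
  W w0 -> skew_K_vertex P E L X Y w0 ->
  exists Qm Qp, conic_pair P Qm Qp /\
    forall w E' L' X' Y', W w -> skew_K_vertex P E' L' X' Y' w -> reversing Qm Qp w.
Proof.
move=> isP pW nn W0 K0; have [ta gv0] := K0; have [dP sP] := isP.
have [a [b [c [fr [eE eL eX eY] onP]]]] := type_a_frame sP ta.
have [Qm [Qp [cp mab pabc]]] := type_a_pair isP fr onP.
exists Qm, Qp; split=> // w E' L' X' Y' Ww K'.
have [QmP QpP _ _] := cp.
have rev1 : global_vertex (K_point E L X Y) (X + Y) w -> reversing Qm Qp w.
  by rewrite eE eL eX eY; apply: (K_reversing isP fr onP (pW _ Ww)).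
have rev2 : global_vertex (K_point X Y E L) (E + L) w -> reversing Qm Qp w.
  by rewrite eE eL eX eY; apply: (K_opposite_reversing isP fr onP (pW _ Ww)).
have [ta' gv'] := K'.
have base B : is_point B -> (forall S, pencil_conic P S -> on_conic S B) ->
    [\/ B = E, B = L, B = X | B = Y].
  move=> pB onB; have [n n0 eB] := is_pointP pB; rewrite eE eL eX eY eB.
  apply: (type_a_base_vec isP fr onP n0) => T TP.
  by apply: base_polar onB _ TP; rewrite eB memv_line.
have [[pE pL pX pY] [l1 l2 l3 l4 [l5 l6]] _ PE] := ta'.
have onE : forall S, pencil_conic P S -> on_conic S E' by move=> S /PE[_ []].
have onL : forall S, pencil_conic P S -> on_conic S L' by move=> S /PE[_ []].
have onX : forall S, pencil_conic P S -> on_conic S X' by move=> S /PE[_ []].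
have onY : forall S, pencil_conic P S -> on_conic S Y' by move=> S /PE[_ []].
have ne B B' : is_point B -> is_line (B + B')%VS -> B <> B'.
  by move=> pB lB e; move: lB pB; rewrite -e addvv /is_line /is_point => /eqP ->.
have EL := ne _ _ pE l1; have EX := ne _ _ pE l2; have EY := ne _ _ pE l3.
have LX := ne _ _ pL l4; have LY := ne _ _ pL l5; have XY := ne _ _ pX l6.
have K0l := skew_K_swapl K0; have K0r := skew_K_swapr K0; have K0lr := skew_K_swapl K0r.
have Kl := skew_K_swapl K'; have Kr := skew_K_swapr K'; have Klr := skew_K_swapl Kr.
have nb e l x y : skew_K_vertex P e l x y w0 -> skew_K_vertex P e x l y w -> False.
  by move=> h1 h2; apply: nn; exists e, l, x, y, w0, w.
(* Of the 24 ways in which E', L', X', Y' can label the base points, 8 respect the partition EL |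
   XY; all others contradict the absence of neighbors. *)
have [e1|e1|e1|e1] := base _ pE onE; have [e2|e2|e2|e2] := base _ pL onL;
  try (by case: EL; rewrite e1 e2);
  have [e3|e3|e3|e3] := base _ pX onX;
  try (by case: EX; rewrite e1 e3); try (by case: LX; rewrite e2 e3);
  have [e4|e4|e4|e4] := base _ pY onY;
  try (by case: EY; rewrite e1 e4); try (by case: LY; rewrite e2 e4);
  try (by case: XY; rewrite e3 e4);
  rewrite {}e1 {}e2 {}e3 {}e4 in Kl Kr Klr K' gv' *;
  first [ exact: rev1 Klr.2 | exact: rev1 Kl.2 | exact: rev1 Kr.2 | exact: rev1 K'.2
        | exact: rev2 Klr.2 | exact: rev2 Kl.2 | exact: rev2 Kr.2 | exact: rev2 K'.2
        | exfalso; first [exact: nb K0 K' | exact: nb K0 Kl | exact: nb K0 Kr | exact: nb K0 Klr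
          | exact: nb K0l K' | exact: nb K0l Kl | exact: nb K0l Kr | exact: nb K0l Klr
          | exact: nb K0r K' | exact: nb K0r Kl | exact: nb K0r Kr | exact: nb K0r Klr
          | exact: nb K0lr K' | exact: nb K0lr Kl | exact: nb K0lr Kr | exact: nb K0lr Klr]].
Qed.

End SkewVertices.

(** * Skew vertices in cases b) to e), and the involution common to all skew vertices *)

Section SkewPairs.
Local Open Scope ring_scope.
Variable F : numFieldType.
Local Notation vec := 'rV[F]_3.
Implicit Types (u v a b c m : vec) (S T Q Qm Qp : 'M[F]_3) (P : {vspace 'M[F]_3}).
Implicit Types (A B C D E L X Y LA LC l K : {vspace vec}) (w : vertex F) (f : 'End(vec)).

(** [Qm] consists of the lines AB and L, [Qp] of the lines CA and CB. *)
Lemma type_b_conics P a b c : is_pencil P -> frame a b c ->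
  (forall S, S \in P -> [/\ polar_form S a a = 0, polar_form S b b = 0,
      polar_form S c c = 0 & polar_form S b c = - polar_form S a c]) ->
  exists Qm Qp, [/\ two_singular P Qm Qp, polar_form Qm a b = 0 &
    forall v, polar_form Qp c v = 0].
Proof.
move=> isP fr onP; have [dP sP] := isP; have [a0 b0 c0] := frame_neq0 fr.
have [Qm [QmP Qm0 mab]] := pencil_polar_zero a b dP.
have [Qp [QpP Qp0 pac]] := pencil_polar_zero a c dP.
have zero S : S \in P -> polar_form S a b = 0 -> polar_form S a c = 0 -> S = 0.
  move=> SP ab ac; have [aa bb cc bc] := onP _ SP.
  by apply: (polar_frame (sP _ SP) fr) => //; rewrite bc ac oppr0.
have sing : forall v, polar_form Qp c v = 0.
  have [aa bb cc bc] := onP _ QpP; have sp := sP _ QpP.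
  by apply: (polar_frame_ker fr) => //; rewrite polarC // bc pac oppr0.
exists Qm, Qp; split=> //; split=> //.
- split=> //; apply/vlineP => -[k e]; case/eqP: Qp0; apply: zero => //.
  by rewrite e polarE mab mulr0.
- have [aa bb cc bc] := onP _ QmP; have sm := sP _ QmP.
  exists (a + b); first by apply/eqP => e; have := fr.2 1 1 0; rewrite !scale1r scale0r addr0
     => /(_ e)[/eqP]; rewrite oner_eq0.
  apply: (polar_frame_ker fr); rewrite !polarE ?(polarC b a sm) ?aa ?bb ?mab ?bc ?addr0 //.
  exact: subrr.
- by exists c.
move=> S SP S0 [n n0 sn]; have [aa bb cc bc] := onP _ SP; have sS := sP _ SP.
have [ab|ab] := eqVneq (polar_form S a b) 0.
  have mac : polar_form Qm a c != 0.
    by apply: contra Qm0 => /eqP mac; apply/eqP/zero.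
  left; apply/vlineP; exists (polar_form S a c / polar_form Qm a c).
  apply/eqP; rewrite -subr_eq0; apply/eqP/zero; rewrite ?memvB ?memvZ // !polarE.
    by rewrite ab mab mulr0 subr0.
  by rewrite divfK // subrr.
have [ac|ac] := eqVneq (polar_form S a c) 0.
  have pab : polar_form Qp a b != 0.
    by apply: contra Qp0 => /eqP pab; apply/eqP/zero.
  right; apply/vlineP; exists (polar_form S a b / polar_form Qp a b).
  apply/eqP; rewrite -subr_eq0; apply/eqP/zero; rewrite ?memvB ?memvZ // !polarE.
    by rewrite divfK // subrr.
  by rewrite ac pac mulr0 subr0.
case/eqP: n0; have [x [y [z en]]] := fr.1 n.
have := sn a; have := sn b; have := sn c; rewrite en !polarE (polarC b a sS).
rewrite (polarC c a sS) (polarC c b sS) aa bb cc bc !mulr0 !addr0 !add0r => e1 e2 e3.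
have xy : x = y.
  by apply: (mulIf ac); apply/eqP; rewrite -subr_eq0 -mulrN e1.
have : x * polar_form S a b *+ 2 = 0.
  by rewrite mulr2n -[RHS](addr0 0) -{1}e2 -e3 xy; ring.
move=> /mulr2n_inj0/eqP; rewrite mulf_eq0 (negPf ab) orbF => /eqP x0.
move: e3; rewrite -xy x0 mul0r add0r => /eqP; rewrite mulf_eq0 (negPf ac) orbF => /eqP ->.
by vring.
Qed.

(** [Qm] consists of the two tangent lines, and [Qp] is the line AC counted twice. *)
Lemma type_c_conics P a c m : is_pencil P -> frame a c m ->
  (forall S, S \in P -> [/\ polar_form S a a = 0, polar_form S c c = 0,
      polar_form S a m = 0 & polar_form S c m = 0]) ->
  exists Qm Qp, [/\ two_singular P Qm Qp, polar_form Qm m m = 0, polar_form Qp a c = 0,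
    forall v, polar_form Qp a v = 0 & forall v, polar_form Qp c v = 0].
Proof.
move=> isP fr onP; have [dP sP] := isP; have [a0 c0 m0] := frame_neq0 fr.
have [Qm [QmP Qm0 mm]] := pencil_polar_zero m m dP.
have [Qp [QpP Qp0 pac]] := pencil_polar_zero a c dP.
have zero S : S \in P -> polar_form S a c = 0 -> polar_form S m m = 0 -> S = 0.
  move=> SP ac mm'; have [aa cc am cm] := onP _ SP.
  exact: (polar_frame (sP _ SP) fr).
have sing_a : forall v, polar_form Qp a v = 0.
  by have [aa cc am cm] := onP _ QpP; apply: (polar_frame_ker fr).
have sing_c : forall v, polar_form Qp c v = 0.
  have [aa cc am cm] := onP _ QpP.
  by apply: (polar_frame_ker fr) => //; rewrite polarC ?sP.
exists Qm, Qp; split=> //; split=> //.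
- split=> //; apply/vlineP => -[k e]; case/eqP: Qp0; apply: zero => //.
  by rewrite e polarE mm mulr0.
- have [aa cc am cm] := onP _ QmP; have sm := sP _ QmP.
  exists m => //; apply: (polar_frame_ker fr) => //; by rewrite polarC.
- by exists a.
move=> S SP S0 [n n0 sn]; have [aa cc am cm] := onP _ SP; have sS := sP _ SP.
have [ac|ac] := eqVneq (polar_form S a c) 0.
  have pmm : polar_form Qp m m != 0.
    by apply: contra Qp0 => /eqP pmm; apply/eqP/zero.
  right; apply/vlineP; exists (polar_form S m m / polar_form Qp m m).
  apply/eqP; rewrite -subr_eq0; apply/eqP/zero; rewrite ?memvB ?memvZ // !polarE.
    by rewrite ac pac mulr0 subr0.
  by rewrite divfK // subrr.
have [smm|smm] := eqVneq (polar_form S m m) 0.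
  have mac : polar_form Qm a c != 0.
    by apply: contra Qm0 => /eqP mac; apply/eqP/zero.
  left; apply/vlineP; exists (polar_form S a c / polar_form Qm a c).
  apply/eqP; rewrite -subr_eq0; apply/eqP/zero; rewrite ?memvB ?memvZ // !polarE.
    by rewrite divfK // subrr.
  by rewrite smm mm mulr0 subr0.
case/eqP: n0; have [x [y [z en]]] := fr.1 n.
have := sn a; have := sn c; have := sn m; rewrite en !polarE (polarC c a sS).
rewrite (polarC m a sS) (polarC m c sS) aa cc am cm !mulr0 !addr0 !add0r.
move=> /eqP; rewrite mulf_eq0 (negPf smm) orbF => /eqP ->.
move=> /eqP; rewrite mulf_eq0 (negPf ac) orbF => /eqP ->.
move=> /eqP; rewrite mulf_eq0 (negPf ac) orbF => /eqP ->.
by vring.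
Qed.

(** [Q] consists of the lines L and AB; it is singular at A and, up to scaling, the only singular
    conic of the pencil. *)
Lemma type_d_singular P a m b Q : is_pencil P -> frame a m b ->
  (forall S, S \in P -> [/\ polar_form S a a = 0, polar_form S a m = 0 & polar_form S b b = 0]) ->
  (forall S T, S \in P -> T \in P ->
      polar_form S a b * polar_form T m m = polar_form T a b * polar_form S m m) ->
  (exists S, [/\ S \in P, polar_form S a b != 0 & polar_form S m m != 0]) ->
  Q \in P -> Q != 0 -> polar_form Q a b = 0 ->
  [/\ polar_form Q m m = 0, forall v, polar_form Q a v = 0 &
    forall S, S \in P -> singular S -> S \in <[Q]>%VS].
Proof.
move=> isP fr onP cr [S0 [S0P ab0 mm0]] QP Q0 Qab; have [dP sP] := isP.
have mm S : S \in P -> polar_form S a b = 0 -> polar_form S m m = 0.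
  move=> SP ab; have := cr _ _ S0P SP; rewrite ab mul0r => /eqP.
  by rewrite mulf_eq0 (negPf ab0) => /eqP.
split; [exact: mm| |].
  by have [aa am bb] := onP _ QP; apply: (polar_frame_ker fr).
move=> S SP [n n0 sn]; have [aa am bb] := onP _ SP; have sS := sP _ SP.
have [ab|ab] := eqVneq (polar_form S a b) 0.
  have Qbm : polar_form Q m b != 0.
    have [aa' am' bb'] := onP _ QP; apply: contra Q0 => /eqP e.
    by apply/eqP/(polar_frame (sP _ QP) fr) => //; apply: mm.
  apply/vlineP; exists (polar_form S m b / polar_form Q m b).
  apply/eqP; rewrite -subr_eq0; apply/eqP; set R := S - _.
  have RP : R \in P by rewrite memvB // memvZ.
  have Rab : polar_form R a b = 0 by rewrite !polarE ab Qab mulr0 subr0.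
  have [aa' am' bb'] := onP _ RP.
  apply: (polar_frame (sP _ RP) fr) => //; first exact: mm.
  by rewrite !polarE divfK // subrr.
have smm : polar_form S m m != 0.
  apply/eqP => e; have := cr _ _ SP S0P; rewrite e mulr0 => /eqP.
  by rewrite mulf_eq0 (negPf ab) (negPf mm0).
case/eqP: n0; have [x [y [z en]]] := fr.1 n.
have := sn b; have := sn m; have := sn a; rewrite en !polarE (polarC m a sS).
rewrite (polarC b a sS) (polarC b m sS) aa am bb !mulr0 !addr0 !add0r.
move=> /eqP; rewrite mulf_eq0 (negPf ab) orbF => /eqP ->.
rewrite mul0r addr0 => /eqP; rewrite mulf_eq0 (negPf smm) orbF => /eqP ->.
rewrite mul0r addr0 => /eqP; rewrite mulf_eq0 (negPf ab) orbF => /eqP ->.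
by vring.
Qed.

Lemma type_d_two_singular P A B L Qm Qp : is_pencil P -> type_d P A B L ->
  ~ two_singular P Qm Qp.
Proof.
move=> isP td [[QmP QpP Qm0 Qpm] sm sp _]; have [[pA _ lL] _ _ _] := td.
have [m mL mA] := line_point_other pA lL.
have [a [b [fr _ onP ex cr]]] := type_d_frame isP td mL mA.
have [Q [QP Q0 Qab]] := pencil_polar_zero a b isP.1.
have [_ _ sing] := type_d_singular isP fr onP cr ex QP Q0 Qab.
have /vlineP[k ek] := sing _ QmP sm; have /vlineP[k' ek'] := sing _ QpP sp.
case/negP: Qpm; apply/vlineP; exists (k' / k); rewrite ek ek' scalerA divfK //.
by apply: contraNneq Qm0 => k0; rewrite ek k0 scale0r.
Qed.

(** The alternatives are properties of the pencil as far as possible, so that they can be compared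
    for two vertices that come with different types or labels. Cases b) and c) share the second
    alternative. *)
Lemma skew_global_cases P w : is_pencil P -> is_point (center w) ->
  skew_global_vertex P w ->
  [\/ exists E L X Y, skew_K_vertex P E L X Y w,
      base_singular P /\ exists Qm Qp, two_singular P Qm Qp /\ reversing Qm Qp w |
      exists A B L C, [/\ type_d P A B L, point_on C L, C <> A & global_vertex C (A + B) w]].
Proof.
move=> isP pw; have [dP sP] := isP; case.
- by move=> E L X Y h; constructor 1; exists E, L, X, Y.
- move=> A B C L K tb; have [a [b [c [fr [eA eB eC eL] onP]]]] := type_b_frame sP tb.
  rewrite eA eB eL => hK gv; have pK := pw; rewrite gv.1 in pK.
  have eK := harmonic_K_vec fr hK.
  have [Qm [Qp [ts mab sing]]] := type_b_conics isP fr onP.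
  have [[QmP QpP Qm0 Qpm] _ _ _] := ts; have sm := sP _ QmP; have sp := sP _ QpP.
  have [ma mb mc mbc] := onP _ QmP; have [qa qb qc qbc] := onP _ QpP.
  constructor 2; split.
    exists c; split; first by have [] := frame_neq0 fr.
    exists Qp; split=> //; first by apply: contraNneq Qpm => ->; rewrite mem0v.
    by move=> T /onP[].
  exists Qm, Qp; split=> //; apply: (homology_reversing sm sp pK gv).
  + move=> v /memv_line2[x [y ->]]; rewrite !polarE (polarC b a sm) (polarC c a sm).
    by rewrite (polarC c b sm) ma mb mc mab mbc; ring.
  + rewrite eK => k /vlineP[t ->]; rewrite !polarE (polarC b a sm) ma mb mab.
    by ring.
  rewrite eK => k v /vlineP[t ->] /memv_line2[x [y ->]].
  by rewrite !polarE (polarC b a sp) (polarC a c sp) (polarC b c sp) !sing qa qb; ring.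
- move=> A B C L tb; have [a [b [c [fr [eA eB eC eL] onP]]]] := type_b_frame sP tb.
  rewrite eA eB eC => gv; have pC := pw; rewrite gv.1 in pC.
  have [Qm [Qp [ts mab sing]]] := type_b_conics isP fr onP.
  have [[QmP QpP Qm0 Qpm] _ _ _] := ts; have sm := sP _ QmP; have sp := sP _ QpP.
  have [ma mb mc mbc] := onP _ QmP.
  constructor 2; split.
    exists c; split; first by have [] := frame_neq0 fr.
    exists Qp; split=> //; first by apply: contraNneq Qpm => ->; rewrite mem0v.
    by move=> T /onP[].
  exists Qm, Qp; split=> //; apply: (homology_reversing sm sp pC gv).
  + move=> v /memv_line2[x [y ->]]; rewrite !polarE (polarC b a sm) ma mb mab.
    by ring.
  + by move=> k /vlineP[t ->]; rewrite !polarE mc; ring.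
  by move=> k v /vlineP[t ->] _; rewrite polarE sing mulr0.
- move=> A C LA LC tc; have [a [c [m [fr [eA eC eLA eLC] onP]]]] := type_c_frame sP tc.
  rewrite eA eLC => gv; have pA := pw; rewrite gv.1 in pA.
  have [Qm [Qp [ts mm pac sing _]]] := type_c_conics isP fr onP.
  have [[QmP QpP Qm0 Qpm] _ _ _] := ts; have sm := sP _ QmP; have sp := sP _ QpP.
  have [ma mc mam mcm] := onP _ QmP.
  constructor 2; split.
    exists a; split; first by have [] := frame_neq0 fr.
    exists Qp; split=> //; first by apply: contraNneq Qpm => ->; rewrite mem0v.
    by move=> T /onP[].
  exists Qm, Qp; split=> //; apply: (homology_reversing sm sp pA gv).
  + move=> v /memv_line2[x [y ->]]; rewrite !polarE (polarC m c sm) mc mcm mm.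
    by ring.
  + by move=> k /vlineP[t ->]; rewrite !polarE ma; ring.
  by move=> k v /vlineP[t ->] _; rewrite polarE sing mulr0.
move=> A B L C td pC CA gv; constructor 3; by exists A, B, L, C.
Qed.

(** [Qm] is the pair L, AB, which contains the center and the fixed line; [Qp] is the conic whose
    tangent at B passes through the center. *)
Lemma type_d_reversing P A B C w Qm Qp a m b : is_pencil P -> frame a m b ->
  A = <[a]>%VS -> B = <[b]>%VS -> C = <[m]>%VS ->
  (forall S, S \in P -> [/\ polar_form S a a = 0, polar_form S a m = 0 & polar_form S b b = 0]) ->
  is_point (center w) -> global_vertex C (A + B) w -> Qm \in P -> Qp \in P ->
  polar_form Qm a b = 0 -> polar_form Qm m m = 0 -> polar_form Qp m b = 0 ->
  reversing Qm Qp w.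
Proof.
move=> isP fr -> -> -> onP pw gv QmP QpP mab mm pmb; have [dP sP] := isP.
have pC := pw; rewrite gv.1 in pC; have sm := sP _ QmP; have sp := sP _ QpP.
have [ma mam mb] := onP _ QmP; have [pa pam pb] := onP _ QpP.
apply: (homology_reversing sm sp pC gv).
- by move=> v /memv_line2[x [y ->]]; rewrite !polarE (polarC b a sm) ma mb mab; ring.
- by move=> k /vlineP[t ->]; rewrite !polarE mm; ring.
by move=> k v /vlineP[t ->] /memv_line2[x [y ->]]; rewrite !polarE (polarC m a sp) pam pmb; ring.
Qed.

(** [Qp] depends on the point C, which is why case d) allows only one such vertex. *)
Lemma type_d_pair P A B L C w : is_pencil P -> is_point (center w) -> type_d P A B L ->
  point_on C L -> C <> A -> global_vertex C (A + B) w ->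
  exists Qm Qp, conic_pair P Qm Qp /\ reversing Qm Qp w.
Proof.
move=> isP pw td /andP[pC CL] CA gv; have [m m0 eC] := is_pointP pC.
have mL : m \in L by rewrite memvE -eC.
have [[pA _ _] _ _ _] := td.
have mA : m \notin A by apply/negP => mA; apply: CA; rewrite eC; apply/esym/is_point_vec.
have [a [b [fr [eA eB eL] onP ex cr]]] := type_d_frame isP td mL mA.
have [Qm [QmP Qm0 mab]] := pencil_polar_zero a b isP.1.
have [Qp [QpP Qp0 pmb]] := pencil_polar_zero m b isP.1.
have [mm sing _] := type_d_singular isP fr onP cr ex QmP Qm0 mab.
have rev := type_d_reversing isP fr eA eB eC onP pw gv QmP QpP mab mm pmb.
exists Qm, Qp; split=> //.
split=> //; apply/vlineP => -[k e]; case/eqP: Qp0.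
have [pa pam pb] := onP _ QpP.
by apply: (polar_frame (isP.2 _ QpP) fr) => //; rewrite e polarE ?mm ?mab mulr0.
Qed.

(** A is the singular point of the only singular conic, and L is the tangent there to a regular
    conic. *)
Lemma type_d_unique P A B L A' B' L' : is_pencil P -> type_d P A B L ->
  type_d P A' B' L' -> A = A' /\ L = L'.
Proof.
move=> isP td td'; have [dP sP] := isP.
have [[pA _ lL] _ _ [[S [SP S0] rS] _ tan _]] := td.
have [[pA' _ lL'] _ _ [_ _ tan' _]] := td'.
have [m mL mA] := line_point_other pA lL; have [m' mL' mA'] := line_point_other pA' lL'.
have [a [b [fr [eA eB eL] onP ex cr]]] := type_d_frame isP td mL mA.
have [a' [b' [fr' [eA' eB' eL'] onP' ex' cr']]] := type_d_frame isP td' mL' mA'.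
have [Q [QP Q0 Qab]] := pencil_polar_zero a b dP.
have [Q' [QP' Q0' Qab']] := pencil_polar_zero a' b' dP.
have [Qmm Qa Qs] := type_d_singular isP fr onP cr ex QP Q0 Qab.
have [_ Qa' _] := type_d_singular isP fr' onP' cr' ex' QP' Q0' Qab'.
have [a0 m0 b0] := frame_neq0 fr; have [a0' m0' b0'] := frame_neq0 fr'.
have /vlineP[k ek] : Q' \in <[Q]>%VS by apply: Qs => //; exists a'.
have k0 : k != 0 by apply: contraNneq Q0' => k0; rewrite ek k0 scale0r.
have Qa2 v : polar_form Q a' v = 0.
  by have := Qa' v; rewrite ek polarE => /eqP; rewrite mulf_eq0 (negPf k0) => /eqP.
have Qmb : polar_form Q m b != 0.
  apply: contra Q0 => /eqP e; have [aa am bb] := onP _ QP.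
  by apply/eqP/(polar_frame (sP _ QP) fr).
have eAA : A = A'.
  have [x [y [z e]]] := fr.1 a'; have sQ := sP _ QP; have [aa am bb] := onP _ QP.
  have := Qa2 b; rewrite e !polarE Qab bb !mulr0 add0r addr0 => /eqP.
  rewrite mulf_eq0 (negPf Qmb) orbF => /eqP y0.
  have := Qa2 m; rewrite e !polarE am Qmm (polarC b m sQ) !mulr0 !add0r => /eqP.
  rewrite mulf_eq0 (negPf Qmb) orbF => /eqP z0.
  have ea' : a' = x *: a by rewrite e y0 z0; vring.
  rewrite eA eA' ea' vline_scale //.
  by apply: contraNneq a0' => x0; rewrite ea' x0 scale0r.
split=> //; have [_ _ t] := tan _ (conj SP S0) rS; have [_ _ t'] := tan' _ (conj SP S0) rS.
have aA : a \in A by rewrite eA memv_line.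
have mL2 : m' \in L.
  have [x [y [z e]]] := fr.1 m'.
  have Sm' : polar_form S a m' = 0 by apply: t'; rewrite ?eL' ?mem_line2r // -eAA.
  have Sab : polar_form S a b != 0.
    apply: contra a0 => /eqP e'; apply/eqP/(regular_polar rS).
    by have [aa am bb] := onP _ SP; apply: (polar_frame_ker fr).
  move: Sm'; rewrite e !polarE; have [-> -> _] := onP _ SP.
  rewrite !mulr0 !add0r => /eqP; rewrite mulf_eq0 (negPf Sab) orbF => /eqP ->.
  by rewrite scale0r addr0 eL; apply/memv_line2; exists x, y.
rewrite eL'; apply: is_line_vec => //.
- by rewrite memvE -eA' -eAA eA -memvE eL mem_line2l.
- by rewrite -eA'.
Qed.

(** In cases b) to e) some conic [Q] of the pencil is singular at the center; the vertex fixes it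
    together with [S]. *)
Lemma skew_quasi_data P w : is_pencil P -> skew_quasi_global_vertex P w ->
  exists A S Q, [/\ quasi_global_vertex A S w, S \in P /\ Q \in P, Q != 0,
    forall k v, k \in A -> polar_form Q k v = 0 & base_singular P].
Proof.
move=> isP; have [dP sP] := isP.
have done a A S Q : A = <[a]>%VS -> a != 0 -> quasi_global_vertex A S w -> S \in P ->
  Q \in P -> Q != 0 -> (forall v, polar_form Q a v = 0) ->
  (forall T, T \in P -> polar_form T a a = 0) ->
  exists A S Q, [/\ quasi_global_vertex A S w, S \in P /\ Q \in P, Q != 0,
    forall k v, k \in A -> polar_form Q k v = 0 & base_singular P].
  move=> eA a0 qg SP QP Q0 Qa base; exists A, S, Q; split=> //.
    by rewrite eA => k v /vlineP[t ->]; rewrite polarE Qa mulr0.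
  by exists a; split=> //; exists Q.
case.
- move=> A B C L S tb [SP _] qg; have [a [b [c [fr [eA eB eC eL] onP]]]] := type_b_frame sP tb.
  have [Qm [Qp [[[QmP QpP Qm0 Qpm] _ _ _] mab sing]]] := type_b_conics isP fr onP.
  have Qp0 : Qp != 0 by apply: contraNneq Qpm => ->; rewrite mem0v.
  have [_ _ c0] := frame_neq0 fr.
  by apply: (done _ _ _ _ eC c0 qg SP QpP Qp0 sing) => T /onP[].
- move=> A C LA LC S tc [SP _] qg.
  have [a [c [m [fr [eA eC eLA eLC] onP]]]] := type_c_frame sP tc.
  have [Qm [Qp [[[QmP QpP Qm0 Qpm] _ _ _] _ _ sing _]]] := type_c_conics isP fr onP.
  have Qp0 : Qp != 0 by apply: contraNneq Qpm => ->; rewrite mem0v.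
  have [a0 _ _] := frame_neq0 fr.
  by apply: (done _ _ _ _ eA a0 qg SP QpP Qp0 sing) => T /onP[].
- move=> A B L S td [SP _] qg; have [[pA _ lL] _ _ _] := td.
  have [m mL mA] := line_point_other pA lL.
  have [a [b [fr [eA eB eL] onP ex cr]]] := type_d_frame isP td mL mA.
  have [Q [QP Q0 Qab]] := pencil_polar_zero a b dP.
  have [_ sing _] := type_d_singular isP fr onP cr ex QP Q0 Qab.
  have [a0 _ _] := frame_neq0 fr.
  by apply: (done _ _ _ _ eA a0 qg SP QP Q0 sing) => T /onP[].
move=> A L S te [SP _] qg; have [pA lL _] := te.
have [m mL mA] := line_point_other pA lL.
have [a [b [fr [eA eL] onP ex [cr e4]]]] := type_e_frame isP te mL mA.
have [Q [QP Q0 Qab]] := pencil_polar_zero a b dP.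
have [a0 _ _] := frame_neq0 fr.
have sing : forall v, polar_form Q a v = 0.
  by have [aa am] := onP _ QP; apply: (polar_frame_ker fr).
by apply: (done _ _ _ _ eA a0 qg SP QP Q0 sing) => T /onP[].
Qed.

(** The structure is given only through the existence of an involution, so one has to be built on
    the line through [a] and [u]: the linear reflection that fixes [a] and negates the second point
    [q] of [S]. *)
Lemma quasi_global_reflects A S w a u : quasi_global_vertex A S w -> A = <[a]>%VS ->
  polar_form S a u != 0 -> exists l y v, [/\ reflect_on w l <[u]>%VS y, v \in y & v != 0].
Proof.
move=> [_ [pA onA] [[sS _] rS] rE] eA Sau.
have a0 : a != 0 by move: pA; rewrite eA /is_point dim_vline; case: (a != 0).
have aa : polar_form S a a = 0 by apply: onA; rewrite eA memv_line.
have ua : u \notin <[a]>%VS by apply: contra Sau => /vlineP[k ->]; rewrite polarE aa mulr0.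
have u0 : u != 0 by apply: contraNneq ua => ->; rewrite mem0v.
(* The second intersection of the line through [a] and [u] with [S]. *)
pose q := polar_form S u u *: a - (polar_form S a u *+ 2) *: u.
have qq : polar_form S q q = 0 by rewrite /q !polarE (polarC u a sS) aa; ring.
have Saq : polar_form S a q = - polar_form S a u ^+ 2 *+ 2.
  by rewrite /q !polarE aa; ring.
have Saq0 : polar_form S a q != 0 by rewrite Saq mulrn_eq0 oppr_eq0 expf_eq0.
have q0 : q != 0 by apply: contraNneq Saq0 => ->; rewrite polar0r.
have qa : q \notin <[a]>%VS by apply: contra Saq0 => /vlineP[k ->]; rewrite polarE aa mulr0.
have c0 : polar_form S a u *+ 2 != 0 by rewrite mulrn_eq0.
have ql : q \in (<[a]> + <[u]>)%VS.
  by apply/memv_line2; exists (polar_form S u u), (- (polar_form S a u *+ 2)); rewrite scaleNr.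
clearbody q; have lE : (<[a]> + <[u]> = <[a]> + <[q]>)%VS.
  by apply: is_line_vec; rewrite ?mem_line2l // /is_line dim_add2.
pose M : 'M[F]_3 := 1%:M - (2 / polar_form S a q) *: ((S *m a^T) *m q).
pose f : 'End(vec) := linfun (mulmxr M).
have fE v : f v = v - (2 / polar_form S a q * polar_form S v a) *: q.
  rewrite lfunE /= /M mulmxBr mulmx1 -scalemxAr mulmxA -scalerA; congr (_ - _ *: _).
  by rewrite mulmxA [X in X *m q]mx11_scalar mul_scalar_mx.
have fa : f a = a by rewrite fE aa mulr0 scale0r subr0.
have fq : f q = - q.
  rewrite fE (polarC q a sS) divfK //; vring.
have ff n : n \in (<[a]> + <[q]>)%VS -> f (f n) = n.
  have fl x y : f (x *: a + y *: q) = x *: a + (- y) *: q.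
    by rewrite linearD !linearZ /= fa fq; vring.
  by move=> /memv_line2[x [y ->]]; rewrite !fl opprK.
have inv : proj_involution (<[a]> + <[q]>)%VS f.
  split.
  - rewrite limgD !limg_line fa fq -scaleN1r vline_scale // oppr_eq0 oner_eq0 //.
  - move=> p /andP[/is_pointP[n n0 ->]]; rewrite -memvE => nl.
    by rewrite !limg_line ff.
  have aq0 : a + q != 0.
    apply: contra qa; rewrite addr_eq0 => /eqP e; apply/vlineP; exists (-1).
    by rewrite e scaleN1r opprK.
  exists <[a + q]>%VS.
    rewrite /point_on is_point_vline // -memvE; apply/memv_line2; exists 1, 1.
    by rewrite !scale1r.
  rewrite limg_line linearD /= fa fq => /vline_eq[k e].
  have e2 : (1 + k) *: q = (1 - k) *: a.
    transitivity (a - (a - q) + k *: q); first by vring.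
    by rewrite e; vring.
  have [k1|k1] := eqVneq (1 + k) 0; last first.
    by case/negP: qa; apply/vlineP; exists ((1 + k)^-1 * (1 - k)); rewrite -scalerA -e2 scalerK.
  move: e2; rewrite k1 scale0r => /esym/eqP; rewrite scaler_eq0 (negPf a0) orbF subr_eq0 => /eqP kk.
  by move: k1; rewrite -kk => /eqP; rewrite -mulr2n pnatr_eq0.
exists (<[a]> + <[q]>)%VS, (f @: <[u]>)%VS, (f u); split.
- apply/rE; split.
  + by rewrite /is_line dim_add2.
  + by rewrite eA addvSl.
  + move=> [_ _ t]; case/eqP: Saq0; apply: t; last exact: mem_line2r.
    by rewrite eA memv_line.
  exists f; split=> //.
  + by rewrite eA limg_line fa.
  + exists <[q]>%VS; split.
    * by rewrite /point_on is_point_vline // addvSr.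
    * by rewrite eA => e; case/negP: qa; rewrite -e memv_line.
    * by move=> _ /vlineP[k ->]; rewrite !polarE qq !mulr0.
    by rewrite limg_line fq -scaleN1r vline_scale // oppr_eq0 oner_eq0.
  split=> //; rewrite /point_on is_point_vline //= -lE; exact: addvSr.
- by rewrite memv_img ?memv_line.
apply: contraNneq u0 => e; have := ff u; rewrite -lE mem_line2r e linear0.
by move=> /(_ isT) <-.
Qed.

(** An exceptional pair names a conic of its own, which has to be the given one. In S' = x S + y T
    the vertex changes the signs of S and of S' relative to T, and a pair with T(u, u) != 0 forces y
    = 0. *)
Lemma quasi_global_unique P A S S' w T : is_pencil P -> quasi_global_vertex A S w ->
  quasi_global_vertex A S' w -> S \in P -> S' \in P -> T \in P -> T != 0 ->
  (forall k v, k \in A -> polar_form T k v = 0) -> S' \in <[S]>%VS.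
Proof.
move=> [dP sP] qg qg' SP SP' TP T0 sing.
have [_ [pA onA] [[sS S0] rS] _] := qg; have [a a0 eA] := is_pointP pA.
have aA : a \in A by rewrite eA memv_line.
have TS : T \notin <[S]>%VS.
  apply/vlineP => -[k e]; have k0 : k != 0 by apply: contraNneq T0 => k0; rewrite e k0 scale0r.
  case/eqP: a0; apply: (regular_polar rS) => v; have := sing a v aA.
  by rewrite e polarE => /eqP; rewrite mulf_eq0 (negPf k0) => /eqP.
have [x [y eS']] := pencil_span dP SP TP S0 TS SP'.
(* A generic point of a line satisfies both conditions; the second one makes the structure defined
   at [u]. *)
have [u Tu Su] : exists2 u, polar_form T u u != 0 & polar_form S a u != 0.
  have [u0 Tu0] := polar_diag_neq0 (sP _ TP) T0.
  have [u1 Su1] : exists u, polar_form S a u != 0.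
    apply: contrapT => np; case/eqP: a0; apply: (regular_polar rS) => u.
    by apply: contrapT => /eqP nu; apply: np; exists u.
  pose p : {poly F} := (polar_form T u0 u0)%:P + (polar_form T u0 u1 *+ 2) *: 'X
     + polar_form T u1 u1 *: 'X^2.
  pose q : {poly F} := (polar_form S a u0)%:P + polar_form S a u1 *: 'X.
  have p0 : p != 0.
    apply: contraNneq Tu0 => e; have := congr1 (horner^~ 0) e.
    by rewrite /= /p !horner_simp mulr0 expr0n /= mulr0 !addr0 => ->.
  have q0 : q != 0.
    apply: contraNneq Su1 => e; have := congr1 (fun r : {poly F} => r`_1) e.
    by rewrite /= coefD coefC coefZ coefX /= mulr1 add0r coef0 => ->.
  have [s] := poly_neq0_value (mulf_neq0 p0 q0).
  rewrite hornerM mulf_eq0 negb_or => /andP[ps qs]; exists (u0 + s *: u1).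
    apply: contra ps => /eqP e; apply/eqP; rewrite -e !polarE (polarC u1 u0 (sP _ TP)).
    by rewrite /p !horner_simp; ring.
  apply: contra qs => /eqP e; apply/eqP; rewrite -e !polarE /q !horner_simp; ring.
have [l [z [v [rf vz v0]]]] := quasi_global_reflects qg eA Su.
have u0 : u != 0 by apply: contraNneq Su => ->; rewrite polar0r.
have [k k0 [e1 e2]] := quasi_global_reversing qg (sP _ TP) sing rf (memv_line u) vz u0 v0.
have [k' _ [e3 e4]] := quasi_global_reversing qg' (sP _ TP) sing rf (memv_line u) vz u0 v0.
have kk : k' = k by apply: (mulIf Tu); rewrite -e4 e2.
move: e3; rewrite kk eS' !polarE e1 e2 => e3.
have /mulr2n_inj0/eqP : k * (y * polar_form T u u) *+ 2 = 0.
  transitivity (x * (- k * polar_form S u u) + y * (k * polar_form T u u)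
    - (- k * (x * polar_form S u u + y * polar_form T u u))); first by ring.
  by rewrite e3 subrr.
rewrite !mulf_eq0 (negPf k0) (negPf Tu) orbF /= => /eqP ->.
by rewrite scale0r addr0 memvZ ?memv_line.
Qed.

(** Next to a quasi-global vertex only its exceptional partner is possible, and both fix the conic
    [S] and the one singular at the center. Otherwise all skew vertices are global, and the
    alternative that holds for one of them holds for all. *)
Theorem skew_common P (W : vertex F -> Prop) : is_pencil P ->
  (forall w, W w -> is_point (center w)) -> quasi_global_condition P W ->
  case_d_condition P W -> has_skew_vertex P W -> ~ has_neighbor_skew_vertices P W ->
  exists Qm Qp, conic_pair P Qm Qp /\
    forall w, W w -> skew_vertex P w -> reversing Qm Qp w.
Proof.
move=> isP pW qc dc [w0 W0 sk0] nn; have [dP sP] := isP.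
have [[w1 W1 q1]|nq] := pselect (exists2 w, W w & skew_quasi_global_vertex P w).
  have [A [S [T [qg [SP TP] T0 sing _]]]] := skew_quasi_data isP q1.
  have [ctr [pA onA] [[sS S0] rS] _] := qg; have [a a0 eA] := is_pointP pA.
  have TS : T \notin <[S]>%VS.
    apply/vlineP => -[k e]; have k0 : k != 0 by apply: contraNneq T0 => k0; rewrite e k0 scale0r.
    case/eqP: a0; apply: (regular_polar rS) => v; have := sing a v.
    rewrite eA memv_line => /(_ isT).
    by rewrite e polarE => /eqP; rewrite mulf_eq0 (negPf k0) => /eqP.
  exists S, T; split=> // w Ww skw.
  have [->|] := qc _ _ W1 Ww q1 skw; first exact: quasi_global_reversing qg (sP _ TP) sing.
  case=> [A' C LA LC S' tc [SP' _] qA qC|A' B L S' T' C td [SP' S0'] qA tanB eC gC].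
    have eAA : A' = A by case: qA => <- _ _ _.
    rewrite eAA in qA tc.
    have SS' := quasi_global_unique isP qA qg SP' SP TP T0 sing.
    have [a' [c [m [fr [eA' eC' eLA eLC] onP]]]] := type_c_frame sP tc.
    have singC k v : k \in C -> polar_form T k v = 0.
      rewrite eC' => /vlineP[t ->]; rewrite polarE; have [aa cc am cm] := onP _ TP.
      rewrite (polar_frame_ker (S := T) (n := c) fr) ?mulr0 //.
      by rewrite (polarC c a' (sP _ TP)) sing // eA' memv_line.
    have r := quasi_global_reversing qC (sP _ TP) singC.
    by apply: reversing_line SS' (memv_line T) r.
  have eAA : A' = A by case: qA => <- _ _ _.
  rewrite eAA in qA td gC.
  have SS' := quasi_global_unique isP qA qg SP' SP TP T0 sing.
  have [_ _ [_ rS'] _] := qA.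
  have pC : is_point C by rewrite -(gC.1) pW.
  have [m m0 eCm] := is_pointP pC.
  have [mL mT] : m \in L /\ m \in T' by apply/andP; rewrite -memv_cap -eC eCm memv_line.
  have [[_ pB lL] _ _ mc] := td.
  have Sbm b : B = <[b]>%VS -> polar_form S' b m = 0.
    by move=> eB; have [_ _ t] := tanB; apply: t => //; rewrite eB memv_line.
  (* If C were A, the tangent at B would pass through A, and [a'] would be in the kernel of a
     regular conic. *)
  have mA : m \notin A.
    apply/negP => mA; have [m1 m1L m1A] := line_point_other pA lL.
    have [a' [b [fr [eA' eB eL] onP ex cr]]] := type_d_frame isP td m1L m1A.
    have [aa am bb] := onP _ SP'.
    have [n0 _ _] := frame_neq0 fr; case/eqP: n0; apply: (regular_polar rS').
    apply: (polar_frame_ker fr) => //; rewrite (polarC a' b (sP _ SP')).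
    have [t et] : exists t, a' = t *: m.
      by apply: vline_eq; rewrite -eA'; apply: is_point_vec.
    by rewrite et polarE Sbm // mulr0.
  have [a' [b [fr [eA' eB eL] onP ex cr]]] := type_d_frame isP td mL mA.
  have Tab : polar_form T a' b = 0 by rewrite sing // eA' memv_line.
  have [Tmm _ _] := type_d_singular isP fr onP cr ex TP T0 Tab.
  have r : reversing T S' w.
    apply: (type_d_reversing isP fr eA' eB eCm onP (pW _ Ww) gC) => //.
    by rewrite (polarC m b (sP _ SP')) Sbm.
  by apply: reversingC; apply: reversing_line (memv_line T) SS' r.
have glob w : W w -> skew_vertex P w -> skew_global_vertex P w.
  by move=> Ww [//|q]; case: nq; exists w.
have := skew_global_cases isP (pW _ W0) (glob _ W0 sk0).
case=> [[E [L [X [Y K0]]]]|[bs [Qm [Qp [ts r0]]]]|[A [B [L [C [td pC CA gC]]]]]].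
- have [Qm [Qp [cp rev]]] := type_a_common isP pW nn W0 K0.
  exists Qm, Qp; split=> // w Ww skw.
  have [a [b [c [fr _ onP]]]] := type_a_frame sP K0.1.
  have := skew_global_cases isP (pW _ Ww) (glob _ Ww skw).
  case=> [[E' [L' [X' [Y' K']]]]|[bs _]|[A [B [L' [C [td _ _ _]]]]]].
  + exact: rev Ww K'.
  + by case: (type_a_not_base_singular isP fr onP bs).
  case: (type_a_not_base_singular isP fr onP).
  have [[pA _ lL] _ _ _] := td; have [m mL mA] := line_point_other pA lL.
  have [a' [b' [fr' _ onP' ex cr]]] := type_d_frame isP td mL mA.
  have [Q [QP Q0 Qab]] := pencil_polar_zero a' b' dP.
  have [_ sing _] := type_d_singular isP fr' onP' cr ex QP Q0 Qab.
  exists a'; split; first by have [] := frame_neq0 fr'.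
  by exists Q; split=> // T /onP'[].
- exists Qm, Qp; split; first by case: ts.
  move=> w Ww skw; have := skew_global_cases isP (pW _ Ww) (glob _ Ww skw).
  case=> [[E [L [X [Y [ta _]]]]]|[_ [Qm' [Qp' [ts' r']]]]|[A [B [L' [C [td _ _ _]]]]]].
  + have [a [b [c [fr _ onP]]]] := type_a_frame sP ta.
    by case: (type_a_not_base_singular isP fr onP bs).
  + have [[mP pP m0 pm] ms ps sg] := ts; have [[mP' pP' m0' pm'] ms' ps' sg'] := ts'.
    have p0 : Qp != 0 by apply: contraNneq pm => ->; rewrite mem0v.
    have p0' : Qp' != 0 by apply: contraNneq pm' => ->; rewrite mem0v.
    (* Both pairs consist of the two singular conics, so they agree up to order; two independent
       conics cannot match the same one. *)
    have [im|im] := sg' _ mP m0 ms; have [ip|ip] := sg' _ pP p0 ps.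
    * case/negP: pm; move: im ip => /vlineP[k ek] /vlineP[k' ->].
      apply/vlineP; exists (k' / k); rewrite ek scalerA divfK //.
      by apply: contraNneq m0 => k0; rewrite ek k0 scale0r.
    * exact: reversing_line im ip r'.
    * exact: reversing_line im ip (reversingC r').
    case/negP: pm; move: im ip => /vlineP[k ek] /vlineP[k' ->].
    apply/vlineP; exists (k' / k); rewrite ek scalerA divfK //.
    by apply: contraNneq m0 => k0; rewrite ek k0 scale0r.
  by case: (type_d_two_singular isP td ts).
have [Qm [Qp [cp r0]]] := type_d_pair isP (pW _ W0) td pC CA gC.
exists Qm, Qp; split=> // w Ww skw.
have := skew_global_cases isP (pW _ Ww) (glob _ Ww skw).
case=> [[E [L' [X [Y [ta _]]]]]|[_ [Qm' [Qp' [ts' _]]]]|[A' [B' [L' [C' [td' pC' CA' gC']]]]]].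
- have [a [b [c [fr _ onP]]]] := type_a_frame sP ta.
  case: (type_a_not_base_singular isP fr onP).
  have [[pA _ lL] _ _ _] := td; have [m mL mA] := line_point_other pA lL.
  have [a' [b' [fr' _ onP' ex cr]]] := type_d_frame isP td mL mA.
  have [Q [QP Q0 Qab]] := pencil_polar_zero a' b' dP.
  have [_ sing _] := type_d_singular isP fr' onP' cr ex QP Q0 Qab.
  exists a'; split; first by have [] := frame_neq0 fr'.
  by exists Q; split=> // T /onP'[].
- by case: (type_d_two_singular isP td ts').
have [eA eL] := type_d_unique isP td td'.
have [/andP[pC0 CL] /andP[pC0' CL']] := (pC, pC').
suff -> : w = w0 by [].
apply: (dc A B L td) => //; rewrite ?gC.1 ?gC'.1 //; first by rewrite eL.
by rewrite eA.
Qed.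

End SkewPairs.

(** * Coprimality of functions of two conics *)

Section Coprimality.
Local Open Scope ring_scope.
Variable F : numFieldType.
Local Notation vec := 'rV[F]_3.
Implicit Types (u v w e : vec) (S : 'M[F]_3) (G N D p : {mpoly F[3]}).

(** Kronecker substitution ['X_i := 'X^(m^i)]. *)
Lemma at_vec_eq0 G : (forall u, at_vec G u = 0) -> G = 0.
Proof.
move=> G0; pose m := msize G.
pose g : {poly F} := mmap polyC (fun i : 'I_3 => 'X^(m ^ i)) G.
have g0 : g = 0.
  apply: poly_eq0_all => t; rewrite rootE -[g.[t]]/(horner_eval t g) /g rmorph_mmap.
  apply/eqP; rewrite -(G0 (\row_i t ^+ (m ^ i))) /at_vec /meval; apply: eq_mmap => i /=.
    by rewrite /horner_eval hornerC.
  by rewrite /horner_eval hornerXn mxE.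
pose ex (k : 'X_{1..3}) := (\sum_(i < 3) m ^ i * k i)%N.
have gE : g = \sum_(k <- msupp G) G@_k *: 'X^(ex k).
  apply: eq_bigr => k _; rewrite mul_polyC /mmap1; congr (_ *: _).
  rewrite /ex -prodrXr; apply: eq_bigr => i _; by rewrite exprM.
have bnd k i : k \in msupp G -> (k i < m)%N.
  move=> kG; apply: leq_ltn_trans (msize_mdeg_lt kG); rewrite mdegE (bigD1 i) //=.
  exact: leq_addr.
have inj k k' : k \in msupp G -> k' \in msupp G -> ex k = ex k' -> k = k'.
  move=> kG kG'; rewrite /ex !big_ord_recl !big_ord0 !addn0 /= !expn0 !mul1n /bump /=.
  rewrite !add1n expn1 => e.
  pose i0 : 'I_3 := ord0; pose i1 : 'I_3 := lift ord0 ord0; pose i2 : 'I_3 := lift ord0 (lift ord0 ord0).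
  move: e; rewrite -/i0 -/i1 -/i2.
  have b0 := bnd k i0 kG; have b1 := bnd k i1 kG.
  have b0' := bnd k' i0 kG'; have b1' := bnd k' i1 kG'.
  have m0 : (0 < m)%N by apply: leq_ltn_trans b0.
  have st q r q' r' : (r < m -> r' < m -> r + m * q = r' + m * q' -> r = r' /\ q = q')%N.
    move=> rm rm' e; have er : r = r'.
      transitivity ((r + m * q) %% m)%N.
        by rewrite addnC mulnC modnMDl modn_small.
      by rewrite e addnC mulnC modnMDl modn_small.
    split=> //; move: e; rewrite er => /addnI/eqP; rewrite eqn_pmul2l // => /eqP.
    by [].
  have -> : (m ^ 2 * k i2 = m * (m * k i2))%N by rewrite expnS expn1 mulnA.
  have -> : (m ^ 2 * k' i2 = m * (m * k' i2))%N by rewrite expnS expn1 mulnA.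
  rewrite -!mulnDr => /(st _ _ _ _ b0 b0')[e0 /(st _ _ _ _ b1 b1')[e1 e2]].
  apply/mnmP => i; case: i => [[|[|[|//]]] h].
  - by rewrite (_ : Ordinal h = i0) //; apply: val_inj.
  - by rewrite (_ : Ordinal h = i1) //; apply: val_inj.
  - by rewrite (_ : Ordinal h = i2) //; apply: val_inj.
apply/mpolyP => k; rewrite mcoeff0; have [kG|] := boolP (k \in msupp G); last first.
  by rewrite mcoeff_msupp negbK => /eqP.
have := congr1 (fun q : {poly F} => q`_(ex k)) g0; rewrite /= gE coef0 coef_sum => <-.
rewrite (bigD1_seq k) //= coefZ coefXn eqxx mulr1 big1_seq ?addr0 //.
move=> k' /andP[nk kG']; rewrite coefZ coefXn; case: eqP => [e|_]; last by rewrite mulr0.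
by case/eqP: nk; apply: inj.
Qed.

Definition linear_poly S e : {mpoly F[3]} := \sum_i (S *m e^T) i 0 *: 'X_i.

Lemma at_linear_poly S e u : at_vec (linear_poly S e) u = polar_form S u e.
Proof.
rewrite /at_vec raddf_sum /polar_form -mulmxA mxE; apply: eq_bigr => i _.
by rewrite /= mevalZ mevalXU mulrC.
Qed.

Lemma at_vecZl c G u : at_vec (c *: G) u = c * at_vec G u.
Proof. exact: mevalZ. Qed.

Lemma generic_vec G z u : at_vec G z != 0 -> line_poly u (z - u) G != 0.
Proof.
apply: contraNneq => e; have := horner_line_poly u (z - u) G 1.
by rewrite e horner0 scale1r addrC subrK => <-.
Qed.

Section PencilCoprime.
Variables (S0 S2 : 'M[F]_3) (p0 : {vspace vec}).
Hypothesis (sS0 : S0^T = S0) (rS0 : regular S0) (sS2 : S2^T = S2).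
Hypothesis S2n : S2 \notin <[S0]>%VS.
Hypothesis (pp0 : is_point p0) (on0 : on_conic S0 p0).

Let slope u e := line_poly u e (conic_poly S0).

Lemma line_conic_poly S u e : S^T = S -> line_poly u e (conic_poly S) =
  (polar_form S u u)%:P + (polar_form S u e *+ 2) *: 'X + polar_form S e e *: 'X^2.
Proof.
move=> sS; apply/eqP; rewrite -subr_eq0; apply/eqP/poly_eq0_all => s.
rewrite rootE !horner_simp horner_line_poly at_conic_poly !polarE (polarC e u sS).
by apply/eqP; ring.
Qed.

(** A direction [e] on S0 makes the restriction of S0 linear; coprimality then only means that S2
    does not vanish at its root, which is proportional to [w]. *)
Lemma coprime_on_line u e : polar_form S0 e e = 0 -> polar_form S0 u e != 0 ->
  let w := (polar_form S0 u e *+ 2) *: u - polar_form S0 u u *: e in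
  polar_form S2 w w != 0 ->
  coprimep (line_poly u e (conic_poly S0)) (line_poly u e (conic_poly S2)).
Proof.
move=> ee ue w w0; pose a := polar_form S0 u e *+ 2.
have a0 : a != 0 by rewrite mulrn_eq0.
pose r := - polar_form S0 u u / a.
have -> : line_poly u e (conic_poly S0) = a *: ('X - r%:P).
  rewrite line_conic_poly // ee scale0r addr0 scalerBr -/a addrC; congr (_ + _).
  by rewrite -mul_polyC -polyCM -polyCN /r; congr _%:P; field.
rewrite coprimepZl // coprimep_sym coprimep_XsubC rootE horner_line_poly at_conic_poly.
apply: contra w0 => /eqP e0.
have -> : w = a *: (u + r *: e).
  by rewrite /w -/a; apply/rowP => i; rewrite /r !mxE; field.
by rewrite polarZl polarZr e0 !mulr0.
Qed.

(** Factorization of ternary forms is avoided: by coprimality on lines a common factor [p] is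
    constant on almost every line whose direction is a point of S0, hence on all of them, and three
    such directions span the space. *)
Lemma pencil_coprime N D :
  (forall u e, coprimep (line_poly u e (conic_poly S0)) (line_poly u e (conic_poly S2)) ->
     coprimep (line_poly u e N) (line_poly u e D)) ->
  forall p q r : {mpoly F[3]}, N = p * q -> D = p * r -> p \is a GRing.unit.
Proof.
move=> cop p q r eN eD.
have [e0 [e1 [e2 [mu [fr ep mu0 S0E]]]]] := conic_frame sS0 rS0 pp0 on0.
pose phi t : vec := e0 + t *: e1 + t ^+ 2 *: e2.
have S0phi t : polar_form S0 (phi t) (phi t) = 0.
  by rewrite /phi -[e0]scale1r S0E; ring.
have S0phi2 t t' : polar_form S0 (phi t) (phi t') *+ 2 = - mu * (t - t') ^+ 2.
  have := polarization (phi t) (phi t') sS0; rewrite !S0phi !add0r => <-.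
  rewrite (_ : phi t + phi t' = 2 *: e0 + (t + t') *: e1 + (t ^+ 2 + t' ^+ 2) *: e2).
    by rewrite S0E; ring.
  by rewrite /phi; vring.
pose c2 := on_parabola (in_chart e0 e1 e2 (conic_poly S2)).
have c20 : c2 != 0 by apply: (chart_S2_neq0 fr mu0 sS0 sS2 S0E S2n).
have c2E t : c2.[t] = polar_form S2 (phi t) (phi t).
  by rewrite horner_subst2 !horner_simp value_in_chart at_conic_poly.
have shift t' : forall u s, at_vec p (u + s *: phi t') = at_vec p u.
  pose L := linear_poly S0 (phi t'); pose L2 := linear_poly S2 (phi t').
  (* The polynomial whose nonvanishing at [u] gives coprimality on the line through [u] in the
     direction [phi t']. *)
  pose G := L * (4 *: (L ^+ 2 * conic_poly S2) - 4 *: (L * conic_poly S0 * L2)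
       + polar_form S2 (phi t') (phi t') *: conic_poly S0 ^+ 2).
  have GE u : at_vec G u = polar_form S0 u (phi t') *
      let w := (polar_form S0 u (phi t') *+ 2) *: u - polar_form S0 u u *: phi t' in
      polar_form S2 w w.
    rewrite /G at_vecM at_vecD at_vecB !at_vecZl !at_vecM ?at_vecX.
    rewrite !at_linear_poly !at_conic_poly; move: (phi t') => e.
    by rewrite !polarE (polarC e u sS2); congr (_ * _); ring.
  have [z Gz] : exists z, at_vec G z != 0.
    have [t] := poly_neq0_value (mulf_neq0 c20 (monic_neq0 (monicXsubC t'))).
    rewrite hornerM mulf_eq0 negb_or c2E hornerXsubC => /andP[t2 tt'].
    have ne : polar_form S0 (phi t) (phi t') != 0.
      apply: contraNneq tt' => z0; have := S0phi2 t t'; rewrite z0 mul0rn => /esym/eqP.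
      by rewrite mulf_eq0 oppr_eq0 (negPf mu0) expf_eq0.
    exists (phi t); rewrite GE mulf_neq0 //= S0phi scale0r subr0 polarZl polarZr.
    by rewrite !mulf_neq0 // mulrn_eq0.
  have step u s : at_vec G u != 0 -> at_vec p (u + s *: phi t') = at_vec p u.
    rewrite GE mulf_eq0 negb_or => /andP[ue w0].
    have /cop := coprime_on_line (S0phi t') ue w0.
    have -> : line_poly u (phi t') N = line_poly u (phi t') p * line_poly u (phi t') q.
      by rewrite eN /line_poly rmorphM.
    have -> : line_poly u (phi t') D = line_poly u (phi t') p * line_poly u (phi t') r.
      by rewrite eD /line_poly rmorphM.
    rewrite coprimepMl => /andP[+ _]; rewrite coprimepMr => /andP[+ _].
    rewrite /coprimep gcdpp => /eqP sz.
    have /size_poly1P[c _ ec] : size (line_poly u (phi t') p) == 1%N by rewrite sz.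
    rewrite -horner_line_poly ec hornerC -(hornerC c 0) -ec horner_line_poly.
    by rewrite scale0r addr0.
  move=> u s; pose d := line_poly (u + s *: phi t') (z - u) p - line_poly u (z - u) p.
  have : d * line_poly u (z - u) G = 0.
    apply: poly_eq0_all => t; rewrite rootE hornerM /d hornerD hornerN !horner_line_poly.
    have [->|Gt] := eqVneq (at_vec G (u + t *: (z - u))) 0; first by rewrite mulr0.
    have -> : u + s *: phi t' + t *: (z - u) = u + t *: (z - u) + s *: phi t'.
      by rewrite addrAC.
    by rewrite step // subrr mul0r.
  move/eqP; rewrite mulf_eq0 (negPf (generic_vec u Gz)) orbF => /eqP d0.
  have := congr1 (horner^~ 0) d0; rewrite /= /d hornerD hornerN !horner_line_poly.
  by rewrite horner0 !scale0r !addr0 => /subr0_eq.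
have const u : at_vec p u = at_vec p 0.
  have [x [y [z eu]]] := fr.1 u.
  have -> : u = 0 + (x - z) *: phi 0 + ((y + z) / 2) *: phi 1 + ((z - y) / 2) *: phi (-1).
    by apply/rowP => i; rewrite eu /phi !mxE; field.
  by rewrite !shift.
have pE : p = (at_vec p 0)%:MP.
  apply/eqP; rewrite -subr_eq0; apply/eqP/at_vec_eq0 => u.
  by rewrite at_vecB const /at_vec mevalC subrr.
(* For [p = 0] both forms vanish, and zero polynomials are not coprime. *)
have p0n : at_vec p 0 != 0.
  apply: contraTneq (c20) => p00; move: eN eD; rewrite pE p00 mpolyC0 !mul0r => eN' eD'.
  exfalso; have [t1] := poly_neq0_value (mulf_neq0 c20 (monic_neq0 (monicXsubC 0))).
  rewrite hornerM mulf_eq0 negb_or c2E hornerXsubC subr0 => /andP[t2 t10].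
  have ne : polar_form S0 (phi t1) (phi 0) != 0.
    apply: contraNneq t10 => z0; have := S0phi2 t1 0; rewrite z0 mul0rn subr0 => /esym/eqP.
    by rewrite mulf_eq0 oppr_eq0 (negPf mu0) expf_eq0.
  have /= := coprime_on_line (S0phi 0) ne; rewrite S0phi scale0r subr0 polarZl polarZr.
  rewrite !mulf_neq0 // ?mulrn_eq0 // => /(_ isT)/cop.
  by rewrite eN' eD' /line_poly !rmorph0 /coprimep gcdp0 size_poly0.
apply/unitrP; exists (at_vec p 0)^-1%:MP; rewrite pE -!mpolyCM.
by rewrite /at_vec mevalC mulVf // divff.
Qed.

End PencilCoprime.
End Coprimality.

(** * Neighbor skew vertices *)

Section Triples.
Local Open Scope ring_scope.
Variable F : numFieldType.
Local Notation vec := 'rV[F]_3.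
Implicit Types (u v a b c m : vec) (S T Q r : 'M[F]_3) (P : {vspace 'M[F]_3}).
Implicit Types (A B C D E L X Y l : {vspace vec}) (w : vertex F).

(** The three line pairs through four points, scaled so that their sum is zero. *)
Definition triple P r1 r2 r3 := [/\ [/\ r1 \in P, r2 \in P & r3 = - r1 - r2],
  r1 != 0, r2 \notin <[r1]>%VS, [/\ singular r1, singular r2 & singular r3] &
  forall S, S \in P -> S != 0 -> singular S ->
    [\/ S \in <[r1]>%VS, S \in <[r2]>%VS | S \in <[r3]>%VS]].

(** In terms of the entries (S(a, b), S(b, c), S(a, c)), whose sum is zero on the pencil, the three
    conics are (0, 1, -1), (1, -1, 0) and (-1, 0, 1). *)
Lemma type_a_triple P a b c : is_pencil P -> frame a b c ->
  (forall S, S \in P -> [/\ polar_form S a a = 0, polar_form S b b = 0,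
      polar_form S c c = 0 & polar_form S a b + polar_form S b c + polar_form S a c = 0]) ->
  exists r1 r2 r3, [/\ triple P r1 r2 r3, polar_form r1 a b = 0,
    polar_form r2 a c = 0, polar_form (r2 - r3) (a - b) c = 0 & polar_form (r1 - r3) (a - c) b = 0].
Proof.
move=> isP fr onP; have [dP sP] := isP.
have zero := type_a_eq0 isP fr onP.
have [s1 [s1P s10 ab1]] := pencil_polar_zero a b dP.
have [s2 [s2P s20 ac2]] := pencil_polar_zero a c dP.
have [_ _ _ e1] := onP _ s1P; have [_ _ _ e2] := onP _ s2P.
have bc1 : polar_form s1 b c != 0 by apply: contra s10 => /eqP bc; apply/eqP/zero.
have ab2 : polar_form s2 a b != 0.
  apply: contra s20 => /eqP ab; apply/eqP/zero => //.
  by rewrite -[RHS]e2 ab ac2 add0r addr0.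
pose r1 := (polar_form s1 b c)^-1 *: s1; pose r2 := (polar_form s2 a b)^-1 *: s2.
have r1P : r1 \in P by rewrite memvZ.
have r2P : r2 \in P by rewrite memvZ.
have r1ab : polar_form r1 a b = 0 by rewrite polarE ab1 mulr0.
have r1bc : polar_form r1 b c = 1 by rewrite polarE mulVf.
have r1ac : polar_form r1 a c = -1.
  have [_ _ _] := onP _ r1P; rewrite r1ab r1bc add0r addrC => /eqP.
  by rewrite addr_eq0 => /eqP.
have r2ac : polar_form r2 a c = 0 by rewrite polarE ac2 mulr0.
have r2ab : polar_form r2 a b = 1 by rewrite polarE mulVf.
have r2bc : polar_form r2 b c = -1.
  have [_ _ _] := onP _ r2P; rewrite r2ab r2ac addr0 addrC => /eqP.
  by rewrite addr_eq0 => /eqP.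
clearbody r1 r2; pose r3 := - r1 - r2.
have r3P : r3 \in P by rewrite memvB // memvN.
have sing r x y z : r \in P -> x *: a + y *: b + z *: c != 0 ->
    y * polar_form r a b + z * polar_form r a c = 0 ->
    x * polar_form r a b + z * polar_form r b c = 0 ->
    x * polar_form r a c + y * polar_form r b c = 0 -> singular r.
  move=> rP n0 ea eb ec; exists (x *: a + y *: b + z *: c) => //.
  have [aa bb cc _] := onP _ rP; have sr := sP _ rP.
  apply: (polar_frame_ker fr); rewrite !polarE ?(polarC b a sr) ?(polarC c a sr) ?(polarC c b sr)
    ?aa ?bb ?cc ?mulr0 ?addr0 ?add0r //.
have nz x y z : [|| x != 0, y != 0 | z != 0] -> x *: a + y *: b + z *: c != 0.
  move=> xyz; apply/eqP => /fr.2[x0 y0 z0]; move: xyz.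
  by rewrite x0 y0 z0 eqxx.
exists r1, r2, r3; split=> //; last 2 first.
- by rewrite /r3 !polarE r1ac r1bc r2ac r2bc; ring.
- by rewrite /r3 !polarE !(polarC c b) ?sP // r1ab r1bc r2ab r2bc; ring.
split=> //.
- by apply/eqP => e; move: r1bc; rewrite e polar_zerom => /esym/eqP; rewrite oner_eq0.
- apply/vlineP => -[k e]; move: r2ab; rewrite e polarE r1ab mulr0 => /esym/eqP.
  by rewrite oner_eq0.
- split.
  + apply: (sing _ 1 1 0) => //; first by apply: nz; rewrite oner_eq0.
    * by rewrite r1ab; ring.
    * by rewrite r1ab; ring.
    * by rewrite r1ac r1bc; ring.
  + apply: (sing _ 1 0 1) => //; first by apply: nz; rewrite oner_eq0.
    * by rewrite r2ac; ring.
    * by rewrite r2ab r2bc; ring.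
    * by rewrite r2ac; ring.
  apply: (sing _ 0 1 1) => //; first by apply: nz; rewrite oner_eq0 orbT.
  + by rewrite /r3 !polarE r1ab r1ac r2ab r2ac; ring.
  + by rewrite /r3 !polarE r1bc r2bc; ring.
  + by rewrite /r3 !polarE r1bc r2bc; ring.
move=> S SP S0 [n n0 sn]; have [aa bb cc e] := onP _ SP; have sS := sP _ SP.
have [ab|ab] := eqVneq (polar_form S a b) 0.
  constructor 1; apply/vlineP; exists (polar_form S b c).
  apply/eqP; rewrite -subr_eq0; apply/eqP/zero; rewrite ?memvB ?memvZ // !polarE.
    by rewrite ab r1ab mulr0 subr0.
  by rewrite r1bc mulr1 subrr.
have [ac|ac] := eqVneq (polar_form S a c) 0.
  constructor 2; apply/vlineP; exists (polar_form S a b).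
  apply/eqP; rewrite -subr_eq0; apply/eqP/zero; rewrite ?memvB ?memvZ // !polarE.
    by rewrite r2ab mulr1 subrr.
  by rewrite r2bc mulrN mulr1 opprK -[RHS]e ac addr0 addrC.
have [bc|bc] := eqVneq (polar_form S b c) 0.
  constructor 3; apply/vlineP; exists (- polar_form S a b).
  apply/eqP; rewrite -subr_eq0; apply/eqP/zero; rewrite ?memvB ?memvZ // /r3 !polarE.
    by rewrite r2ab r1ab; ring.
  by rewrite bc r1bc r2bc; ring.
case/eqP: n0; have [x [y [z en]]] := fr.1 n.
have := sn a; have := sn b; have := sn c; rewrite en !polarE (polarC b a sS).
rewrite (polarC c a sS) (polarC c b sS) aa bb cc !mulr0 !addr0 !add0r => e3 e4 e5.
have z0 : z = 0.
  have : z * (polar_form S a c * polar_form S b c) *+ 2 = 0.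
    transitivity (polar_form S b c * (y * polar_form S a b + z * polar_form S a c)
      + polar_form S a c * (x * polar_form S a b + z * polar_form S b c)
      - polar_form S a b * (x * polar_form S a c + y * polar_form S b c)); first by ring.
    by rewrite e3 e4 e5; ring.
  by move=> /mulr2n_inj0/eqP; rewrite !mulf_eq0 (negPf ac) (negPf bc) !orbF => /eqP.
move: e4 e5; rewrite z0 !mul0r !addr0 => /eqP; rewrite mulf_eq0 (negPf ab) orbF => /eqP ->.
move=> /eqP; rewrite mulf_eq0 (negPf ab) orbF => /eqP ->.
by vring.
Qed.

Definition val2 r1 r2 r3 u := let x := polar_form r1 u u in let y := polar_form r2 u u in
  let z := polar_form r3 u u in x * y + y * z + x * z.
Definition val3 r1 r2 r3 u := let x := polar_form r1 u u in let y := polar_form r2 u u in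
  let z := polar_form r3 u u in x * y * z.

Lemma triple_scalars r r' (al be ga : F) : r != 0 -> r' \notin <[r]>%VS ->
  al *: r + be *: r' + ga *: (- r - r') = 0 -> al = ga /\ be = ga.
Proof.
move=> r0 rr' e; have e2 : (al - ga) *: r + (be - ga) *: r' = 0.
  by rewrite -[RHS]e; apply/matrixP => i j; rewrite !mxE; ring.
have bg : be - ga = 0.
  apply/eqP; apply: contraNT rr' => bg; apply/vlineP; exists (- (be - ga)^-1 * (al - ga)).
  rewrite -scalerA (_ : (al - ga) *: r = - ((be - ga) *: r')).
    by rewrite scalerN scaleNr opprK scalerK.
  by apply/eqP; rewrite -addr_eq0 e2.
move: e2; rewrite bg scale0r addr0 => /eqP; rewrite scaler_eq0 (negPf r0) orbF => /eqP.
by move=> /subr0_eq -> ; split=> //; apply: subr0_eq.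
Qed.

(** Both triples list the three singular conics of the pencil, so they agree up to order and
    scaling; as each sums to zero, the three factors coincide. Symmetric functions of the triple are
    thus independent of the labelling of the base points, up to powers of one factor. *)
Lemma triple_unique P r1 r2 r3 s1 s2 s3 : triple P r1 r2 r3 -> triple P s1 s2 s3 ->
  exists2 k, k != 0 & forall u, val2 s1 s2 s3 u = k ^+ 2 * val2 r1 r2 r3 u /\
                               val3 s1 s2 s3 u = k ^+ 3 * val3 r1 r2 r3 u.
Proof.
move=> [[r1P r2P er3] r10 r21 _ rE] [[s1P s2P es3] s10 s21 [ss1 ss2 ss3] _].
have indep (a b : 'M[F]_3) : a != 0 -> b \notin <[a]>%VS -> - a - b \notin <[a]>%VS /\
   - a - b \notin <[b]>%VS.
  move=> a0 ba; split; apply/vlineP => -[k e].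
    case/negP: ba; apply/vlineP; exists (- (1 + k)).
    rewrite -(opprK b) -(addKr (- a) (- b)) e opprK.
    by apply/matrixP => i j; rewrite !mxE; ring.
  have ea : a = (- (1 + k)) *: b.
    rewrite -(opprK a) -(addrK (- b) (- a)) e.
    by apply/matrixP => i j; rewrite !mxE; ring.
  have k0 : - (1 + k) != 0 by apply: contraNneq a0 => k0; rewrite ea k0 scale0r.
  case/negP: ba; apply/vlineP; exists (- (1 + k))^-1.
  by rewrite ea scalerK.
have nz (a b : 'M[F]_3) : b \notin <[a]>%VS -> b != 0.
  by apply: contraNneq => ->; rewrite mem0v.
have sym (a b : 'M[F]_3) : a != 0 -> b \notin <[a]>%VS -> a \notin <[b]>%VS.
  move=> a0; apply: contra => /vlineP[k e]; apply/vlineP; exists k^-1.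
  have k0 : k != 0 by apply: contraNneq a0 => k0; rewrite e k0 scale0r.
  by rewrite e scalerK.
have s20 := nz _ _ s21; have r20 := nz _ _ r21.
have [s31 s32] := indep _ _ s10 s21; rewrite -es3 in s31 s32; have s30 := nz _ _ s31.
have [r31 r32] := indep _ _ r10 r21; rewrite -er3 in r31 r32; have r30 := nz _ _ r31.
have r12 := sym _ _ r10 r21; have r13 := sym _ _ r10 r31; have r23 := sym _ _ r20 r32.
have s3P : s3 \in P by rewrite es3 memvB // memvN.
have sE s : s \in P -> s != 0 -> singular s ->
    [\/ exists k, s = k *: r1, exists k, s = k *: r2 | exists k, s = k *: r3].
  move=> sP s0 ss; have [/vlineP h|/vlineP h|/vlineP h] := rE _ sP s0 ss;
  by [constructor 1|constructor 2|constructor 3].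
have bad (a b r : 'M[F]_3) (k h : F) : a != 0 -> b \notin <[a]>%VS -> a = k *: r -> b = h *: r -> False.
  move=> a0 ba ea eb; case/negP: ba; apply/vlineP; exists (h / k).
  have k0 : k != 0 by apply: contraNneq a0 => k0; rewrite ea k0 scale0r.
  by rewrite ea eb scalerA divfK.
have rel (r r' r'' : 'M[F]_3) (al be ga : F) : r != 0 -> r' \notin <[r]>%VS -> r'' = - r - r' ->
   s1 = al *: r -> s2 = be *: r' -> s3 = ga *: r'' -> [/\ al != 0, s1 = al *: r, s2 = al *: r' & s3 = al *: r''].
  move=> r0 rr' er'' e1 e2 e3.
  have [ag bg] : al = ga /\ be = ga.
    apply: (triple_scalars r0 rr').
    by rewrite -er'' -e1 -e2 -e3 es3; apply/matrixP => i j; rewrite !mxE; ring.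
  rewrite e1 e2 e3 ag bg; split=> //; rewrite -ag.
  by apply: contraNneq s10 => z; rewrite e1 z scale0r.
have p123 : r3 = - r1 - r2 by [].
have p132 : r2 = - r1 - r3 by rewrite er3; apply/matrixP => i j; rewrite !mxE; ring.
have p213 : r3 = - r2 - r1 by rewrite er3; apply/matrixP => i j; rewrite !mxE; ring.
have p231 : r1 = - r2 - r3 by rewrite er3; apply/matrixP => i j; rewrite !mxE; ring.
have p312 : r2 = - r3 - r1 by rewrite er3; apply/matrixP => i j; rewrite !mxE; ring.
have p321 : r1 = - r3 - r2 by rewrite er3; apply/matrixP => i j; rewrite !mxE; ring.
have fin (r r' r'' : 'M[F]_3) (al be ga : F) : r != 0 -> r' \notin <[r]>%VS -> r'' = - r - r' ->
   s1 = al *: r -> s2 = be *: r' -> s3 = ga *: r'' ->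
   (forall u, val2 r r' r'' u = val2 r1 r2 r3 u) ->
   (forall u, val3 r r' r'' u = val3 r1 r2 r3 u) ->
   exists2 k, k != 0 & forall u, val2 s1 s2 s3 u = k ^+ 2 * val2 r1 r2 r3 u /\
                               val3 s1 s2 s3 u = k ^+ 3 * val3 r1 r2 r3 u.
  move=> r0 rr' er'' e1 e2 e3 v2 v3; have [al0 f1 f2 f3] := rel _ _ _ _ _ _ r0 rr' er'' e1 e2 e3.
  exists al => // u; rewrite -v2 -v3 f1 f2 f3 /val2 /val3 !polar_scalem.
  by split; ring.
have [[k1 e1]|[k1 e1]|[k1 e1]] := sE _ s1P s10 ss1;
  have [[k2 e2]|[k2 e2]|[k2 e2]] := sE _ s2P s20 ss2;
  try (by case: (bad _ _ _ _ _ s10 s21 e1 e2));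
  have [[k3 e3]|[k3 e3]|[k3 e3]] := sE _ s3P s30 ss3;
  try (by case: (bad _ _ _ _ _ s10 s31 e1 e3)); try (by case: (bad _ _ _ _ _ s20 s32 e2 e3)).
- by apply: (fin _ _ _ _ _ _ r10 r21 p123 e1 e2 e3).
- by apply: (fin _ _ _ _ _ _ r10 r31 p132 e1 e2 e3) => u; rewrite /val2 /val3 /=; ring.
- by apply: (fin _ _ _ _ _ _ r20 r12 p213 e1 e2 e3) => u; rewrite /val2 /val3 /=; ring.
- by apply: (fin _ _ _ _ _ _ r20 r32 p231 e1 e2 e3) => u; rewrite /val2 /val3 /=; ring.
- by apply: (fin _ _ _ _ _ _ r30 r13 p312 e1 e2 e3) => u; rewrite /val2 /val3 /=; ring.
- by apply: (fin _ _ _ _ _ _ r30 r23 p321 e1 e2 e3) => u; rewrite /val2 /val3 /=; ring.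
Qed.

(** The action on the three line pairs as the transposition of [r2] and [r3], up to the common
    factor [- k]. *)
Definition transposes r1 r2 r3 w := forall l x y u v, reflect_on w l x y ->
  u \in x -> v \in y -> u != 0 -> v != 0 ->
  exists2 k, k != 0 & [/\ polar_form r1 v v = - k * polar_form r1 u u,
    polar_form r2 v v = - k * polar_form r3 u u & polar_form r3 v v = - k * polar_form r2 u u].

(** The sum [r2 + r3 = - r1] and the difference [r2 - r3] are multiplied by opposite factors. *)
Lemma reversing_transposes r1 r2 r3 w : r3 = - r1 - r2 -> reversing r1 (r2 - r3) w ->
  transposes r1 r2 r3 w.
Proof.
move=> er3 rev l x y u v rf ux vy u0 v0; have [k k0 [e1 e2]] := rev _ _ _ _ _ rf ux vy u0 v0.
exists k => //; move: e2; rewrite er3 !polarE => e2.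
have half (p q : F) : p *+ 2 = q *+ 2 -> p = q by move/eqP; rewrite eqr_pMn2r // => /eqP.
split=> //; apply: half.
- transitivity (polar_form r2 v v - (- polar_form r1 v v - polar_form r2 v v) - polar_form r1 v v).
    by ring.
  by rewrite e2 e1; ring.
transitivity (- (polar_form r2 v v - (- polar_form r1 v v - polar_form r2 v v)) - polar_form r1 v v).
  by ring.
by rewrite e2 e1; ring.
Qed.

Lemma skew_K_invariants P r1 r2 r3 E L X Y w : is_pencil P -> is_point (center w) ->
  triple P r1 r2 r3 -> skew_K_vertex P E L X Y w ->
  forall l x y u v, reflect_on w l x y -> u \in x -> v \in y -> u != 0 -> v != 0 ->
  exists k, val2 r1 r2 r3 v = k ^+ 2 * val2 r1 r2 r3 u /\
            val3 r1 r2 r3 v = - k ^+ 3 * val3 r1 r2 r3 u.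
Proof.
move=> isP pw tr [ta gv] l x y u v rf ux vy u0 v0; have [dP sP] := isP.
have [a [b [c [fr [eE eL eX eY] onP]]]] := type_a_frame sP ta.
have [s1 [s2 [s3 [ts ab ac sab _]]]] := type_a_triple isP fr onP.
have [[s1P s2P es3] _ _ _ _] := ts.
have s23 : s2 - s3 \in P by rewrite es3 memvB // memvB // memvN.
rewrite eE eL eX eY in gv.
have rev := K_reversing isP fr onP pw s1P s23 ab sab gv.
have [k k0 [e1 e2 e3]] := reversing_transposes es3 rev rf ux vy u0 v0.
have [h h0 rel] := triple_unique tr ts.
have [u2 u3] := rel u; have [v2 v3] := rel v; exists k; split.
  apply: (mulfI (expf_neq0 2 h0)); rewrite -v2 mulrCA -u2 /val2 e1 e2 e3 /=; ring.
by apply: (mulfI (expf_neq0 3 h0)); rewrite -v3 mulrCA -u3 /val3 e1 e2 e3 /=; ring.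
Qed.

Lemma skew_vertex_type_a P a b c w : is_pencil P -> frame a b c ->
  (forall S, S \in P -> [/\ polar_form S a a = 0, polar_form S b b = 0,
      polar_form S c c = 0 & polar_form S a b + polar_form S b c + polar_form S a c = 0]) ->
  is_point (center w) -> skew_vertex P w -> exists E L X Y, skew_K_vertex P E L X Y w.
Proof.
move=> isP fr onP pw [g|q]; last first.
  have [A [S [Q [_ _ _ _ bs]]]] := skew_quasi_data isP q.
  by case: (type_a_not_base_singular isP fr onP bs).
case: (skew_global_cases isP pw g) => [//|[bs _]|[A [B [L [C [td _ _ _]]]]]].
  by case: (type_a_not_base_singular isP fr onP bs).
case: (type_a_not_base_singular isP fr onP).
have [[pA _ lL] _ _ _] := td; have [m mL mA] := line_point_other pA lL.
have [a' [b' [fr' _ onP' ex cr]]] := type_d_frame isP td mL mA.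
have [Q [QP Q0 Qab]] := pencil_polar_zero a' b' isP.1.
have [_ sing _] := type_d_singular isP fr' onP' cr ex QP Q0 Qab.
exists a'; split; first by have [] := frame_neq0 fr'.
by exists Q; split=> // T /onP'[].
Qed.

(** The clause on the centers makes [r1] and [r2] the only conics of the pencil through them; this
    serves to find these conics over the ground field, where the centers lie. *)
Theorem neighbor_common P (W : vertex F -> Prop) : is_pencil P ->
  (forall w, W w -> is_point (center w)) -> has_neighbor_skew_vertices P W ->
  exists r1 r2 r3 w1 w2, [/\ triple P r1 r2 r3, W w1 /\ W w2,
    transposes r1 r2 r3 w1 /\ transposes r2 r1 r3 w2,
    (forall n, n \in center w1 -> n != 0 -> forall S, S \in P -> polar_form S n n = 0 ->
       S \in <[r1]>%VS) /\
    (forall n, n \in center w2 -> n != 0 -> forall S, S \in P -> polar_form S n n = 0 ->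
       S \in <[r2]>%VS) &
    forall z, W z -> skew_vertex P z ->
    forall l x y u v, reflect_on z l x y -> u \in x -> v \in y -> u != 0 -> v != 0 ->
    exists k, val2 r1 r2 r3 v = k ^+ 2 * val2 r1 r2 r3 u /\
            val3 r1 r2 r3 v = - k ^+ 3 * val3 r1 r2 r3 u].
Proof.
move=> isP pW [E [L [X [Y [w1 [w2 [Wv Ww [ta gv] [ta' gw]]]]]]]]; have [dP sP] := isP.
have [a [b [c [fr [eE eL eX eY] onP]]]] := type_a_frame sP ta.
have [r1 [r2 [r3 [tr ab ac sab sac]]]] := type_a_triple isP fr onP.
have [[r1P r2P er3] r10 r21 _ _] := tr.
have r23 : r2 - r3 \in P by rewrite er3 memvB // memvB // memvN.
have r13 : r1 - r3 \in P by rewrite er3 memvB // memvB // memvN.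
rewrite eE eL eX eY in gv gw.
have rev := K_reversing isP fr onP (pW _ Wv) r1P r23 ab sab gv.
have fr' : frame a c b by apply: frame_rot (frame_swap fr).
have onP' S : S \in P -> [/\ polar_form S a a = 0, polar_form S c c = 0,
      polar_form S b b = 0 & polar_form S a c + polar_form S c b + polar_form S a b = 0].
  move=> SP; have [aa bb cc e] := onP _ SP; split=> //.
  by rewrite (polarC c b (sP _ SP)) -[RHS]e; ring.
rewrite -addrA (addrC b) addrA in gw.
have rev' := K_reversing isP fr' onP' (pW _ Ww) r2P r13 ac sac gw.
exists r1, r2, r3, w1, w2; split=> //.
- split; apply: reversing_transposes => //.
  by rewrite er3 addrC.
- have span S : S \in P -> exists x y, S = x *: r1 + y *: r2.
    exact: pencil_span dP r1P r2P r10 r21 _.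
  have r20 : r2 != 0 by apply: contraNneq r21 => ->; rewrite mem0v.
  split=> n.
    rewrite gv.1 => /(K_point_vec fr erefl)[t ->] tn0 S SP.
    have [x [y ->]] := span _ SP; have [aa bb cc e] := onP _ r1P; have [aa' bb' cc' e'] := onP _ r2P.
    have r2ab : polar_form r2 a b != 0.
      apply: contra r20 => /eqP z; apply/eqP/(type_a_eq0 isP fr onP) => //.
      by rewrite -[RHS]e' z ac add0r addr0.
    have t0 : t != 0 by apply: contraNneq tn0 => ->; rewrite scale0r.
    rewrite !polarE (polarC b a (sP _ r1P)) (polarC b a (sP _ r2P)) aa bb aa' bb' ab => e0.
    have : y * (t ^+ 2 * polar_form r2 a b) *+ 2 = 0.
      by apply/eqP; rewrite -oppr_eq0; apply/eqP; rewrite -[RHS]e0; ring.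
    move/mulr2n_inj0/eqP; rewrite !mulf_eq0 (negPf t0) (negPf r2ab) !orbF => /eqP ->.
    by rewrite scale0r addr0 memvZ ?memv_line.
  rewrite gw.1 => /(K_point_vec fr' erefl)[t ->] tn0 S SP.
  have [x [y ->]] := span _ SP; have [aa bb cc e] := onP _ r1P; have [aa' bb' cc' e'] := onP _ r2P.
  have r1ac : polar_form r1 a c != 0.
    apply: contra r10 => /eqP z; apply/eqP/(type_a_eq0 isP fr onP) => //.
    by rewrite -[RHS]e z ab add0r addr0.
  have t0 : t != 0 by apply: contraNneq tn0 => ->; rewrite scale0r.
  rewrite !polarE (polarC c a (sP _ r1P)) (polarC c a (sP _ r2P)) aa cc aa' cc' ac => e0.
  have : x * (t ^+ 2 * polar_form r1 a c) *+ 2 = 0.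
    by apply/eqP; rewrite -oppr_eq0; apply/eqP; rewrite -[RHS]e0; ring.
  move/mulr2n_inj0/eqP; rewrite !mulf_eq0 (negPf t0) (negPf r1ac) !orbF => /eqP ->.
  by rewrite scale0r add0r memvZ ?memv_line.
move=> z Wz skz; have [E' [L' [X' [Y' K']]]] := skew_vertex_type_a isP fr onP (pW _ Wz) skz.
exact: skew_K_invariants isP (pW _ Wz) tr K'.
Qed.

End Triples.

(** * Real points of complexified structures *)

Section GroundField.
Local Open Scope ring_scope.
Variables (F K : numFieldType) (iota : {rmorphism F -> K}).
Local Notation vec := 'rV[F]_3.
Local Notation cx := (map_mx iota).
Implicit Types (u v c z : vec) (S : 'M[F]_3) (P : {vspace 'M[F]_3}).

Lemma mem_complexify m n (U : {vspace 'M[F]_(m, n)}) (u : 'M[F]_(m, n)) : u \in U -> cx u \in complexify iota U.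
Proof.
move=> uU; rewrite (coord_vbasis uU) raddf_sum; apply: memv_suml => i _.
rewrite /= map_mxZ memvZ // memv_span //; apply: map_f.
by rewrite mem_nth // size_tuple.
Qed.

Lemma complexify_sub m n (U : {vspace 'M[F]_(m, n)}) (V : {vspace 'M[K]_(m, n)}) :
  (forall u : 'M[F]_(m, n), u \in U -> cx u \in V) -> (complexify iota U <= V)%VS.
Proof. by move=> h; apply/span_subvP => _ /mapP[u /vbasis_mem uU ->]; apply: h. Qed.

Lemma complexify_line m n (u : 'M[F]_(m, n)) : complexify iota <[u]> = <[cx u]>%VS.
Proof.
apply/eqP; rewrite eqEsubv; apply/andP; split; last first.
  by rewrite -memvE mem_complexify ?memv_line.
by apply: complexify_sub => _ /vlineP[k ->]; rewrite map_mxZ memvZ ?memv_line.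
Qed.

Lemma complexify_mono m n (U V : {vspace 'M[F]_(m, n)}) :
  (U <= V)%VS -> (complexify iota U <= complexify iota V)%VS.
Proof. by move=> /subvP UV; apply: complexify_sub => u /UV/mem_complexify. Qed.

Lemma cx_eq0 m n (u : 'M[F]_(m, n)) : (cx u == 0) = (u == 0).
Proof. exact: map_mx_eq0. Qed.

Lemma polar_cx S u v : polar_form (cx S) (cx u) (cx v) = iota (polar_form S u v).
Proof. by rewrite /polar_form matrix.map_trmx -!map_mxM mxE. Qed.

Lemma cx_notin (S T : 'M[F]_3) : S != 0 -> T \notin <[S]>%VS -> cx T \notin <[cx S]>%VS.
Proof.
move=> S0 TS; apply/vlineP => -[k e].
have [i [j Sij]] : exists i j, S i j != 0.
  apply: contrapT => np; case/eqP: S0; apply/matrixP => i j; rewrite mxE.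
  by apply: contrapT => /eqP nz; apply: np; exists i, j.
have ek : k = iota (T i j / S i j).
  have := congr1 (fun M : 'M[K]_3 => M i j) e; rewrite !mxE => eij.
  by rewrite fmorph_div eij mulfK // fmorph_eq0.
case/negP: TS; apply/vlineP; exists (T i j / S i j); apply/eqP; rewrite -subr_eq0.
by rewrite -cx_eq0 map_mxB map_mxZ -ek e subrr.
Qed.

Lemma complexify_pencil P S T : is_pencil P -> S \in P -> T \in P -> S != 0 ->
  T \notin <[S]>%VS -> is_pencil (complexify iota P) /\
  forall Q, Q \in complexify iota P -> exists x y, Q = x *: cx S + y *: cx T.
Proof.
move=> [dP sP] SP TP S0 TS.
have T0 : T != 0 by apply: contraNneq TS => ->; rewrite mem0v.
have span : (complexify iota P <= <[cx S]> + <[cx T]>)%VS.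
  apply: complexify_sub => Q QP; have [x [y ->]] := pencil_span dP SP TP S0 TS QP.
  by rewrite map_mxD !map_mxZ memv_add // memvZ ?memv_line.
have TS' := cx_notin S0 TS.
have form Q : Q \in complexify iota P -> exists x y, Q = x *: cx S + y *: cx T.
  move=> /(subvP span)/memv_addP[_ /vlineP[x ->] [_ /vlineP[y ->] ->]].
  by exists x, y.
split=> //; split; last first.
  move=> Q /form[x [y ->]]; rewrite linearD !linearZ /= !matrix.map_trmx.
  by rewrite !sP.
have PE : complexify iota P = (<[cx S]> + <[cx T]>)%VS.
  by apply/eqP; rewrite eqEsubv span subv_add -!memvE !mem_complexify.
rewrite PE dimv_disjoint_sum ?dim_vline ?cx_eq0 ?S0 ?T0 //; apply/eqP.
rewrite -subv0; apply/subvP => w; rewrite memv_cap => /andP[/vlineP[k ->] /vlineP[h e]].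
rewrite memv0; have [h0|h0] := eqVneq h 0; first by rewrite e h0 scale0r.
by case/negP: TS'; rewrite -[cx T](scalerK h0) -e memvZ // memvZ // memv_line.
Qed.

(** What genericity arguments need of a K-valued function of vectors over F: it is polynomial along
    lines over F. This covers forms over F, forms over K, and products. *)
Definition linepoly (g : vec -> K) :=
  forall u v, exists p : {poly K}, forall s, g (u + s *: v) = p.[iota s].

Lemma linepolyM g h : linepoly g -> linepoly h -> linepoly (fun u => g u * h u).
Proof.
move=> lg lh u v; have [p ep] := lg u v; have [q eq] := lh u v.
by exists (p * q) => s; rewrite hornerM ep eq.
Qed.

Lemma linepoly_at_vec (D : {mpoly F[3]}) : linepoly (fun u => iota (at_vec D u)).
Proof.
move=> u v; exists (map_poly iota (line_poly u v D)) => s.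
by rewrite horner_map /= horner_line_poly.
Qed.

Lemma linepoly_polar (Q : 'M[K]_3) : linepoly (fun u => polar_form Q (cx u) (cx u)).
Proof.
move=> u v; exists ((polar_form Q (cx u) (cx u))%:P
  + (polar_form Q (cx u) (cx v) + polar_form Q (cx v) (cx u)) *: 'X
  + polar_form Q (cx v) (cx v) *: 'X^2) => s.
by rewrite map_mxD map_mxZ !polarE !horner_simp; ring.
Qed.

(** The sequence is arbitrary so that it may also tend to zero, which yields nonroots close to a
    given point. *)
Lemma nonroot_seq (p : {poly K}) (h : nat -> F) : injective h -> p != 0 ->
  exists n, p.[iota (h n)] != 0.
Proof.
move=> h_inj p0; apply: contrapT => np.
have := max_poly_roots p0 (rs := [seq iota (h i) | i <- seq.iota 0 (size p)]).
rewrite map_inj_uniq ?iota_uniq; last by move=> i j /fmorph_inj/h_inj.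
rewrite size_map size_iota ltnn => ne; have : false by apply: ne => //; apply/allP => _ /mapP[i _ ->];
  rewrite rootE; apply: contrapT => /negP nz; apply: np; exists i.
by [].
Qed.

Lemma linepoly_nonzeroM g h y z : linepoly g -> linepoly h -> g y != 0 -> h z != 0 ->
  exists u, g u * h u != 0.
Proof.
move=> lg lh gy hz; have [p ep] := lg y (z - y); have [q eq] := lh y (z - y).
have p0 : p != 0.
  apply: contraNneq gy => p0; have := ep 0.
  by rewrite scale0r addr0 p0 horner0 => ->.
have q0 : q != 0.
  apply: contraNneq hz => q0; have := eq 1.
  by rewrite scale1r addrC subrK q0 horner0 => ->.
have [n] : exists n, (p * q).[iota (n%:R)] != 0.
  apply: (nonroot_seq (h := fun n => n%:R)); last by rewrite mulf_neq0.
  by move=> i j /eqP; rewrite eqr_nat => /eqP.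
by rewrite hornerM -ep -eq; exists (y + n%:R *: (z - y)).
Qed.

Lemma linepoly_near g z u (e : F) : linepoly g -> g z != 0 -> 0 < e ->
  exists2 u' : vec, forall i, `|u' 0 i - u 0 i| < e & g u' != 0.
Proof.
move=> lg gz e0; have [p ep] := lg u (z - u).
have p0 : p != 0.
  apply: contraNneq gz => p0; have := ep 1.
  by rewrite scale1r addrC subrK p0 horner0 => ->.
(* A bound on the coordinates of [z - u], so that the points u + e / (M (n + 1)) (z - u) stay within
   [e] of [u]. *)
pose M := 1 + \sum_i `|(z - u) 0 i|.
have M0 : 0 < M by rewrite ltr_wpDr // sumr_ge0.
have dM i : `|(z - u) 0 i| < M.
  rewrite /M (bigD1 i) //= addrCA ltrDl ltr_wpDr // sumr_ge0 //.
pose h n := e / (M * n.+1%:R).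
have MN n : 0 < M * n.+1%:R by rewrite mulr_gt0 // ltr0Sn.
have h_inj : injective h.
  move=> i j /(mulfI (lt0r_neq0 e0))/invr_inj/(mulfI (lt0r_neq0 M0))/eqP.
  by rewrite eqr_nat => /eqP[].
have [n hn] := nonroot_seq h_inj p0.
exists (u + h n *: (z - u)); last by rewrite ep.
move=> i; have -> : (u + h n *: (z - u)) 0 i - u 0 i = h n * (z - u) 0 i.
  by rewrite !mxE; ring.
rewrite normrM.
rewrite gtr0_norm ?divr_gt0 // /h mulrAC ltr_pdivrMr // ltr_pM2l //.
by apply: Order.POrderTheory.lt_le_trans (dM i) _; rewrite ler_peMr ?(Order.POrderTheory.ltW M0) // ler1n.
Qed.

(** Openness of the set of lines allows a generic [u]. With the center at infinity, an involution of
    the line fixing it is s |-> - s - d in the coordinate of u + s c. *)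
Lemma vertex_line (v : vertex F) g z : vertex_axioms v -> linepoly g -> g z != 0 ->
  exists c u d, [/\ c != 0 /\ center v = <[c]>%VS, g u != 0, u \notin <[c]>%VS &
    forall s, reflect_on v (<[c]> + <[u]>)%VS <[u + s *: c]>%VS <[u - (s + d) *: c]>%VS].
Proof.
move=> [pc [l dl] refl op] lg gz; have [c c0 ec] := is_pointP pc.
have [ll cl _] := refl _ dl.
have cl' : c \in l by rewrite memvE -ec.
have [u0 u0c el] := is_lineP ll c0 cl'.
rewrite el -ec in dl; have [e e0 near] := op _ dl.
have [u un gu] := linepoly_near u0 lg gz e0.
have dl' := near _ un; have [ll' _ [f [inv fc rE]]] := refl _ dl'.
have uc : u \notin <[c]>%VS by apply: is_line_notin; rewrite -ec.
rewrite ec in inv fc rE; have [al [d [al0 fa fb]]] := line_involution c0 uc inv fc.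
exists c, u, d; split=> // s; apply/rE; split.
  have nz : u + s *: c != 0.
    apply: contra uc; rewrite addr_eq0 => /eqP ->; by rewrite memvN memvZ ?memv_line.
  rewrite /point_on is_point_vline // -memvE; apply/memv_line2; exists s, 1.
  by rewrite scale1r addrC.
have fu : f (u + s *: c) = (- al) *: (u - (s + d) *: c).
  by rewrite linearD linearZ /= fa fb; vring.
by rewrite limg_line fu vline_scale // oppr_eq0.
Qed.

Lemma vertex_complexification_pair (v : vertex F) (w : vertex K) l x y u u' :
  vertex_complexification iota v w -> reflect_on v l x y -> u \in x -> u' \in y ->
  [/\ reflect_on w (complexify iota l) (complexify iota x) (complexify iota y),
      cx u \in complexify iota x & cx u' \in complexify iota y].
Proof. by move=> [_ rE _] /rE[_ _ _ rw] ux uy; split=> //; apply: mem_complexify. Qed.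

Lemma center_is_point (v : vertex F) (w : vertex K) : vertex_axioms v ->
  vertex_complexification iota v w -> is_point (center w).
Proof.
move=> [pc _ _ _] [-> _ _]; have [c c0 ->] := is_pointP pc.
by rewrite complexify_line is_point_vline // cx_eq0.
Qed.

(** The conic of the complexified pencil through [u] meets the tangent line also in the image of
    [u], and this conic is T(u, u) S - S(u, u) T. *)
Lemma pencil_billiard_pair P (g : dual_billiard F) S T p x y u v :
  pencil_billiard iota P g -> invol g p x y -> u \in x -> v \in y -> S \in P -> T \in P ->
  polar_form S u u * polar_form T v v = polar_form S v v * polar_form T u u.
Proof.
move=> [R [_ _ _ _ [_ iE]]] /iE[_ _ [l [f [tl /andP[px xl] py [_ _ perm] ey]]]] ux vy SP TP.
have [->|u0] := eqVneq u 0; first by rewrite !polar0l mulr0 mul0r.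
have ex := is_point_vec px ux u0.
have vfx : cx v \in (f @: complexify iota x)%VS by rewrite -ey mem_complexify.
have key Q : Q \in complexify iota P -> polar_form Q (cx u) (cx u) = 0 ->
    polar_form Q (cx v) (cx v) = 0.
  move=> QP Qu; have [->|Q0] := eqVneq Q 0; first by rewrite polar_zerom.
  have cu0 : cx u != 0 by rewrite cx_eq0.
  have exx : complexify iota x = <[cx u]>%VS by rewrite ex complexify_line.
  have onx : on_conic Q (complexify iota x).
    by rewrite exx => _ /vlineP[k ->]; rewrite polarZl polarZr Qu !mulr0.
  have pox : point_on (complexify iota x) (complexify iota l).
    by rewrite /point_on complexify_mono // andbT exx is_point_vline.
  have [other same] := perm Q (conj QP Q0) _ pox onx.
  have [[z [pz oz nz]]|no] := pselect (exists z : {vspace 'rV[K]_3},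
    [/\ point_on z (complexify iota l), on_conic Q z & z <> complexify iota x]).
    by have e := other z pz oz nz; apply: (oz (cx v)); rewrite -e.
  apply: onx; rewrite -same // => z pz oz; apply: contrapT => nz; apply: no.
  by exists z.
apply: (fmorph_inj iota); rewrite !rmorphM -!polar_cx.
have := key (polar_form (cx T) (cx u) (cx u) *: cx S - polar_form (cx S) (cx u) (cx u) *: cx T).
rewrite !polarE => h; apply/eqP; rewrite -subr_eq0; apply/eqP.
have -> : polar_form (cx S) (cx v) (cx v) * polar_form (cx T) (cx u) (cx u)
  = polar_form (cx T) (cx u) (cx u) * polar_form (cx S) (cx v) (cx v) by rewrite mulrC.
apply/eqP; rewrite subr_eq0 eq_sym -subr_eq0; apply/eqP/h.
  by rewrite memvB // memvZ // mem_complexify.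
by rewrite mulrC subrr.
Qed.

End GroundField.

(** * Lower bounds *)

Section BinaryForms.
Local Open Scope ring_scope.
Variable F : numFieldType.
Local Notation vec := 'rV[F]_3.

Lemma size_mul_leq n k (p q : {poly F}) : (size p <= n.+1)%N -> (size q <= k.+1)%N ->
  (size (p * q)%R <= (n + k).+1)%N.
Proof.
move=> sp sq; apply: (leq_trans (size_polyMleq _ _)).
by move: (size p) (size q) sp sq => s t; clear; lia.
Qed.

(** The products [p ^+ i * q ^+ (m - i)] vanish at 0 to distinct orders. *)
Lemma form_poly_zero (p q : {poly F}) m (a : nat -> F) : p != 0 -> p.[0] = 0 -> q.[0] != 0 ->
  \sum_(i < m.+1) a i *: (p ^+ i * q ^+ (m - i)) = 0 -> forall i, (i <= m)%N -> a i = 0.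
Proof.
move=> p0 pz qz; elim: m a => [|m IH] a.
  rewrite big_ord1 expr0 mul1r => /eqP; rewrite scaler_eq0 oner_eq0 orbF => /eqP a0 [|i] //.
rewrite big_ord_recl expr0 mul1r subn0.
rewrite (eq_bigr (fun i : 'I_m.+1 => p * (a i.+1 *: (p ^+ i * q ^+ (m - i))))); last first.
  by move=> i _; rewrite lift0 subSS exprS -mulrA scalerAr.
rewrite -mulr_sumr => e.
have a0 : a 0%N = 0.
  have := congr1 (horner^~ 0) e; rewrite /= hornerD hornerZ hornerM pz mul0r addr0 horner0.
  by rewrite horner_exp => /eqP; rewrite mulf_eq0 expf_eq0 (negPf qz) andbF orbF => /eqP.
move: e; rewrite a0 scale0r add0r => /eqP; rewrite mulf_eq0 (negPf p0) /= => /eqP e.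
by move=> [|i] //; apply: (IH (fun i => a i.+1)).
Qed.

Definition form (m : nat) (a : 'I_m.+1 -> F) (x y : F) := \sum_i a i * (x ^+ i * y ^+ (m - i)).

Lemma formZ m (a : 'I_m.+1 -> F) k x y : form a (k * x) (k * y) = k ^+ m * form a x y.
Proof.
rewrite /form mulr_sumr; apply: eq_bigr => i _; rewrite !exprMn.
have -> : k ^+ m = k ^+ i * k ^+ (m - i) by rewrite -exprD subnKC ?leq_ord.
by ring.
Qed.

Variables (S0 S2 : 'M[F]_3).

Definition conic_form (m : nat) (a : 'I_m.+1 -> F) : {mpoly F[3]} :=
  \sum_i a i *: (conic_poly S0 ^+ i * conic_poly S2 ^+ (m - i)).

Lemma at_conic_form m (a : 'I_m.+1 -> F) u :
  at_vec (conic_form a) u = form a (polar_form S0 u u) (polar_form S2 u u).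
Proof.
rewrite /at_vec raddf_sum; apply: eq_bigr => i _; rewrite /= mevalZ -/(at_vec _ u).
by rewrite at_vecM !at_vecX !at_conic_poly.
Qed.

Lemma conic_form_eq0 m (a : 'I_m.+1 -> F) z : S0 != 0 -> S0^T = S0 ->
  polar_form S0 z z = 0 -> polar_form S2 z z != 0 ->
  conic_form a = 0 -> forall i, a i = 0.
Proof.
move=> S00 sS0 z0 z2 e i.
have [x Sx] := polar_diag_neq0 sS0 S00.
pose p := line_poly z (x - z) (conic_poly S0); pose q := line_poly z (x - z) (conic_poly S2).
have p0 : p != 0 by apply: generic_vec; rewrite at_conic_poly.
have pz : p.[0] = 0 by rewrite horner_line_poly scale0r addr0 at_conic_poly.
have qz : q.[0] != 0 by rewrite horner_line_poly scale0r addr0 at_conic_poly.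
have := form_poly_zero (m := m) (a := fun n => a (inord n)) p0 pz qz.
rewrite (eq_bigr (fun i : 'I_m.+1 => a i *: (p ^+ i * q ^+ (m - i)))); last first.
  by move=> j _; rewrite inord_val.
have -> : \sum_(i < m.+1) a i *: (p ^+ i * q ^+ (m - i)) = line_poly z (x - z) (conic_form a).
  rewrite /line_poly rmorph_sum; apply: eq_bigr => j _.
  by rewrite /= -mul_mpolyC !rmorphM !rmorphXn /= mmapC mul_polyC.
rewrite e /line_poly rmorph0 => /(_ erefl i (leq_ord i)).
by rewrite inord_val.
Qed.

(** If all minors vanish, either the form [a] is a constant multiple of [b], and N the same multiple
    of D, or [b] is zero and D vanishes. *)
Lemma forms_not_proportional m (a b : 'I_m.+1 -> F) (N D : {mpoly F[3]}) z :
  S0 != 0 -> S0^T = S0 -> polar_form S0 z z = 0 -> polar_form S2 z z != 0 ->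
  (exists i, (a i != 0) || (b i != 0)) ->
  (forall u, at_vec (conic_form b) u * at_vec N u = at_vec (conic_form a) u * at_vec D u) ->
  D != 0 -> (forall c : F, N <> c *: D) -> ~ forall i j, a i * b j = a j * b i.
Proof.
move=> S00 sS0 z0 z2 [k abk] rel D0 ND prop.
have e : conic_form b * N = conic_form a * D.
  by apply/eqP; rewrite -subr_eq0; apply/eqP/at_vec_eq0 => u; rewrite at_vecB !at_vecM rel subrr.
have [[j bj]|nb] := pselect (exists j, b j != 0).
  apply: (ND (a j / b j)).
  have ea : conic_form a = (a j / b j) *: conic_form b.
    rewrite /conic_form scaler_sumr; apply: eq_bigr => i _; rewrite scalerA; congr (_ *: _).
    by rewrite mulrAC prop mulfK || (rewrite mulrAC -prop mulfK).
  have b0 : conic_form b != 0.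
    by apply: contraNneq bj => b0; apply/eqP; apply: (conic_form_eq0 S00 sS0 z0 z2 b0).
  by apply: (mulfI b0); rewrite e ea -scalerAl -scalerAr.
have b0 i : b i = 0 by apply: contrapT => /eqP bi; apply: nb; exists i.
move: abk; rewrite b0 eqxx orbF => ak.
have a0 : conic_form a != 0.
  by apply: contraNneq ak => a0; apply/eqP; apply: (conic_form_eq0 S00 sS0 z0 z2 a0).
move: e; rewrite {1}/conic_form big1 ?mul0r; last by move=> i _; rewrite b0 scale0r.
by move/esym/eqP; rewrite mulf_eq0 (negPf a0) (negPf D0).
Qed.

Lemma conic_point_off p0 : S0^T = S0 -> regular S0 -> S2^T = S2 -> S2 \notin <[S0]>%VS ->
  is_point p0 -> on_conic S0 p0 -> exists z, polar_form S0 z z = 0 /\ polar_form S2 z z != 0.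
Proof.
move=> sS0 rS0 sS2 S2n pp0 on0.
have [e0 [e1 [e2 [mu [fr _ mu0 S0E]]]]] := conic_frame sS0 rS0 pp0 on0.
have [t] := poly_neq0_value (chart_S2_neq0 fr mu0 sS0 sS2 S0E S2n).
rewrite horner_subst2 !horner_simp value_in_chart at_conic_poly => h.
exists (e0 + t *: e1 + t ^+ 2 *: e2); split=> //.
by rewrite -[e0]scale1r S0E; ring.
Qed.

End BinaryForms.

Section LowerBounds.
Local Open Scope ring_scope.
Variables (F K : numFieldType) (iota : {rmorphism F -> K}).
Local Notation vec := 'rV[F]_3.
Local Notation cx := (map_mx iota).
Variables (P : {vspace 'M[F]_3}) (B : multibilliard F) (g0 : dual_billiard F).
Hypothesis isP : is_pencil P.
Hypothesis mB : is_dual_multibilliard B.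
Hypothesis cB : forall g, curves B g -> pencil_billiard iota P g.
Hypothesis Bg0 : curves B g0.
Variables (S0 S2 : 'M[F]_3) (p0 : {vspace vec}).
Hypothesis (S0P : S0 \in P) (rS0 : regular S0) (S2P : S2 \in P) (S2n : S2 \notin <[S0]>%VS).
Hypothesis (pp0 : is_point p0) (on0 : on_conic S0 p0).
Hypothesis curveE : forall p, curve g0 p <-> is_point p /\ on_conic S0 p.
Hypothesis tangentE : forall p l, tangent_line g0 p l -> tangent_at S0 p l.

Let sS0 : S0^T = S0 := isP.2 _ S0P.
Let sS2 : S2^T = S2 := isP.2 _ S2P.
Local Notation cform := (conic_form S0 S2).

Lemma S0_neq0 : S0 != 0.
Proof.
apply: contraTneq rS0 => ->; rewrite /regular unitmxE det0 ?unitr0 //.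
Qed.

Variables (d : nat) (N D : {mpoly F[3]}).
Hypothesis intND : rational_integral B d N D.

Lemma integral_form : exists a b : 'I_(d./2).+1 -> F, (exists i, (a i != 0) || (b i != 0)) /\
  forall u, at_vec (cform b) u * at_vec N u = at_vec (cform a) u * at_vec D u.
Proof.
have [[hN hD _] _ _ hC _] := intND.
have [[bad defd] inv] := mB.1 _ Bg0.
have [|a [b [nz e]]] := pencil_form_of_integral (bad := bad) sS0 rS0 sS2 S2n pp0 on0 hN hD; last first.
  by exists a, b; split=> // u; rewrite !at_conic_form; apply: e.
move=> p pp onp pbad; have /defd - /(_ pbad)[x [y ixy]] := (curveE p).2 (conj pp onp).
have [_ [l [f [tl pl _ inl [fp fE]]]]] := inv p (ex_intro _ x (ex_intro _ y ixy)).
exists l, f; split=> //; first exact: tangentE.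
move=> z zl; have iz : invol g0 p z (f @: z)%VS by apply/fE.
split; first exact: hC Bg0 _ _ _ iz.
move=> u w uz wz; have := pencil_billiard_pair (cB Bg0) iz uz wz S0P S2P.
by rewrite -!at_conic_poly.
Qed.

(** Invariance passes from N / D to the function of the pencil wherever D does not vanish. D may
    vanish at the image of [u], so the identity is proved for polynomials along the line, where D is
    cancelled, and then evaluated at [u]. *)
Lemma integral_pair (v : vertex F) (g : vec -> K) z (a b : 'I_(d./2).+1 -> F) :
  vertices B v -> linepoly iota g -> g z != 0 ->
  (forall u, at_vec (cform b) u * at_vec N u = at_vec (cform a) u * at_vec D u) ->
  exists l u w, [/\ reflect_on v l <[u]>%VS <[w]>%VS, g u != 0, u != 0, w != 0 &
    at_vec (cform a) u * at_vec (cform b) w = at_vec (cform a) w * at_vec (cform b) u].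
Proof.
move=> Bv lg gz rel; have [[hN hD D0] _ _ _ hV] := intND.
have [y Dy] : exists y, at_vec D y != 0.
  apply: contrapT => np; case/eqP: D0; apply: at_vec_eq0 => y.
  by apply: contrapT => /eqP ny; apply: np; exists y.
have Dy' : iota (at_vec D y) != 0 by rewrite fmorph_eq0.
have lD : linepoly iota (fun u => iota (at_vec D u)) := linepoly_at_vec iota D.
have [x gDx] := linepoly_nonzeroM lg lD gz Dy'.
have [c [u [dl [[c0 ec] + uc refl]]]] := vertex_line (mB.2 _ Bv) (linepolyM lg lD) gDx.
rewrite mulf_eq0 fmorph_eq0 negb_or => /andP[gu Du].
have u0 : u != 0 by apply: contraNneq uc => ->; rewrite mem0v.
have w0 s : u - s *: c != 0.
  by apply: contra uc; rewrite subr_eq0 => /eqP ->; rewrite memvZ ?memv_line.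
exists (<[c]> + <[u]>)%VS, u, (u - dl *: c); split=> //.
  by have := refl 0; rewrite scale0r addr0 add0r.
have pair s : at_vec N (u + s *: c) * at_vec D (u - (s + dl) *: c)
   = at_vec N (u - (s + dl) *: c) * at_vec D (u + s *: c).
  exact: (hV _ Bv _ _ _ (refl s) _ _ (memv_line _) (memv_line _)).
pose L (M : {mpoly F[3]}) := line_poly u c M; pose L' M := line_poly (u - dl *: c) (- c) M.
have LE M s : (L M).[s] = at_vec M (u + s *: c) by rewrite horner_line_poly.
have LE' M s : (L' M).[s] = at_vec M (u - (s + dl) *: c).
  by rewrite horner_line_poly; congr at_vec; vring.
have DL : L D != 0.
  by apply: contraNneq Du => z0; have := LE D 0; rewrite z0 horner0 scale0r addr0 => <-.
have DL' : L' D != 0.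
  by apply: contraNneq Du => z0; have := LE' D (- dl); rewrite z0 horner0 addNr scale0r subr0 => <-.
have : L D * L' D * (L (cform a) * L' (cform b) - L' (cform a) * L (cform b)) = 0.
  apply: poly_eq0_all => s; rewrite rootE !(hornerM, hornerD, hornerN) !LE !LE'.
  have e := pair s; have r1 := rel (u + s *: c); have r2 := rel (u - (s + dl) *: c).
  set u1 := u + s *: c in e r1 *; set w1 := u - (s + dl) *: c in e r2 *.
  apply/eqP; transitivity (at_vec (cform a) u1 * at_vec D u1 * (at_vec D w1 * at_vec (cform b) w1)
    - at_vec (cform a) w1 * at_vec D w1 * (at_vec D u1 * at_vec (cform b) u1)); first by ring.
  rewrite -r1 -r2; transitivity (at_vec (cform b) u1 * at_vec (cform b) w1 *
    (at_vec N u1 * at_vec D w1 - at_vec N w1 * at_vec D u1)); first by ring.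
  by rewrite e subrr mulr0.
move/eqP; rewrite !mulf_eq0 (negPf DL) (negPf DL') /= => /eqP e.
have := congr1 (horner^~ 0) e; rewrite /= !(hornerM, hornerD, hornerN) !LE !LE' horner0.
by rewrite scale0r addr0 add0r => /subr0_eq.
Qed.

(** For d < 2 the two forms have degree zero, and N / D would be constant. *)
Lemma degree_ge2 : (2 <= d)%N.
Proof.
have [[_ _ D0] _ ND _ _] := intND; rewrite leqNgt; apply/negP => d2.
have [a [b [nz rel]]] := integral_form.
have [z [z0 z2]] := conic_point_off sS0 rS0 sS2 S2n pp0 on0.
apply: (forms_not_proportional S0_neq0 sS0 z0 z2 nz rel D0 ND) => i j.
have dd : d./2 = 0%N by move: d2; case: (d) => [|[|]].
have k0 (k : 'I_(d./2).+1) : nat_of_ord k = 0%N.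
  by have := ltn_ord k; move: (nat_of_ord k) => n; rewrite dd ltnS leqn0 => /eqP.
by have -> : i = j by apply: val_inj; rewrite /= !k0.
Qed.

Lemma cx_polar_neq0 (Q : 'M[K]_3) : Q^T = Q -> Q != 0 ->
  exists u : vec, polar_form Q (cx u) (cx u) != 0.
Proof.
move=> sQ Q0; apply: contrapT => np; case/eqP: Q0.
have z u : polar_form Q (cx u) (cx u) = 0.
  by apply: contrapT => /eqP nu; apply: np; exists u.
apply/matrixP => i j; rewrite mxE -polar_delta -!(map_delta_mx iota).
have := z (delta_mx 0 i + delta_mx 0 j); rewrite map_mxD polarization // !z !add0r.
exact: mulr2n_inj0.
Qed.

(** A fractional linear function that takes the same value at two distinct points is constant. *)
Lemma form_small m (a b : 'I_m.+1 -> F) x y x' y' : (m < 2)%N ->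
  form a x y * form b x' y' = form a x' y' * form b x y -> x * y' != x' * y ->
  forall i j, a i * b j = a j * b i.
Proof.
case: m a b => [|[|//]] a b _; first by move=> _ _ i j; rewrite !ord1.
rewrite /form !big_ord_recl !big_ord0 /= !subn0 /bump /= !addn0 !expr0 !expr1 !mul1r !mulr1 !addr0.
set o := lift _ _ => e nz.
have key : a ord0 * b o = a o * b ord0.
  apply/eqP; rewrite -subr_eq0; move/eqP: e; rewrite -subr_eq0 => /eqP e.
  have : (a ord0 * b o - a o * b ord0) * (x * y' - x' * y) = 0.
    by apply/eqP; rewrite -oppr_eq0; apply/eqP; rewrite -[RHS]e; ring.
  by move/eqP; rewrite mulf_eq0 [X in _ || X]subr_eq0 (negPf nz) orbF.
have cases (i : 'I_2) : i = ord0 \/ i = o.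
  by case: i => [[|[|//]] h]; [left|right]; apply: val_inj.
by move=> i j; case: (cases i) => ->; case: (cases j) => ->.
Qed.

Lemma pencil_cross (Q Q' : 'M[K]_3) u w : Q \in complexify iota P -> Q' \in complexify iota P ->
  polar_form S0 u u * polar_form S2 w w = polar_form S0 w w * polar_form S2 u u ->
  polar_form Q (cx u) (cx u) * polar_form Q' (cx w) (cx w)
  = polar_form Q (cx w) (cx w) * polar_form Q' (cx u) (cx u).
Proof.
move=> QP QP' e; have [_ cP] := complexify_pencil iota isP S0P S2P S0_neq0 S2n.
have [x [y ->]] := cP _ QP; have [x' [y' ->]] := cP _ QP'.
rewrite !polarE !polar_cx; have {}e := congr1 iota e; rewrite !rmorphM in e.
apply/eqP; rewrite -subr_eq0; apply/eqP.
move/eqP: e; rewrite -subr_eq0 => /eqP e.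
transitivity ((x * y' - y * x') * (iota (polar_form S0 u u) * iota (polar_form S2 w w) -
       iota (polar_form S0 w w) * iota (polar_form S2 u u))); first by ring.
by rewrite e mulr0.
Qed.

(** For d < 4 the integral is a fractional linear function of the pencil parameter. At a point off
    both fixed conics the vertex moves the parameter, so this function would be constant. *)
Lemma degree_ge4 (v : vertex F) (w : vertex K) Qm Qp : vertices B v ->
  vertex_complexification iota v w -> reversing Qm Qp w ->
  conic_pair (complexify iota P) Qm Qp -> (4 <= d)%N.
Proof.
move=> Bv vw rev [QmP QpP Qm0 Qpm]; rewrite leqNgt; apply/negP => d4.
have [[_ cP] _] := complexify_pencil iota isP S0P S2P S0_neq0 S2n.
have [[_ _ D0] _ ND _ _] := intND.
have [a [b [nz rel]]] := integral_form.
have [z [z0 z2]] := conic_point_off sS0 rS0 sS2 S2n pp0 on0.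
apply: (forms_not_proportional S0_neq0 sS0 z0 z2 nz rel D0 ND).
have Qp0 : Qp != 0 by apply: contraNneq Qpm => ->; rewrite mem0v.
have [z1 g1] := cx_polar_neq0 (cP _ QmP) Qm0; have [z3 g3] := cx_polar_neq0 (cP _ QpP) Qp0.
have l1 := linepoly_polar iota Qm; have l3 := linepoly_polar iota Qp.
have [z4 g4] := linepoly_nonzeroM l1 l3 g1 g3.
have [l [u [u' [refl + u0 u0' e]]]] := integral_pair Bv (linepolyM l1 l3) g4 rel.
rewrite mulf_eq0 negb_or => /andP[mu pu].
rewrite !at_conic_form in e; apply: (form_small _ e).
  by move: d4; case: (d) => [|[|[|[|]]]].
apply/eqP => cross; have := pencil_cross QmP QpP cross.
have [rw ux uy] := vertex_complexification_pair vw refl (memv_line u) (memv_line u').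
have cu0 : cx u != 0 by rewrite cx_eq0.
have cu'0 : cx u' != 0 by rewrite cx_eq0.
have [k k0 [-> ->]] := rev _ _ _ _ _ rw ux uy cu0 cu'0.
  move=> h; have /mulr2n_inj0/eqP : k * (polar_form Qm (cx u) (cx u) * polar_form Qp (cx u) (cx u)) *+ 2 = 0.
    transitivity (polar_form Qm (cx u) (cx u) * (k * polar_form Qp (cx u) (cx u)) -
      (- k * polar_form Qm (cx u) (cx u) * polar_form Qp (cx u) (cx u))); first by ring.
    by rewrite h subrr.
  by rewrite !mulf_eq0 (negPf k0) (negPf mu) (negPf pu).
Qed.

(** * The orbit argument for two neighbors *)

Section SixValues.
Variables (q1 q2 : 'M[F]_3) (x1 y1 x2 y2 : F).
Hypothesis (q1P : q1 \in P) (q10 : q1 != 0).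
Hypothesis (S0E : S0 = x1 *: q1 + y1 *: q2) (S2E : S2 = x2 *: q1 + y2 *: q2).
Variables (c : vec).
Hypothesis (q1c : polar_form q1 c c = 0) (q2c : polar_form q2 c c != 0).
Variables (a b : 'I_(d./2).+1 -> F).
Hypothesis nz : exists i, (a i != 0) || (b i != 0).
Hypothesis rel :
  forall u, at_vec (cform b) u * at_vec N u = at_vec (cform a) u * at_vec D u.

Let m := d./2.
(** The forms in the coordinates of the basis [q1], [q2]; [HP] is the same substitution for
    polynomials. *)
Let H (e : 'I_m.+1 -> F) x y := form e (x1 * x + y1 * y) (x2 * x + y2 * y).
Let HP (e : 'I_m.+1 -> F) (p q : {poly F}) : {poly F} :=
  \sum_i e i *: ((x1 *: p + y1 *: q) ^+ i * (x2 *: p + y2 *: q) ^+ (m - i)).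

Lemma horner_HP e (p q : {poly F}) t : (HP e p q).[t] = H e p.[t] q.[t].
Proof.
rewrite /HP horner_sum; apply: eq_bigr => i _.
by rewrite !horner_simp.
Qed.

Lemma HZ e k x y : H e (k * x) (k * y) = k ^+ m * H e x y.
Proof. by rewrite /H -formZ; congr form; ring. Qed.

Lemma H_ratio e x y : y != 0 -> H e x y = y ^+ m * H e (x / y) 1.
Proof. by move=> y0; rewrite -HZ mulr1 mulrCA divff // mulr1. Qed.

Lemma at_cform_H e u : at_vec (cform e) u = H e (polar_form q1 u u) (polar_form q2 u u).
Proof. by rewrite at_conic_form S0E S2E !polarE. Qed.

Lemma size_HP e (p q : {poly F}) : (size p <= 2)%N -> (size q <= 2)%N -> (size (HP e p q) <= m.+1)%N.
Proof.
move=> sp sq; apply: (leq_trans (size_sum _ _ _)); apply/bigmax_leqP => i _.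
apply: (leq_trans (size_scale_leq _ _)).
have lin (s t : F) : (size (s *: p + t *: q : {poly F})%R <= 2)%N.
  apply: (leq_trans (size_polyD _ _)); rewrite geq_max.
  by rewrite !(leq_trans (size_scale_leq _ _)).
have pw (r : {poly F}) k : (size r <= 2)%N -> (size (r ^+ k) <= k.+1)%N.
  move=> sr; apply: (leq_trans (size_poly_exp_leq _ _)); rewrite ltnS.
  by rewrite -[leqRHS]mul1n leq_mul2r -subn1 leq_subLR sr orbT.
have := size_mul_leq (pw _ i (lin x1 y1)) (pw _ (m - i)%N (lin x2 y2)).
by rewrite subnKC // leq_ord.
Qed.

Let pb := HP b 'X 1.
Let pa := HP a 'X 1.

Lemma HP_X1 e t : (HP e 'X 1).[t] = H e t 1.
Proof. by rewrite horner_HP !hornerE. Qed.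

Lemma conic_q2_neq0 : conic_poly q2 != 0.
Proof.
by apply: contraNneq q2c => e; rewrite -at_conic_poly e /at_vec meval0.
Qed.

Lemma cform_eq_of_ratio e e' : HP e 'X 1 = HP e' 'X 1 -> cform e = cform e'.
Proof.
move=> h; apply: (mulIf conic_q2_neq0); apply/eqP; rewrite -subr_eq0; apply/eqP/at_vec_eq0 => u.
rewrite at_vecB !at_vecM at_conic_poly !at_cform_H.
have [->|z] := eqVneq (polar_form q2 u u) 0; first by rewrite !mulr0 subrr.
by rewrite !(H_ratio _ _ z) -!HP_X1 h subrr.
Qed.

Lemma pb_neq0 : pb != 0.
Proof.
have [[_ _ D0] _ _ _ _] := intND.
have [z [z0 z2]] := conic_point_off sS0 rS0 sS2 S2n pp0 on0.
have zero (e : 'I_m.+1 -> F) : cform e = 0 -> forall i, e i = 0.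
  exact: conic_form_eq0 S0_neq0 sS0 z0 z2.
apply/eqP => e; case: nz => i.
have cb : cform b = 0.
  have z' : cform (fun _ : 'I_m.+1 => 0) = 0.
    by rewrite /conic_form big1 // => j _; rewrite scale0r.
  rewrite -[RHS]z'; apply: cform_eq_of_ratio; rewrite -/pb e.
  by rewrite /HP big1 // => j _; rewrite scale0r.
have ca : cform a = 0.
  have : cform a * D = 0 by apply: at_vec_eq0 => u; rewrite at_vecM -rel cb /at_vec meval0 mul0r.
  by move/eqP; rewrite mulf_eq0 (negPf D0) orbF => /eqP.
by rewrite (zero _ ca) (zero _ cb) eqxx.
Qed.

(** The vertex acts on the pencil by the linear substitution [(x, y) |-> (al x
    + be y, ga x + de y)], up to a common factor. *)
Lemma substitution_invariant v (h : vec -> K) z al be ga de : vertices B v ->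
  linepoly iota h -> h z != 0 ->
  (forall l u w, reflect_on v l <[u]>%VS <[w]>%VS -> u != 0 -> w != 0 -> h u != 0 ->
    exists2 k, k != 0 &
     polar_form q1 w w = k * (al * polar_form q1 u u + be * polar_form q2 u u) /\
     polar_form q2 w w = k * (ga * polar_form q1 u u + de * polar_form q2 u u)) ->
  forall x y : F, y != 0 -> H a x y * H b (al * x + be * y) (ga * x + de * y)
    = H a (al * x + be * y) (ga * x + de * y) * H b x y.
Proof.
move=> Bv lh hz act x y y0.
pose E s t := H a s t * H b (al * s + be * t) (ga * s + de * t)
    - H a (al * s + be * t) (ga * s + de * t) * H b s t.
pose ep : {poly F} := HP a 'X 1 * HP b (al *: 'X + be%:P) (ga *: 'X + de%:P)
   - HP a (al *: 'X + be%:P) (ga *: 'X + de%:P) * HP b 'X 1.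
have epE t : ep.[t] = E t 1.
  by rewrite /ep !(hornerD, hornerN, hornerM) !horner_HP !horner_simp /E !mulr1.
have EZ k s t : E (k * s) (k * t) = k ^+ (m + m) * E s t.
  rewrite /E !(mulrCA _ k) -!mulrDr !HZ exprD mulrBr.
  by congr (_ - _); rewrite mulrACA.
have Eratio (s t : F) : t != 0 -> E s t = t ^+ (m + m) * ep.[s / t].
  by move=> t0; rewrite epE -EZ mulr1 mulrCA divff // mulr1.
suff ep0 : ep = 0.
  by apply/eqP; rewrite -subr_eq0; apply/eqP; rewrite -/(E x y) Eratio // ep0 horner0 mulr0.
have sz : (size ep <= (m + m).+1)%N.
  have s1 : (size ('X : {poly F}) <= 2)%N by rewrite size_polyX.
  have s2 : (size (1%R : {poly F}) <= 2)%N by rewrite size_poly1.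
  have s3 (k j : F) : (size (k *: 'X + j%:P : {poly F})%R <= 2)%N.
    apply: (leq_trans (size_polyD _ _)); rewrite geq_max.
    by rewrite (leq_trans (size_scale_leq _ _)) ?size_polyX // (leq_trans (size_polyC_leq1 _)).
  rewrite (leq_trans (size_polyD _ _)) // size_polyN geq_max.
  by rewrite !size_mul_leq // size_HP.
have Ezero u : E (polar_form q1 u u) (polar_form q2 u u) = 0.
  pose G u := E (polar_form q1 u u) (polar_form q2 u u).
  have lG : linepoly iota (fun u => iota (G u)).
    move=> u0 v0; pose p := line_poly u0 v0 (conic_poly q1).
    pose q := line_poly u0 v0 (conic_poly q2).
    exists (map_poly iota (HP a p q * HP b (al *: p + be *: q) (ga *: p + de *: q)
      - HP a (al *: p + be *: q) (ga *: p + de *: q) * HP b p q)) => s.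
    rewrite horner_map /=; congr (iota _).
    rewrite !(hornerD, hornerN, hornerM) !horner_HP !(hornerD, hornerZ).
    by rewrite !horner_line_poly !at_conic_poly.
  apply: contrapT => /eqP nz0.
  have iG : iota (G u) != 0 by rewrite fmorph_eq0.
  have [z' hG] := linepoly_nonzeroM lh lG hz iG.
  have [l [u1 [w1 [refl + u10 w10 e]]]] := integral_pair Bv (linepolyM lh lG) hG rel.
  rewrite mulf_eq0 negb_or fmorph_eq0 => /andP[hu Gu].
  have [k k0 [e1 e2]] := act _ _ _ refl u10 w10 hu.
  case/eqP: Gu; rewrite !at_cform_H e1 e2 !HZ in e.
  apply: (mulfI (expf_neq0 m k0)); rewrite mulr0 /G /E.
  by apply/eqP; rewrite mulrBr subr_eq0; apply/eqP; rewrite mulrCA e mulrA.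
(* So far [E] vanishes at the pairs of values of [q1] and [q2], which need not be all pairs. On a
   line starting at [c], where [q1] vanishes and [q2] does not, the products of powers are
   independent, so every coefficient of [ep] is zero. *)
have [x0 q1x] := polar_diag_neq0 (isP.2 _ q1P) q10.
pose p := line_poly c (x0 - c) (conic_poly q1); pose q := line_poly c (x0 - c) (conic_poly q2).
have p0' : p != 0 by apply: generic_vec; rewrite at_conic_poly.
have pz : p.[0] = 0 by rewrite horner_line_poly scale0r addr0 at_conic_poly.
have qz : q.[0] != 0 by rewrite horner_line_poly scale0r addr0 at_conic_poly.
have q0 : q != 0 by apply: contraNneq qz => ->; rewrite horner0.
have ep_rel : \sum_(i < (m + m).+1) ep`_i *: (p ^+ i * q ^+ (m + m - i)) = 0.
  apply: (mulIf q0); rewrite mul0r; apply: poly_eq0_all => s; rewrite rootE hornerM.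
  have [->|qs] := eqVneq q.[s] 0; first by rewrite mulr0.
  rewrite mulf_eq0 (negPf qs) orbF.
  suff -> : (\sum_(i < (m + m).+1) ep`_i *: (p ^+ i * q ^+ (m + m - i))).[s] = E p.[s] q.[s].
    by rewrite !horner_line_poly !at_conic_poly Ezero.
  rewrite Eratio // (horner_coef_wide _ sz) horner_sum mulr_sumr; apply: eq_bigr => i _.
  rewrite hornerZ hornerM !horner_exp expr_div_n.
  have -> : q.[s] ^+ (m + m) = q.[s] ^+ (m + m - i) * q.[s] ^+ i.
    by rewrite -exprD subnK ?leq_ord.
  have := expf_neq0 i qs; move: (q.[s] ^+ i) (q.[s] ^+ _) (p.[s] ^+ i) (ep`_i) => x3 x4 x5 x6 x30.
  by field.
apply/polyP => i; rewrite poly.coef0; have [im|im] := leqP i (m + m).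
  exact: (form_poly_zero (a := fun i => ep`_i) p0' pz qz ep_rel).
by rewrite nth_default // (leq_trans sz).
Qed.

(** An invertible fractional linear substitution with cleared denominators keeps a nonzero
    polynomial nonzero. *)
Lemma HP_linear_neq0 al be ga de : al * de - be * ga != 0 ->
  HP b (al *: 'X + be%:P) (ga *: 'X + de%:P) != 0.
Proof.
move=> det; have l0 : al%:P - ga *: 'X != 0 :> {poly F}.
  apply: contraNneq det => e.
  have e0 := congr1 (horner^~ 0) e; have e1 := congr1 (horner^~ 1) e; move: e0 e1.
  rewrite /= !horner_simp mulr0 subr0 => -> /eqP; rewrite sub0r oppr_eq0 mulr1 => /eqP ->.
  by rewrite mul0r mulr0 subrr.
have [t] := poly_neq0_value (mulf_neq0 pb_neq0 l0).
rewrite !horner_simp mulf_eq0 negb_or => /andP[bt lt].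
(* The preimage of [t] under the substitution. *)
pose s := (de * t - be) / (al - ga * t).
have e2 : ga * s + de = (al * de - be * ga) / (al - ga * t) by rewrite /s; field.
have l2 : ga * s + de != 0 by rewrite e2 mulf_neq0 ?invr_eq0.
apply: contraNneq bt => e; have := congr1 (horner^~ s) e.
rewrite /= horner_HP !horner_simp (H_ratio _ _ l2) -HP_X1 -/pb.
have -> : (al * s + be) / (ga * s + de) = t by rewrite e2 /s; field; rewrite lt.
by move/eqP; rewrite mulf_eq0 expf_eq0 (negPf l2) andbF.
Qed.

(** The ratios of ordered pairs from [1], [n] and [- (n + 1)], three numbers with sum zero, in
    increasing order. *)
Lemma orbit_uniq (n : F) : 1 < n ->
  uniq [:: - (n + 1); - (n + 1) / n; n / - (n + 1); 1 / - (n + 1); 1 / n; n].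
Proof.
move=> n1; have n0 : 0 < n by rewrite (Order.POrderTheory.lt_trans ltr01).
have N0 : 0 < n + 1 by rewrite addr_gt0.
have Nn : n < n + 1 by rewrite ltrDl.
apply: Order.POrderTheory.lt_sorted_uniq; rewrite /= andbT !mulNr !invrN !mulrN !mul1r !ltrN2.
have lt := Order.POrderTheory.lt_trans.
have n0' : n != 0 by rewrite lt0r_neq0.
have N0' : n + 1 != 0 by rewrite lt0r_neq0.
apply/and5P; split.
- by rewrite ltr_pdivrMr // ltr_pMr.
- by apply: (lt _ _ 1); rewrite ?ltr_pdivrMr ?ltr_pdivlMr ?mul1r.
- by rewrite ltr_pdivlMr // mulVf.
- by apply: (lt _ _ 0); rewrite ?oppr_lt0 ?invr_gt0.
- by apply: (lt _ _ 1); rewrite // invf_lt1.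
Qed.

(** The two substitutions generate the permutations of [x], [y], [- x - y]; on
    the line of conics the orbit of a general point has six elements. *)
Lemma six_values : (d < 12)%N ->
  (forall x y : F, y != 0 -> H a x y * H b x (- x - y) = H a x (- x - y) * H b x y) ->
  (forall x y : F, y != 0 -> H a x y * H b (- x - y) y = H a (- x - y) y * H b x y) ->
  False.
Proof.
move=> d12 inv1 inv2; have [[_ _ D0] _ ND _ _] := intND.
have lin (al be ga de : F) (det : al * de - be * ga != 0) := HP_linear_neq0 det.
have n11 : 1 * 0 - 0 * 1 = 0 :> F by rewrite mul0r mulr0 subrr.
pose Z : {poly F} := -1 *: 'X + (-1)%:P.
(* Denominators at the orbit points (n, 1), (n, z), (1, z) and (z, 1), with z = - n - 1, from which
   the relation is carried to the next point. *)
have f1 : HP b (1 *: 'X + 0%:P) (0 *: 'X + 1%:P) != 0.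
  by apply: lin; rewrite mulr1 mulr0 subr0 oner_eq0.
have f2 : HP b (1 *: 'X + 0%:P) (-1 *: 'X + (-1)%:P) != 0.
  by apply: lin; rewrite mul1r mul0r subr0 oppr_eq0 oner_eq0.
have f3 : HP b (0 *: 'X + 1%:P) (-1 *: 'X + (-1)%:P) != 0.
  by apply: lin; rewrite mul0r mul1r sub0r opprK oner_eq0.
have f4 : HP b (-1 *: 'X + (-1)%:P) (0 *: 'X + 1%:P) != 0.
  by apply: lin; rewrite mulr1 mulr0 subr0 oppr_eq0 oner_eq0.
have inj : injective (fun k => k.+2%:R : F).
  by move=> i j /eqP; rewrite eqr_nat => /eqP[].
have [n n1] : exists2 n : F, 1 < n & ((HP b (1 *: 'X + 0%:P) (0 *: 'X + 1%:P)
    * HP b (1 *: 'X + 0%:P) (-1 *: 'X + (-1)%:P)) * (HP b (0 *: 'X + 1%:P) (-1 *: 'X + (-1)%:P)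
    * HP b (-1 *: 'X + (-1)%:P) (0 *: 'X + 1%:P))).[n] != 0.
  have [k hk] := nonroot_seq (K := F) idfun inj (mulf_neq0 (mulf_neq0 f1 f2) (mulf_neq0 f3 f4)).
  by exists k.+2%:R; rewrite ?ltr1n.
pose z := - (n + 1).
rewrite !hornerM !horner_HP !horner_simp !(mul0r, mul1r, mulN1r, add0r, addr0).
have zE : - n - 1 = z by rewrite /z opprD.
rewrite zE !mulf_eq0 !negb_or => /andP[/andP[b1 b2] /andP[b3 b4]].
have n0 : n != 0 by rewrite lt0r_neq0 // (Order.POrderTheory.lt_trans ltr01).
have z0 : z != 0.
  by rewrite oppr_eq0 lt0r_neq0 // addr_gt0 // (Order.POrderTheory.lt_trans ltr01).
pose c0 := H a n 1 / H b n 1.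
have h1 : H a n 1 = c0 * H b n 1 by rewrite divfK.
have step x y x' y' : H b x y != 0 -> H a x y * H b x' y' = H a x' y' * H b x y ->
  H a x y = c0 * H b x y -> H a x' y' = c0 * H b x' y'.
  move=> bxy e h; apply: (mulIf bxy); rewrite -e h; ring.
have h2 : H a n z = c0 * H b n z.
  by apply: step b1 _ h1; rewrite -zE; apply: inv1; rewrite oner_eq0.
have h3 : H a 1 z = c0 * H b 1 z.
  by apply: step b2 _ h2; have := inv2 n z z0; rewrite (_ : - n - z = 1) // /z; ring.
have h4 : H a 1 n = c0 * H b 1 n.
  by apply: step b3 _ h3; have := inv1 1 z z0; rewrite (_ : - 1 - z = n) // /z; ring.
have h5 : H a z 1 = c0 * H b z 1.
  by apply: step b1 _ h1; rewrite -zE; apply: inv2; rewrite oner_eq0.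
have h6 : H a z n = c0 * H b z n.
  apply: step b4 _ h5; have := inv1 z 1; rewrite (_ : - z - 1 = n) ?oner_eq0; last by rewrite /z; ring.
  exact.
have root x y : y != 0 -> H a x y = c0 * H b x y -> root (pa - c0 *: pb) (x / y).
  move=> y0 e; rewrite rootE !(hornerD, hornerN, hornerZ) !HP_X1 subr_eq0.
  move: e; rewrite !(H_ratio _ _ y0) mulrCA => e; apply/eqP.
  exact: (mulfI (expf_neq0 m y0)).
(* From d < 12 the degree is at most 5, while the numerator minus [c0] times the denominator has six
   roots. *)
have sz e : (size (HP e 'X 1) <= 6)%N.
  apply: (leq_trans (size_HP _ _ _)); rewrite ?size_polyX ?size_poly1 //.
  by rewrite /m; move: d12; clear; lia.
have pab : pa = c0 *: pb.
  apply/eqP; rewrite -subr_eq0; apply: contraT => p0'.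
  have r1 := root _ _ z0 h2; have r2 := root _ _ z0 h3; have r3 := root _ _ n0 h4.
  have r4 := root _ _ n0 h6; have r5 := root _ _ (oner_neq0 _) h1.
  have r6 := root _ _ (oner_neq0 _) h5; rewrite !divr1 in r5 r6.
  have := max_poly_roots p0' (_ : all (poly.root _) _) (orbit_uniq n1).
  rewrite /= r1 r2 r3 r4 r5 r6 => /(_ isT); rewrite ltnNge.
  by rewrite (leq_trans (size_polyD _ _)) // geq_max size_polyN !(sz, leq_trans (size_scale_leq _ _)).
have ca : cform a = c0 *: cform b.
  have e : HP a 'X 1 = HP (fun i => c0 * b i) 'X 1.
    by rewrite -/pa pab /pb /HP scaler_sumr; apply: eq_bigr => i _; rewrite scalerA.
  rewrite (cform_eq_of_ratio e) /conic_form scaler_sumr.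
  by apply: eq_bigr => i _; rewrite scalerA.
have cb : cform b != 0.
  have [x0 [x00 x02]] := conic_point_off sS0 rS0 sS2 S2n pp0 on0.
  apply: contraNneq pb_neq0 => /(conic_form_eq0 S0_neq0 sS0 x00 x02) b0.
  by apply/eqP; rewrite /pb /HP big1 // => i _; rewrite b0 scale0r.
apply: (ND c0); apply: (mulfI cb); apply/eqP; rewrite -subr_eq0; apply/eqP/at_vec_eq0 => u.
by rewrite at_vecB !at_vecM rel ca -!at_vecM -scalerAl -scalerAr subrr.
Qed.

End SixValues.

(** Being multiples of [r1] and [r2] by one factor [kap], the conics [q1] and [q2] are acted on as
    (x, y) |-> (x, - x - y) and (- x - y, y), up to common factors; these are the two substitutions
    of the orbit argument. *)
Lemma degree_ge12 (v1 v2 : vertex F) (w1 w2 : vertex K) r1 r2 r3 q1 q2 kap c :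
  vertices B v1 -> vertices B v2 ->
  vertex_complexification iota v1 w1 -> vertex_complexification iota v2 w2 ->
  r3 = - r1 - r2 -> transposes r1 r2 r3 w1 -> transposes r2 r1 r3 w2 ->
  q1 \in P -> q2 \in P -> kap != 0 -> cx q1 = kap *: r1 -> cx q2 = kap *: r2 ->
  polar_form q1 c c = 0 -> polar_form q2 c c != 0 -> r1 != 0 -> r2 != 0 ->
  (12 <= d)%N.
Proof.
move=> Bv1 Bv2 vw1 vw2 er3 t1 t2 q1P q2P kap0 e1 e2 q1c q2c r10 r20.
rewrite leqNgt; apply/negP => d12.
have nzq (q : 'M[F]_3) (r : 'M[K]_3) : cx q = kap *: r -> r != 0 -> q != 0.
  by move=> e r0; rewrite -(cx_eq0 iota) e scaler_eq0 negb_or kap0.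
have q10 := nzq _ _ e1 r10; have q20 := nzq _ _ e2 r20.
have q21 : q2 \notin <[q1]>%VS.
  by apply: contra q2c => /vlineP[s ->]; rewrite polarE q1c mulr0.
have [x1 [y1 S0E]] := pencil_span isP.1 q1P q2P q10 q21 S0P.
have [x2 [y2 S2E]] := pencil_span isP.1 q1P q2P q10 q21 S2P.
have [a [b [nz rel]]] := integral_form.
have value (q : 'M[F]_3) (r : 'M[K]_3) : cx q = kap *: r -> forall u, iota (polar_form q u u) = kap * polar_form r (cx u) (cx u).
  by move=> e u; rewrite -polar_cx e polarE.
have V1 := value _ _ e1; have V2 := value _ _ e2.
have inv q : q != 0 -> q \in P -> exists z, polar_form (cx q) (cx z) (cx z) != 0.
  move=> q0 qP; have [z hz] := polar_diag_neq0 (isP.2 _ qP) q0.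
  by exists z; rewrite polar_cx fmorph_eq0.
(* The multiplier [- k] is real because the vertex preserves the conic [q]. *)
have real q q' r r' k u w : (forall u, iota (polar_form q u u) = kap * polar_form r (cx u) (cx u)) ->
    (forall u, iota (polar_form q' u u) = kap * polar_form r' (cx u) (cx u)) ->
    polar_form (cx q) (cx u) (cx u) != 0 -> k != 0 ->
    polar_form r (cx w) (cx w) = - k * polar_form r (cx u) (cx u) ->
    polar_form r' (cx w) (cx w) = - k * (- polar_form r (cx u) (cx u) - polar_form r' (cx u) (cx u)) ->
  exists2 k', k' != 0 & polar_form q w w = k' * polar_form q u u /\
    polar_form q' w w = k' * (- polar_form q u u - polar_form q' u u).
  move=> V V'; rewrite polar_cx fmorph_eq0 => qu k0 f1 f2.
  have ek : iota (polar_form q w w / polar_form q u u) = - k.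
    rewrite fmorph_div !V f1; field.
    by have := qu; rewrite -(fmorph_eq0 iota) V mulf_eq0 negb_or andbC.
  exists (polar_form q w w / polar_form q u u).
    by rewrite -(fmorph_eq0 iota) ek oppr_eq0.
  split; first by rewrite divfK.
  apply: (fmorph_inj iota); rewrite rmorphM ek rmorphB rmorphN V V' V' f2; ring.
have [z1 h1] := inv _ q10 q1P; have [z2 h2] := inv _ q20 q2P.
have refl v w l u u' : vertex_complexification iota v w -> reflect_on v l <[u]>%VS <[u']>%VS ->
  reflect_on w (complexify iota l) <[cx u]>%VS <[cx u']>%VS.
  move=> vw rf; have [] := vertex_complexification_pair vw rf (memv_line u) (memv_line u').
  by rewrite !complexify_line.
apply: (six_values S0E S2E q2c nz rel d12) => x y y0.
  have := substitution_invariant q1P q10 S0E S2E q1c q2c rel (al := 1) (be := 0) (ga := -1)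
    (de := -1) Bv1 (linepoly_polar iota _) h1 _ x y0.
  rewrite !(mul1r, mul0r, addr0, mulN1r) -opprD opprD; apply.
  move=> l u w rf u0 w0 hu; rewrite mul1r mul0r addr0 !mulN1r.
  have cu0 : cx u != 0 by rewrite cx_eq0.
  have cw0 : cx w != 0 by rewrite cx_eq0.
  have [k k0 [f1 f2 f3]] := t1 _ _ _ _ _ (refl _ _ _ _ _ vw1 rf) (memv_line _) (memv_line _) cu0 cw0.
  apply: (real _ _ _ _ _ _ _ V1 V2 hu k0 f1).
  by rewrite f2 er3 !polarE.
have := substitution_invariant q1P q10 S0E S2E q1c q2c rel (al := -1) (be := -1) (ga := 0)
  (de := 1) Bv2 (linepoly_polar iota _) h2 _ x y0.
rewrite !(mul1r, mul0r, add0r, mulN1r) -opprD opprD; apply.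
move=> l u w rf u0 w0 hu; rewrite mul1r mul0r add0r !mulN1r.
have cu0 : cx u != 0 by rewrite cx_eq0.
have cw0 : cx w != 0 by rewrite cx_eq0.
have [k k0 [f1 f2 f3]] := t2 _ _ _ _ _ (refl _ _ _ _ _ vw2 rf) (memv_line _) (memv_line _) cu0 cw0.
have f2' : polar_form r1 (cx w) (cx w)
    = - k * (- polar_form r2 (cx u) (cx u) - polar_form r1 (cx u) (cx u)).
  by rewrite f2 er3 !polarE; ring.
have [k' k'0 [g1 g2]] := real _ _ _ _ _ _ _ V2 V1 hu k0 f1 f2'.
by exists k' => //; rewrite g1 g2; split=> //; ring.
Qed.

End LowerBounds.

(** * Integrals of minimal degree *)

Section CoprimeForms.
Local Open Scope ring_scope.
Variable F : fieldType.
Implicit Types x y : {poly F}.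

Lemma coprimep_basis x y a b c d :
  coprimep (a *: x + b *: y) (c *: x + d *: y) -> coprimep x y.
Proof.
move=> /coprimepP h; apply/coprimepP => e ex ey.
have lin s t : e %| s *: x + t *: y by rewrite -!mul_polyC dvdp_add ?dvdp_mull.
exact: h (lin _ _) (lin _ _).
Qed.

Lemma coprimep_product_squares x y a c : a != 0 -> c != 0 -> coprimep x y ->
  coprimep (x * y) (a *: x ^+ 2 - c *: y ^+ 2).
Proof.
move=> a0 c0 xy; rewrite coprimepMl; apply/andP; split.
  rewrite expr2 scalerAl coprimep_addl_mul -scaleNr coprimepZr ?oppr_eq0 //.
  exact: coprimep_expr.
rewrite addrC -scaleNr [y ^+ 2]expr2 scalerAl coprimep_addl_mul coprimepZr //.
by rewrite coprimep_expr // coprimep_sym.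
Qed.

(** For z = - x - y these are powers of - e_2 and - e_3 in x, y, z. *)
Lemma coprimep_symmetric_forms x y : coprimep x y ->
  coprimep ((x ^+ 2 + x * y + y ^+ 2) ^+ 3) ((x * y * (x + y)) ^+ 2).
Proof.
move=> xy; apply: coprimep_expl; apply: coprimep_expr.
rewrite coprimep_sym !coprimepMl; apply/andP; split; first (apply/andP; split).
- have -> : x ^+ 2 + x * y + y ^+ 2 = (x + y) * x + y ^+ 2 by ring.
  by rewrite coprimep_addl_mul coprimep_expr.
- have -> : x ^+ 2 + x * y + y ^+ 2 = (x + y) * y + x ^+ 2 by ring.
  by rewrite coprimep_addl_mul coprimep_expr // coprimep_sym.
have -> : x ^+ 2 + x * y + y ^+ 2 = x * (x + y) + y ^+ 2 by ring.
rewrite coprimep_addl_mul coprimep_expr // coprimep_sym -(mul1r y) -{1}(mul1r x).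
have := coprimep_addl_mul 1 x y; rewrite coprimep_sym.
by rewrite !mul1r addrC coprimep_sym => ->; rewrite coprimep_sym.
Qed.

End CoprimeForms.

Section Forms.
Local Open Scope ring_scope.
Variable F : numFieldType.
Local Notation vec := 'rV[F]_3.

Lemma line_polyM u e (N D : {mpoly F[3]}) : line_poly u e (N * D) = line_poly u e N * line_poly u e D.
Proof. exact: rmorphM. Qed.
Lemma line_polyD u e (N D : {mpoly F[3]}) : line_poly u e (N + D) = line_poly u e N + line_poly u e D.
Proof. exact: rmorphD. Qed.
Lemma line_polyB u e (N D : {mpoly F[3]}) : line_poly u e (N - D) = line_poly u e N - line_poly u e D.
Proof. exact: rmorphB. Qed.
Lemma line_polyX u e (N : {mpoly F[3]}) k : line_poly u e (N ^+ k) = line_poly u e N ^+ k.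
Proof. exact: rmorphXn. Qed.
Lemma line_polyZ u e (N : {mpoly F[3]}) c : line_poly u e (c *: N) = c *: line_poly u e N.
Proof. by rewrite /line_poly -mul_mpolyC rmorphM /= mmapC mul_polyC. Qed.

Lemma conic_poly_lin a S b T :
  conic_poly (a *: S + b *: T) = a *: conic_poly S + b *: conic_poly T :> {mpoly F[3]}.
Proof.
apply/eqP; rewrite -subr_eq0; apply/eqP/at_vec_eq0 => u.
by rewrite at_vecB at_vecD !at_vecZl !at_conic_poly !polarE subrr.
Qed.

Lemma cross_scale (x y x' y' : F) : x * y' = x' * y ->
  (x = 0 /\ y = 0) \/ exists t, x' = t * x /\ y' = t * y.
Proof.
move=> e; have [x0|x0] := eqVneq x 0.
  have [y0|y0] := eqVneq y 0; first by left.
  right; exists (y' / y); rewrite x0 mulr0 divfK //; split=> //.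
  by move: e; rewrite x0 mul0r => /esym/eqP; rewrite mulf_eq0 (negPf y0) orbF => /eqP.
by right; exists (x' / x); rewrite divfK // mulrAC -e; split=> //; field.
Qed.

End Forms.

Section UpperBounds.
Local Open Scope ring_scope.
Variables (F K : numFieldType) (iota : {rmorphism F -> K}).
Local Notation vec := 'rV[F]_3.
Local Notation cx := (map_mx iota).
Variables (P : {vspace 'M[F]_3}) (B : multibilliard F).
Local Notation PC := (complexify iota P).
Hypothesis isP : is_pencil P.
Hypothesis mB : is_dual_multibilliard B.
Hypothesis cB : forall g, curves B g -> pencil_billiard iota P g.
Hypothesis vB : forall v, vertices B v ->
  exists2 w, vertex_complexification iota v w & admissible_vertex PC w.
Variables (S0 S2 : 'M[F]_3) (p0 : {vspace vec}).
Hypothesis (S0P : S0 \in P) (rS0 : regular S0) (S2P : S2 \in P) (S2n : S2 \notin <[S0]>%VS).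
Hypothesis (pp0 : is_point p0) (on0 : on_conic S0 p0).

(** [u] and [w] lie on the same conic of the pencil; curves and standard vertices exchange only such
    points. *)
Definition cross_pair (u w : vec) := forall S T, S \in P -> T \in P ->
  polar_form S u u * polar_form T w w = polar_form S w w * polar_form T u u.

Definition skew_pair (u w : vec) := exists v z l x y,
  [/\ vertices B v, vertex_complexification iota v z, skew_vertex PC z,
      reflect_on v l x y & [/\ u \in x, w \in y, u != 0 & w != 0]].

Lemma complexified_pencil : is_pencil PC.
Proof. by have [] := complexify_pencil iota isP S0P S2P (S0_neq0 rS0) S2n. Qed.

Lemma standard_cross v z l x y u w : vertices B v -> vertex_complexification iota v z ->
  standard_vertex PC z -> reflect_on v l x y -> u \in x -> w \in y -> cross_pair u w.
Proof.
move=> Bv vz st rf ux wy S T SP TP.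
have [->|u0] := eqVneq u 0; first by rewrite !polar0l mul0r mulr0.
have [->|w0] := eqVneq w 0; first by rewrite !polar0l mul0r mulr0.
have [rz cu cw] := vertex_complexification_pair vz rf ux wy.
have cu0 : cx u != 0 by rewrite cx_eq0.
have cw0 : cx w != 0 by rewrite cx_eq0.
have pz := center_is_point (mB.2 _ Bv) vz.
have [k _ e] := standard_preserving complexified_pencil pz st rz cu cw cu0 cw0.
apply: (fmorph_inj iota); rewrite !rmorphM -!polar_cx !e ?mem_complexify //; ring.
Qed.

(** Curves and standard vertices only exchange points of one conic, so invariance has to be checked
    on two kinds of pairs. Coprimality also excludes constants: for N = c D the form D would be a
    unit, although it vanishes at the origin. *)
Lemma rational_integral_intro d N D : (0 < d)%N -> N \is d.-homog -> D \is d.-homog ->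
  (forall u e, coprimep (line_poly u e (conic_poly S0)) (line_poly u e (conic_poly S2)) ->
     coprimep (line_poly u e N) (line_poly u e D)) ->
  (forall u w, cross_pair u w \/ skew_pair u w ->
     at_vec N u * at_vec D w = at_vec N w * at_vec D u) ->
  rational_integral B d N D.
Proof.
move=> d0 hN hD cop inv.
have cop' := pencil_coprime (isP.2 _ S0P) rS0 (isP.2 _ S2P) S2n pp0 on0 cop.
have hom0 (G : {mpoly F[3]}) : G \is d.-homog -> at_vec G 0 = 0.
  by move=> hG; rewrite -[X in at_vec _ X](scale0r 0) (at_vecZ _ _ hG) expr0n eqn0Ngt d0 mul0r.
have unit0 (G : {mpoly F[3]}) : G \is d.-homog -> G \isn't a GRing.unit.
  move=> hG; apply/negP => uG; have := at_vecM G G^-1 0.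
  rewrite (hom0 _ hG) mul0r mulrV // /at_vec meval1 => /eqP; exact/negP/oner_neq0.
have D0 : D != 0.
  apply: contraTneq (unit0 _ hN) => D0; rewrite negbK.
  by apply: (cop' N 1 0); rewrite ?mulr1 ?mulr0.
split=> //.
- move=> c e; have := unit0 _ hD; rewrite (cop' D c%:MP 1) ?mulr1 //.
  by rewrite mulrC mul_mpolyC.
- move=> g Bg p x y ixy u w ux wy; apply: inv; left => S T SP TP.
  exact: pencil_billiard_pair (cB Bg) ixy ux wy SP TP.
move=> v Bv l x y rf u w ux wy; apply: inv.
have [z vz [st|sk]] := vB Bv; first by left; apply: standard_cross Bv vz st rf ux wy.
have [->|u0] := eqVneq u 0; first by left=> S T _ _; rewrite !polar0l mul0r mulr0.
have [->|w0] := eqVneq w 0; first by left=> S T _ _; rewrite !polar0l mul0r mulr0.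
by right; exists v, z, l, x, y.
Qed.

Lemma integral_degree2 : (forall u w, ~ skew_pair u w) ->
  exists N D, rational_integral B 2 N D.
Proof.
move=> nsk; exists (conic_poly S0), (conic_poly S2).
apply: rational_integral_intro; rewrite ?conic_poly_homog // => u w [cr|/nsk//].
by rewrite !at_conic_poly cr.
Qed.

Lemma basis_coprime q1 q2 u e : q1 \in P -> q2 \in P -> q1 != 0 -> q2 \notin <[q1]>%VS ->
  coprimep (line_poly u e (conic_poly S0)) (line_poly u e (conic_poly S2)) ->
  coprimep (line_poly u e (conic_poly q1)) (line_poly u e (conic_poly q2)).
Proof.
move=> q1P q2P q10 q21.
have [x1 [y1 ->]] := pencil_span isP.1 q1P q2P q10 q21 S0P.
have [x2 [y2 ->]] := pencil_span isP.1 q1P q2P q10 q21 S2P.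
by rewrite !conic_poly_lin !line_polyD !line_polyZ; apply: coprimep_basis.
Qed.

(** [N D' - N' D = (a q1 q1' + c q2 q2') (q2 q1' - q1 q2')] for
    [N = q1 q2] and [D = a q1^2 - c q2^2]. *)
Lemma integral_degree4 q1 q2 a c : q1 \in P -> q2 \in P -> q1 != 0 -> q2 \notin <[q1]>%VS ->
  a != 0 -> c != 0 ->
  (forall u w, skew_pair u w -> a * (polar_form q1 u u * polar_form q1 w w)
     + c * (polar_form q2 u u * polar_form q2 w w) = 0) ->
  exists N D, rational_integral B 4 N D.
Proof.
move=> q1P q2P q10 q21 a0 c0 rel.
exists (conic_poly q1 * conic_poly q2), (a *: conic_poly q1 ^+ 2 - c *: conic_poly q2 ^+ 2).
have h2 (q : 'M[F]_3) : conic_poly q ^+ 2 \is 4.-homog by exact: (dhomogMn 2 (conic_poly_homog q)).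
apply: rational_integral_intro => //.
- exact: (dhomogM (conic_poly_homog q1) (conic_poly_homog q2)).
- by rewrite rpredB ?rpredZ ?h2.
- move=> u e /(basis_coprime q1P q2P q10 q21) cop.
  rewrite line_polyM line_polyB !line_polyZ !line_polyX.
  exact: coprimep_product_squares.
move=> u w h; rewrite !at_vecM !at_vecB !at_vecZl !at_vecX !at_conic_poly.
set x := polar_form q1 u u; set y := polar_form q2 u u.
set x' := polar_form q1 w w; set y' := polar_form q2 w w.
have e : (a * (x * x') + c * (y * y')) * (y * x' - x * y') = 0.
  case: h => [cr|/rel ->]; last by rewrite mul0r.
  by rewrite [y * x']mulrC -(cr _ _ q1P q2P : x * y' = x' * y) subrr mulr0.
apply/eqP; rewrite -subr_eq0; apply/eqP.
by rewrite -[RHS]e; ring.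
Qed.

Lemma integral_degree12 q1 q2 : q1 \in P -> q2 \in P -> q1 != 0 -> q2 \notin <[q1]>%VS ->
  (forall u w, skew_pair u w -> let x := polar_form q1 u u in let y := polar_form q2 u u in
     let x' := polar_form q1 w w in let y' := polar_form q2 w w in
     (x ^+ 2 + x * y + y ^+ 2) ^+ 3 * (x' * y' * (x' + y')) ^+ 2
     = (x' ^+ 2 + x' * y' + y' ^+ 2) ^+ 3 * (x * y * (x + y)) ^+ 2) ->
  exists N D, rational_integral B 12 N D.
Proof.
move=> q1P q2P q10 q21 rel; pose X := conic_poly q1; pose Y := conic_poly q2.
exists ((X ^+ 2 + X * Y + Y ^+ 2) ^+ 3), ((X * Y * (X + Y)) ^+ 2).
have hX : X \is 2.-homog := conic_poly_homog q1.
have hY : Y \is 2.-homog := conic_poly_homog q2.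
apply: rational_integral_intro => //.
- apply: (dhomogMn (d := 4) 3); rewrite !rpredD //.
  + exact: (dhomogMn 2 hX).
  + exact: (dhomogM hX hY).
  + exact: (dhomogMn 2 hY).
- apply: (dhomogMn (d := 6) 2); apply: (dhomogM (d := 4) (e := 2)); last exact: rpredD.
  exact: (dhomogM hX hY).
- move=> u e /(basis_coprime q1P q2P q10 q21) cop.
  rewrite !(line_polyX, line_polyM, line_polyD).
  exact: coprimep_symmetric_forms.
move=> u w h; rewrite !(at_vecX, at_vecM, at_vecD) !at_conic_poly.
case: h => [cr|/rel //].
have [[-> ->]|[t [-> ->]]] := cross_scale (cr _ _ q1P q2P).
  by rewrite !(mul0r, mulr0, expr0n, addr0).
by ring.
Qed.

Local Notation W := (complex_vertices iota P B).

(** Provides a pair for which a degenerate relation, with only one of its two terms, fails. *)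
Lemma skew_pair_off q : q \in P -> q != 0 -> has_skew_vertex PC W ->
  exists u w, [/\ skew_pair u w, polar_form q u u != 0 & polar_form q w w != 0].
Proof.
move=> qP q0 [z [v [Bv vz _]] sk].
have [x qx] := polar_diag_neq0 (isP.2 _ qP) q0.
have gx : iota (at_vec (conic_poly q) x) != 0 by rewrite fmorph_eq0 at_conic_poly.
have [c [u [dl [_ + uc refl]]]] := vertex_line (mB.2 _ Bv) (linepoly_at_vec iota _) gx.
rewrite fmorph_eq0 => qu.
pose p := line_poly u c (conic_poly q); pose p' := line_poly (u - dl *: c) (- c) (conic_poly q).
have pE s : p.[s] = polar_form q (u + s *: c) (u + s *: c).
  by rewrite horner_line_poly at_conic_poly.
have p'E s : p'.[s] = polar_form q (u - (s + dl) *: c) (u - (s + dl) *: c).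
  rewrite horner_line_poly at_conic_poly.
  by have -> : u - dl *: c + s *: - c = u - (s + dl) *: c by vring.
have p0' : p != 0.
  apply: contraNneq qu => e; rewrite at_conic_poly.
  by have := pE 0; rewrite e horner0 scale0r addr0 => <-.
have p'0 : p' != 0.
  apply: contraNneq qu => e; rewrite at_conic_poly.
  by have := p'E (- dl); rewrite e horner0 addNr scale0r subr0 => <-.
have [s] := poly_neq0_value (mulf_neq0 p0' p'0).
rewrite hornerM mulf_eq0 negb_or => /andP[ps p's].
have nz t : u + t *: c != 0.
  by apply: contra uc; rewrite addr_eq0 => /eqP ->; rewrite -scaleNr memvZ ?memv_line.
exists (u + s *: c), (u - (s + dl) *: c); rewrite -pE -p'E; split=> //.
exists v, z, (<[c]> + <[u]>)%VS, <[u + s *: c]>%VS, <[u - (s + dl) *: c]>%VS.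
by split=> //; split; rewrite ?memv_line // -scaleNr nz.
Qed.

Lemma pencil_basis (al be ga de : F) : al * de - be * ga != 0 ->
  al *: S0 + be *: S2 != 0 /\ ga *: S0 + de *: S2 \notin <[al *: S0 + be *: S2]>%VS.
Proof.
move=> det.
have ind x y : x *: S0 + y *: S2 = 0 -> x = 0 /\ y = 0.
  move=> e; have y0 : y = 0.
    apply/eqP; apply: contraNT S2n => y0; apply/vlineP; exists (- (y^-1 * x)).
    rewrite scaleNr -scalerA; apply/eqP; rewrite -addr_eq0 addrC -[S2 in X in _ + X]scale1r.
    by rewrite -(mulVf y0) -scalerA -scalerDr e scaler0.
  split=> //; apply/eqP; move/eqP: e; rewrite y0 scale0r addr0 scaler_eq0.
  by rewrite (negPf (S0_neq0 rS0)) orbF.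
split.
  apply: contraNneq det => /ind[-> ->]; by rewrite !mul0r subrr.
apply: contraNN det => /vlineP[k e]; have /ind[g d] : (ga - k * al) *: S0 + (de - k * be) *: S2 = 0.
  by rewrite !scalerBl -!scalerA addrACA -opprD -scalerDr e subrr.
move/subr0_eq: g => ->; move/subr0_eq: d => ->.
by apply/eqP; ring.
Qed.

(** A symmetric bilinear relation between the parameters of exchanged conics is diagonalized by
    completing the square, or by sum and difference when both squares are absent. Unlike the fixed
    conics of the involution, which may be complex conjugate, a diagonal basis exists over the
    ground field. *)
Lemma diagonal_relation (c1 c2 c3 : F) : [|| c1 != 0, c2 != 0 | c3 != 0] ->
  exists q1 q2 a c, [/\ q1 \in P /\ q2 \in P, q1 != 0, q2 \notin <[q1]>%VS, (a != 0) || (c != 0) &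
   forall u w, c1 * (polar_form S0 u u * polar_form S0 w w)
     + c2 * (polar_form S0 u u * polar_form S2 w w + polar_form S2 u u * polar_form S0 w w)
     + c3 * (polar_form S2 u u * polar_form S2 w w) = 0 ->
     a * (polar_form q1 u u * polar_form q1 w w) + c * (polar_form q2 u u * polar_form q2 w w) = 0].
Proof.
have inP x y : x *: S0 + y *: S2 \in P by rewrite memvD ?memvZ.
have [c10|c10] := eqVneq c1 0; last first.
  move=> _; have [] := pencil_basis (al := 1) (be := c2 / c1) (ga := 0) (de := 1).
    by rewrite mulr1 mulr0 subr0 oner_neq0.
  move=> n1 n2; exists (1 *: S0 + (c2 / c1) *: S2), (0 *: S0 + 1 *: S2), c1, (c3 - c2 ^+ 2 / c1).
  split; rewrite ?c10 //; move=> u w e; rewrite !polarE -[RHS]e; field.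
  exact: c10.
have [c30|c30] := eqVneq c3 0; last first.
  move=> _; have [] := pencil_basis (al := c2 / c3) (be := 1) (ga := 1) (de := 0).
    by rewrite mulr0 sub0r mulr1 oppr_eq0 oner_neq0.
  move=> n1 n2; exists ((c2 / c3) *: S0 + 1 *: S2), (1 *: S0 + 0 *: S2), c3, (- (c2 ^+ 2 / c3)).
  split; rewrite ?c30 //; move=> u w e; rewrite !polarE -[RHS]e c10; field.
  exact: c30.
rewrite /= orbF => c20; have [] := pencil_basis (al := 1) (be := 1) (ga := 1) (de := -1).
  by rewrite mulr1 mul1r -opprD oppr_eq0 -[1 + 1]/(2%:R) pnatr_eq0.
move=> n1 n2; exists (1 *: S0 + 1 *: S2), (1 *: S0 + -1 *: S2), 1, (-1).
split; rewrite ?oner_neq0 // => u w; rewrite c10 c30 !mul0r addr0 add0r => /eqP.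
rewrite mulf_eq0 (negPf c20) /= => /eqP e; rewrite !polarE.
set x := polar_form S0 u u in e *; set y := polar_form S2 u u in e *.
set x' := polar_form S0 w w in e *; set y' := polar_form S2 w w in e *.
transitivity (2 * (x * y' + y * x')); first by ring.
by rewrite e mulr0.
Qed.

(** The last hypothesis replaces a linear relation over K between elements of F by a nontrivial one
    over F. *)
Lemma skew_integral Qm Qp : conic_pair PC Qm Qp ->
  (forall w, W w -> skew_vertex PC w -> reversing Qm Qp w) -> has_skew_vertex PC W ->
  (forall b1 b2 b3 : K, [|| b1 != 0, b2 != 0 | b3 != 0] ->
     exists c1 c2 c3 : F, [|| c1 != 0, c2 != 0 | c3 != 0] /\
     forall x1 x2 x3, b1 * iota x1 + b2 * iota x2 + b3 * iota x3 = 0 ->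
       c1 * x1 + c2 * x2 + c3 * x3 = 0) ->
  exists N D, rational_integral B 4 N D.
Proof.
move=> [QmP QpP Qm0 Qpm] rev hsk desc.
have [_ cP] := complexify_pencil iota isP S0P S2P (S0_neq0 rS0) S2n.
have [m1 [m2 em]] := cP _ QmP; have [n1 [n2 en]] := cP _ QpP.
have Qp0 : Qp != 0 by apply: contraNneq Qpm => ->; rewrite mem0v.
(* The coefficients, in the basis [S0], [S2], of the relation Qm(u) Qp(w) + Qm(w) Qp(u) = 0 between
   exchanged points. *)
have [|c1 [c2 [c3 [nz rel]]]] := desc (2 * (m1 * n1)) (m1 * n2 + m2 * n1) (2 * (m2 * n2)).
  rewrite !mulf_eq0 pnatr_eq0 /=.
  have [m10|m10] := eqVneq m1 0; have [n10|n10] := eqVneq n1 0 => //=.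
  - have m20 : m2 != 0 by apply: contraNneq Qm0 => m20; rewrite em m10 m20 !scale0r addr0.
    have n20 : n2 != 0 by apply: contraNneq Qp0 => n20; rewrite en n10 n20 !scale0r addr0.
    by rewrite (negPf m20) (negPf n20) orbT.
  - have m20 : m2 != 0 by apply: contraNneq Qm0 => m20; rewrite em m10 m20 !scale0r addr0.
    by rewrite m10 mul0r add0r mulf_eq0 (negPf m20) (negPf n10).
  - have n20 : n2 != 0 by apply: contraNneq Qp0 => n20; rewrite en n10 n20 !scale0r addr0.
    by rewrite n10 mulr0 addr0 mulf_eq0 (negPf m10) (negPf n20).
have [q1 [q2 [a [c [[q1P q2P] q10 q21 ac diag]]]]] := diagonal_relation nz.
have relq u w : skew_pair u w -> a * (polar_form q1 u u * polar_form q1 w w)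
    + c * (polar_form q2 u u * polar_form q2 w w) = 0.
  move=> [v [z [l [x [y [Bv vz sk rf [ux wy u0 w0]]]]]]]; apply/diag/rel.
  have Wz : W z by exists v; split=> //; right.
  have [rz cu cw] := vertex_complexification_pair vz rf ux wy.
  have cu0 : cx u != 0 by rewrite cx_eq0.
  have cw0 : cx w != 0 by rewrite cx_eq0.
  have [k _ [e1 e2]] := rev _ Wz sk _ _ _ _ _ rz cu cw cu0 cw0.
  have e : polar_form Qm (cx u) (cx u) * polar_form Qp (cx w) (cx w)
    + polar_form Qm (cx w) (cx w) * polar_form Qp (cx u) (cx u) = 0 by rewrite e1 e2; ring.
  by move: e; rewrite em en !polarE !polar_cx !(rmorphM, rmorphD) => e; rewrite -[RHS]e; ring.
have q20 : q2 != 0 by apply: contraNneq q21 => ->; rewrite mem0v.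
apply: (integral_degree4 q1P q2P q10 q21 _ _ relq).
  apply: contraTneq ac => a0; rewrite a0 eqxx negbK /=.
  have [u [w [/relq + q2u q2w]]] := skew_pair_off q2P q20 hsk.
  by rewrite a0 mul0r add0r => /eqP; rewrite !mulf_eq0 (negPf q2u) (negPf q2w) !orbF.
apply: contraTneq ac => c0; rewrite c0 eqxx orbF negbK /=.
have [u [w [/relq + q1u q1w]]] := skew_pair_off q1P q10 hsk.
by rewrite c0 mul0r addr0 => /eqP; rewrite !mulf_eq0 (negPf q1u) (negPf q1w) !orbF.
Qed.

Lemma complex_vertex_center w : W w -> is_point (center w).
Proof. by move=> [v [Bv vw _]]; apply: center_is_point (mB.2 _ Bv) vw. Qed.

Definition neighbor_data r1 r2 r3 w1 w2 v1 v2 (q1 q2 : 'M[F]_3) kap (c : vec) : Prop :=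
  [/\ [/\ vertices B v1, vertices B v2, vertex_complexification iota v1 w1
        & vertex_complexification iota v2 w2],
      [/\ r3 = - r1 - r2, transposes r1 r2 r3 w1 & transposes r2 r1 r3 w2],
      [/\ q1 \in P, q2 \in P, kap != 0, cx q1 = kap *: r1 & cx q2 = kap *: r2],
      [/\ polar_form q1 c c = 0, polar_form q2 c c != 0, r1 != 0, r2 != 0 & r2 \notin <[r1]>%VS]
    & forall z, W z -> skew_vertex PC z ->
      forall l x y u v, reflect_on z l x y -> u \in x -> v \in y -> u != 0 -> v != 0 ->
      exists k, val2 r1 r2 r3 v = k ^+ 2 * val2 r1 r2 r3 u /\
                val3 r1 r2 r3 v = - k ^+ 3 * val3 r1 r2 r3 u].

(** The centers of the two neighbors are real, hence so are the singular conics
    through them up to factors; the ratio of the factors is read off a real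
    pair exchanged by the first neighbor. *)
Lemma neighbor_conics : has_neighbor_skew_vertices PC W ->
  exists r1 r2 r3 w1 w2 v1 v2 q1 q2 kap c, neighbor_data r1 r2 r3 w1 w2 v1 v2 q1 q2 kap c.
Proof.
move=> /(neighbor_common complexified_pencil complex_vertex_center).
move=> [r1 [r2 [r3 [w1 [w2 [[[_ _ er3] r10 r21 _ _]]]]]]].
move=> [[v1 [Bv1 vw1 _]] [v2 [Bv2 vw2 _]]] [t1 t2] [on1 on2] vals.
have r20 : r2 != 0 by apply: contraNneq r21 => ->; rewrite mem0v.
have conic_through v w r : vertices B v -> vertex_complexification iota v w ->
    (forall n, n \in center w -> n != 0 -> forall S, S \in PC -> polar_form S n n = 0 -> S \in <[r]>%VS) ->
    exists q c al, [/\ q \in P, polar_form q c c = 0, al != 0, cx q = al *: r &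
      c != 0 /\ cx c \in center w].
  move=> Bv vw on; have [pc _ _ _] := mB.2 _ Bv; have [c c0 ec] := is_pointP pc.
  have [q [qP q0 qc]] := pencil_polar_zero c c isP.1.
  have [ecw _ _] := vw.
  have cw : cx c \in center w by rewrite ecw ec complexify_line memv_line.
  have cc0 : cx c != 0 by rewrite cx_eq0.
  have /vlineP[al e] : cx q \in <[r]>%VS.
    by apply: on cw cc0 _ _ _; rewrite ?mem_complexify // polar_cx qc rmorph0.
  exists q, c, al; split=> //; apply: contraNneq q0 => al0.
  by rewrite -(cx_eq0 iota) e al0 scale0r.
have [q1 [c [al [q1P q1c al0 e1 [c0 cw]]]]] := conic_through _ _ _ Bv1 vw1 on1.
have [q2 [_ [be [q2P _ be0 e2 _]]]] := conic_through _ _ _ Bv2 vw2 on2.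
have q2c : polar_form q2 c c != 0.
  apply: contraNneq r21 => z; have cc0 : cx c != 0 by rewrite cx_eq0.
  have := on1 _ cw cc0 (cx q2) (mem_complexify iota q2P).
  rewrite polar_cx z rmorph0 e2 => /(_ erefl)/(memvZ be^-1).
  by rewrite scalerA mulVf // scale1r.
have q10 : q1 != 0 by rewrite -(cx_eq0 iota) e1 scaler_eq0 negb_or al0.
have [x q1x] := polar_diag_neq0 (isP.2 _ q1P) q10.
have gx : iota (at_vec (conic_poly q1) x) != 0 by rewrite fmorph_eq0 at_conic_poly.
have [n [u [dl [_ + uc refl]]]] := vertex_line (mB.2 _ Bv1) (linepoly_at_vec iota _) gx.
rewrite fmorph_eq0 at_conic_poly => q1u.
have {}refl := refl 0; rewrite scale0r addr0 add0r in refl.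
set w := u - dl *: n in refl.
have u0 : cx u != 0 by rewrite cx_eq0; apply: contraNneq uc => ->; rewrite mem0v.
have w0 : cx w != 0.
  by rewrite cx_eq0; apply: contra uc; rewrite subr_eq0 => /eqP ->; rewrite memvZ ?memv_line.
have [rw ux wy] := vertex_complexification_pair vw1 refl (memv_line _) (memv_line _).
have [k k0 [f1 f2 _]] := t1 _ _ _ _ _ rw ux wy u0 w0.
have V1 z : iota (polar_form q1 z z) = al * polar_form r1 (cx z) (cx z).
  by rewrite -polar_cx e1 polarE.
have V2 z : iota (polar_form q2 z z) = be * polar_form r2 (cx z) (cx z).
  by rewrite -polar_cx e2 polarE.
have r1u : polar_form r1 (cx u) (cx u) != 0.
  by move: q1u; rewrite -(fmorph_eq0 iota) V1 mulf_eq0 negb_or => /andP[].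
(* The multiplier [k] of the pair [u], [w], which lies in F as a ratio of values of [q1]. *)
pose ka := - polar_form q1 w w / polar_form q1 u u.
have eka : iota ka = k.
  by rewrite fmorph_div rmorphN !V1 f1; field; rewrite al0 r1u.
(* Solving r2(w) = k (r1(u) + r2(u)) for the ratio of the factors [be] and [al]. *)
pose rho := (polar_form q2 w w / ka - polar_form q2 u u) / polar_form q1 u u.
have erho : iota rho = be / al.
  rewrite fmorph_div rmorphB fmorph_div eka !V1 !V2 f2 er3 !polarE.
  by field; rewrite al0 r1u k0.
have rho0 : rho != 0 by rewrite -(fmorph_eq0 iota) erho mulf_neq0 ?invr_eq0.
exists r1, r2, r3, w1, w2, v1, v2, (rho *: q1), q2, be, c; split=> //.
  by split; rewrite ?memvZ // map_mxZ erho e1 scalerA divfK.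
by split; rewrite // polarE q1c mulr0.
Qed.

(** The functions e_2 and e_3 of the three line pairs get the factors k^2 and -k^3, so e_2^3 / e_3^2
    is unchanged. *)
Lemma neighbor_integral r1 r2 r3 w1 w2 v1 v2 q1 q2 kap c :
  neighbor_data r1 r2 r3 w1 w2 v1 v2 q1 q2 kap c -> exists N D, rational_integral B 12 N D.
Proof.
move=> [_ [er3 _ _] [q1P q2P kap0 e1 e2] [q1c q2c r10 r20 r21] vals].
have V1 z : iota (polar_form q1 z z) = kap * polar_form r1 (cx z) (cx z).
  by rewrite -polar_cx e1 polarE.
have V2 z : iota (polar_form q2 z z) = kap * polar_form r2 (cx z) (cx z).
  by rewrite -polar_cx e2 polarE.
apply: (integral_degree12 q1P q2P).
- by rewrite -(cx_eq0 iota) e1 scaler_eq0 negb_or kap0.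
- by apply: contra q2c => /vlineP[s ->]; rewrite polarE q1c mulr0.
move=> u w [v [z [l [x [y [Bv vz sk rf [ux wy u0 w0]]]]]]] /=.
have Wz : W z by exists v; split=> //; right.
have [rz cu cw] := vertex_complexification_pair vz rf ux wy.
have cu0 : cx u != 0 by rewrite cx_eq0.
have cw0 : cx w != 0 by rewrite cx_eq0.
have [k []] := vals _ Wz sk _ _ _ _ _ rz cu cw cu0 cw0.
rewrite /val2 /val3 er3 !polarE => f2 f3.
apply: (fmorph_inj iota); rewrite !(rmorphXn, rmorphM, rmorphD) /= !V1 !V2.
set a := polar_form r1 (cx u) (cx u) in f2 f3 *; set b := polar_form r2 (cx u) (cx u) in f2 f3 *.
set a' := polar_form r1 _ _ in f2 f3 *; set b' := polar_form r2 _ _ in f2 f3 *.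
have -> : kap * a' * (kap * b') * (kap * a' + kap * b')
   = - kap ^+ 3 * (a' * b' * (- a' - b')) by ring.
have -> : (kap * a') ^+ 2 + kap * a' * (kap * b') + (kap * b') ^+ 2
   = - kap ^+ 2 * (a' * b' + b' * (- a' - b') + a' * (- a' - b')) by ring.
rewrite f2 f3; ring.
Qed.

End UpperBounds.

Section Descent.
Local Open Scope ring_scope.
Local Open Scope complex_scope.

(** Over the reals, take real or imaginary parts of the coefficients. *)
Lemma descend_relation (R : realType) (k : ground) (b1 b2 b3 : R[i]) :
  [|| b1 != 0, b2 != 0 | b3 != 0] ->
  exists c1 c2 c3 : scalars R k, [|| c1 != 0, c2 != 0 | c3 != 0] /\
    forall x1 x2 x3, b1 * embedding R k x1 + b2 * embedding R k x2 + b3 * embedding R k x3 = 0 ->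
      c1 * x1 + c2 * x2 + c3 * x3 = 0.
Proof.
case: k => /=; last by move=> nz; exists b1, b2, b3.
case: b1 b2 b3 => [r1 i1] [r2 i2] [r3 i3] nz.
have parts x1 x2 x3 : (r1 +i* i1) * real_complex R x1 + (r2 +i* i2) * real_complex R x2
    + (r3 +i* i3) * real_complex R x3 = 0 ->
    r1 * x1 + r2 * x2 + r3 * x3 = 0 /\ i1 * x1 + i2 * x2 + i3 * x3 = 0.
  rewrite /real_complex_def; simpc => /eqP; rewrite eq_complex /= => /andP[/eqP e1 /eqP e2].
  by split.
have [rz|rz] := boolP [|| r1 != 0, r2 != 0 | r3 != 0].
  by exists r1, r2, r3; split=> // x1 x2 x3 /parts[].
exists i1, i2, i3; split; last by move=> x1 x2 x3 /parts[].
move: rz nz; rewrite !negb_or !negbK => /and3P[/eqP -> /eqP -> /eqP ->].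
by rewrite !eq_complex /= !eqxx.
Qed.

End Descent.

Theorem theorem1p31 (R : realType) (k : ground)
    (P : {vspace 'M[scalars R k]_3}) (B : multibilliard (scalars R k)) :
  pencil_type (embedding R k) P B ->
  (exists g, curves B g) ->
  let PC := complexify (embedding R k) P in
  let W := complex_vertices (embedding R k) P B in
  [/\ ~ has_skew_vertex PC W -> minimal_integral_degree B 2,
      has_neighbor_skew_vertices PC W -> minimal_integral_degree B 12
    & has_skew_vertex PC W -> ~ has_neighbor_skew_vertices PC W ->
        minimal_integral_degree B 4].
Proof.
move=> [[mB isP] cB vB qc [dc _]] [g0 Bg0] PC W.
have [S0 [[S0P S00] rS0 [p0 /[dup] cp0]]] := cB _ Bg0.
move=> + curveE [tangentE _] => /curveE[pp0 on0].
have [S2 S2P S2n] := pencil_other isP.1 S0P.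
have tanE p l : tangent_line g0 p l -> tangent_at S0 p l by move=> /tangentE[].
split.
- move=> nsk; split.
    apply: (integral_degree2 isP mB cB vB S0P rS0 S2P S2n pp0 on0).
    move=> u w [v [z [l [x [y [Bv vz sk _ _]]]]]]; apply: nsk.
    by exists z => //; exists v; split=> //; right.
  move=> d N D; exact: (degree_ge2 isP mB cB Bg0 S0P rS0 S2P S2n pp0 on0 curveE tanE).
- move=> /(neighbor_conics isP mB S0P rS0 S2P S2n).
  move=> [r1 [r2 [r3 [w1 [w2 [v1 [v2 [q1 [q2 [kap [c data]]]]]]]]]]]; split.
    exact: (neighbor_integral isP mB cB vB S0P rS0 S2P S2n pp0 on0 data).
  move: data => [[Bv1 Bv2 vw1 vw2] [er3 t1 t2] [q1P q2P kap0 e1 e2] [q1c q2c r10 r20 _] _] d N D h.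
  exact: (degree_ge12 isP mB cB Bg0 S0P rS0 S2P S2n pp0 on0 curveE tanE h Bv1 Bv2 vw1 vw2 er3
    t1 t2 q1P q2P kap0 e1 e2 q1c q2c r10 r20).
move=> hsk nn.
have [Qm [Qp [pair rev]]] := skew_common (complexified_pencil (embedding R k) isP S0P rS0 S2P S2n)
  (@complex_vertex_center _ _ _ _ _ mB) qc dc hsk nn.
split.
  apply: (skew_integral isP mB cB vB S0P rS0 S2P S2n pp0 on0 pair rev hsk).
  exact: descend_relation.
move=> d N D h; have [w Ww sk] := hsk; have [v [Bv vw _]] := Ww.
exact: (degree_ge4 isP mB cB Bg0 S0P rS0 S2P S2n pp0 on0 curveE tanE h Bv vw (rev _ Ww sk) pair).
Qed.
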